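(* Let $f\in L_2(\mathbb{R}_+)$ have Mellin transform $f^*$ with $s f^*(s)\in L_2(\sigma)$. Then for all $x>0$ $$(H^2f)(x)=(\mathcal{S}_2f)(x)-\pi^2 f(x).$$
   Context: $\mathbb{R}_+=(0,\infty)$; functions are complex-valued. $\sigma=\{s\in\mathbb{C}:\mathrm{Re}\,s=1/2\}$, with $L_2(\sigma)$ taken with respect to $|ds|$. The Mellin transform of $f\in L_2(\mathbb{R}_+)$ is $f^*(s)=\int_0^\infty f(t)t^{s-1}dt$, $s\in\sigma$ (convergence in mean square in $L_2(\sigma)$), with inversion $f(x)=\frac{1}{2\pi i}\int_{\sigma}f^*(s)x^{-s}ds$. If $s f^*(s)\in L_2(\sigma)$ then $f^*\in L_1(\sigma)$, and in pointwise statements $f$ denotes the continuous function given by this inversion integral. The iterated Stieltjes transform is $(\mathcal{S}_2f)(x)=\int_0^\infty\frac{\log(x)-\log(t)}{x-t}f(t)\,dt$, $x>0$ (removable singularity at $t=x$). The Hilbert transform on the half-axis is $(Hf)(x)=\int_0^\infty\frac{f(t)}{t-x}\,dt$, $x>0$, understood as a Cauchy principal value, and $H^2f=H(Hf)$. *)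

(* Defs.v *)
From mathcomp Require Import all_boot all_order all_algebra.
From mathcomp Require Import all_classical all_reals all_analysis.
From mathcomp Require Import complex.
Import Order.TTheory GRing.Theory Num.Theory.
Import ComplexField.Normc.
Import numFieldNormedType.Exports.
Set Implicit Arguments.
Unset Strict Implicit.
Unset Printing Implicit Defensive.
Local Open Scope classical_set_scope.
Local Open Scope ring_scope.
Local Open Scope complex_scope.

(* Measurability and integration of R[i]-valued functions are componentwise,
   for Lebesgue measure on the Borel sets. *)

Section complex_functions.
Context {R : realType}.
Implicit Types (D : set R) (g : R -> R[i]).

Definition cmeasurable_fun D g : Prop :=
  measurable_fun D (fun t => complex.Re (g t)) /\
  measurable_fun D (fun t => complex.Im (g t)).

Definition cintegrable D g : Prop :=
  lebesgue_measure.-integrable D (fun t => (complex.Re (g t))%:E) /\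
  lebesgue_measure.-integrable D (fun t => (complex.Im (g t))%:E).

Definition cintegral D g : R[i] :=
  (\int[lebesgue_measure]_(t in D) complex.Re (g t))%R +i*
  (\int[lebesgue_measure]_(t in D) complex.Im (g t))%R.

Definition sqr_L2norm D g : \bar R :=
  (\int[lebesgue_measure]_(t in D) ((normc (g t)) ^+ 2)%:E)%E.

Definition in_L2 D g : Prop :=
  cmeasurable_fun D g /\ (sqr_L2norm D g < +oo)%E.

Definition Rpos : set R := `]0, +oo[.

(* x ^ s = exp (s * ln x), for x > 0. *)
Definition cpow (x : R) (s : R[i]) : R[i] :=
  (x `^ complex.Re s)%:C *
  (cos (complex.Im s * ln x) +i* sin (complex.Im s * ln x)).

End complex_functions.

Section mellin.
Context {R : realType}.
Implicit Types (f : R -> R[i]) (G : R[i] -> R[i]).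

(* Parametrisation of the line Re s = 1/2, for which |ds| = d tau and
   ds = i d tau. *)
Definition sigma (tau : R) : R[i] := 2^-1 +i* tau.

Definition in_L2_sigma G : Prop := in_L2 setT (G \o sigma).

Definition integral_sigma G : R[i] := 'i%C * cintegral setT (G \o sigma).

Definition mellin_trunc f (a b : R) (s : R[i]) : R[i] :=
  cintegral `[a, b] (fun t => f t * cpow t (s - 1)).

(* Only the values of G on the line matter, up to a null set. The truncated
   integrals tend to G in L2(sigma) when the lower bound tends to 0+ and the
   upper bound to +oo. *)
Definition is_mellin f G : Prop :=
  in_L2_sigma G /\
  sqr_L2norm setT (fun tau => mellin_trunc f p.1 p.2 (sigma tau) - G (sigma tau))
    @[p --> (0^'+, +oo)] --> 0%E.

(* The continuous representative of f when G is the Mellin transform of f and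
   s * G s is in L2(sigma). *)
Definition mellin_inv G (x : R) : R[i] :=
  (2 * (pi : R)%:C * 'i%C)^-1 * integral_sigma (fun s => G s * cpow x (- s)).

End mellin.

Section transforms.
Context {R : realType}.
Implicit Types (f : R -> R[i]) (x t e : R).

(* The value 1/x is the one that removes the singularity at t = x. *)
Definition stieltjes2_kernel x t : R :=
  if t == x then x^-1 else (ln x - ln t) / (x - t).

Definition stieltjes2_integrand f x t : R[i] := (stieltjes2_kernel x t)%:C * f t.

Definition stieltjes2 f x : R[i] := cintegral Rpos (stieltjes2_integrand f x).

Definition hilbert_integrand f x t : R[i] := f t / (t - x)%:C.

Definition off_diagonal x e : set R := Rpos `&` [set t | e < `|t - x|].

Definition hilbert_trunc f x e : R[i]^o :=
  cintegral (off_diagonal x e) (hilbert_integrand f x).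

Definition hilbert f x : R[i] := lim (hilbert_trunc f x e @[e --> 0^'+]).

(* lim and cintegral are total; this says that the principal value defining
   hilbert f x exists. *)
Definition hilbert_exists f x : Prop :=
  (forall e, 0 < e -> cintegrable (off_diagonal x e) (hilbert_integrand f x)) /\
  cvg (hilbert_trunc f x e @[e --> 0^'+]).

End transforms.

(* Main.v *)
Require Import Defs.
From HB Require Import structures.
From mathcomp Require Import all_boot all_order all_algebra.
From mathcomp Require Import all_classical all_reals all_analysis.
From mathcomp Require Import measurable_realfun.
From mathcomp Require Import complex.
From mathcomp Require Import ring lra.
Import Order.TTheory GRing.Theory Num.Theory.
Import numFieldNormedType.Exports.
Local Open Scope classical_set_scope.
Local Open Scope ring_scope.
Set Implicit Arguments.
Unset Strict Implicit.
Unset Printing Implicit Defensive.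

(** The Mellin transform on the line [Re s = 1/2] diagonalises both transforms.
    In the coordinate [u] with [t = x * exp u], a function
    [f t = t ^ (- 1/2) * F (ln t)] satisfies

      [H f x = x ^ (- 1/2) * pv int F (ln x + u) / sh2 u du],
      [S2 f x = x ^ (- 1/2) * int F (ln x + u) * u / sh2 u du],

    where [sh2 u = 2 sinh (u / 2)]. So both are convolutions, and they act on the
    Fourier transform of [F], which is the Mellin transform of [f] at
    [1/2 + i tau], as multiplication by a function of [tau]. Let
    [M tau = int sin (tau u) / sh2 u du]; by oddness [H] multiplies by [- i M] and
    [H ^ 2] by [- M ^ 2]. The multiplier of [S2] is
    [int u cos (tau u) / sh2 u du = M' tau]. Now [M tau = pi tanh (pi tau)], which
    satisfies [M' = pi ^ 2 - M ^ 2]; hence [- M ^ 2 = M' - pi ^ 2], and this is the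
    theorem.

    To have only real integrals, a Mellin transform [P + i Q] is handled through
    the real pair [P], [Q]: [hphi P Q] is the real part of the inverse transform
    and [hphi Q (- P)] its imaginary part.

    The value of [M] ([Rintegral_sin_sh2]) comes from expanding [1 / sh2] in
    exponentials and recognising the partial fractions of [tanh]
    ([tanh_partial_fractions]). The latter are obtained in an elementary way, from
    recursions for [int cosh (2 tau t) (cos t) ^ n dt] over [[0, pi / 2]] and for its
    derivative in [tau]. [M'] is computed by differentiation under the integral
    ([Rintegral_idcos_sh2]).

    Since [s * G s] is in L2 of the line, [P] and [Q] are integrable even against
    [|tau| ^ (1/4)]. This makes [F] Hoelder continuous with exponent [1/4], enough
    to subtract [F (ln x)] in the principal value and to exchange the integrals
    ([phi_sh2], [truncated_hilbert_cvg]). The result is again an inverse Mellin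
    transform with the same integrability, so the transform can be iterated.

    What is given is only that [f] is in L2 and that its truncated Mellin integrals
    converge to [G] in mean square. That [f] agrees almost everywhere with the
    inversion integral of [G] is proved by Abel summation ([fourier_inversion]): with
    the factor [exp (- eps |tau|)] the truncated inversion integral is a Poisson
    integral, the truncation is removed by L2 convergence, and after integration over a
    segment [eps] can tend to [0], which identifies the integrals of both functions
    over every segment. *)

(** * Integration of real-valued functions *)

Section tools.
Context {R : realType}.
Notation mu := (@lebesgue_measure R).
Implicit Types (f g h : R -> R) (D : set R).

(** The total inverse is [x * (x ^ 2) `^ (- 1)], also at [0] where both sides
    vanish, so measurability of real powers gives it. *)
Lemma measurable_invr : measurable_fun setT (fun x : R => x^-1).
Proof.
rewrite (_ : (fun x => _) = (fun x : R => x * (x ^+ 2) `^ (-1))).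
  apply: measurable_funM => //.
  apply: (@measurableT_comp _ _ _ _ _ _ (fun y : R => y `^ (-1))) => //.
apply/funext => x; rewrite powR_inv1 ?sqr_ge0//.
have [->|x0] := eqVneq x 0; first by rewrite invr0 mul0r.
by rewrite expr2 invfM mulrA mulfV// mul1r.
Qed.

Lemma measurable_funV d (T : measurableType d) (D : set T) (f : T -> R) :
  measurable_fun D f -> measurable_fun D (fun x => (f x)^-1).
Proof. exact: measurableT_comp measurable_invr. Qed.

Lemma measurable_sin : measurable_fun setT (@sin R).
Proof. by apply: continuous_measurable_fun; exact: continuous_sin. Qed.

Lemma measurable_cos : measurable_fun setT (@cos R).
Proof. by apply: continuous_measurable_fun; exact: continuous_cos. Qed.

Lemma integrable_le d (T : measurableType d) (m : {measure set T -> \bar R})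
    (D : set T) (f g : T -> R) : measurable D -> measurable_fun D f ->
  m.-integrable D (EFin \o g) -> (forall x, D x -> `|f x| <= g x) ->
  m.-integrable D (EFin \o f).
Proof.
move=> mD mf ig fg; apply: le_integrable ig => //; first exact/measurable_EFinP.
by move=> x Dx /=; rewrite lee_fin (le_trans (fg _ Dx))// ler_norm.
Qed.

Lemma Rintegral_dominated_cvg d (T : measurableType d)
    (m : {measure set T -> \bar R}) (D : set T) (f_ : nat -> T -> R)
    (f g : T -> R) : measurable D ->
  (forall n, measurable_fun D (f_ n)) -> measurable_fun D f ->
  {ae m, forall x, D x -> f_ ^~ x @ \oo --> f x} ->
  m.-integrable D (EFin \o g) ->
  (forall n x, D x -> `|f_ n x| <= g x) ->
  m.-integrable D (EFin \o f) /\
  (\int[m]_(x in D) f_ n x)%R @[n --> \oo] --> (\int[m]_(x in D) f x)%R.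
Proof.
move=> mD mf_ mf f_f ig f_g.
have emf n : measurable_fun D (fun x => (f_ n x)%:E) by exact/measurable_EFinP.
have emg : measurable_fun D (EFin \o f) by exact/measurable_EFinP.
have ecv : {ae m, forall x, D x -> (fun n => (f_ n x)%:E) @ \oo --> (f x)%:E}.
  apply: filterS f_f => x fx Dx; apply: cvg_EFin; first exact: nearW.
  exact: fx.
have edom : {ae m, forall x n, D x -> (`|(f_ n x)%:E| <= (EFin \o g) x)%E}.
  by apply: aeW => x n Dx; rewrite /= lee_fin f_g.
have [i1 _ i3] := @dominated_convergence _ _ _ m D mD
  (fun n x => (f_ n x)%:E) (EFin \o f) (EFin \o g) emf emg ecv ig edom.
split=> //.
apply: fine_cvg; rewrite fineK//; exact: integrable_fin_num.
Qed.

End tools.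

Section integrable_real.
Context {R : realType} d (T : measurableType d) (m : {measure set T -> \bar R}).
Variables (D : set T).
Hypothesis mD : measurable D.
Implicit Types f g : T -> R.

Lemma integrable_fD f g : m.-integrable D (EFin \o f) -> m.-integrable D (EFin \o g) ->
  m.-integrable D (EFin \o (fun x => f x + g x)).
Proof. by move=> hf hg; apply: eq_integrable (integrableD mD hf hg). Qed.

Lemma integrable_fB f g : m.-integrable D (EFin \o f) -> m.-integrable D (EFin \o g) ->
  m.-integrable D (EFin \o (fun x => f x - g x)).
Proof. by move=> hf hg; apply: eq_integrable (integrableB mD hf hg). Qed.

Lemma integrable_fZl k f : m.-integrable D (EFin \o f) ->
  m.-integrable D (EFin \o (fun x => k * f x)).
Proof. by move=> hf; apply: eq_integrable (integrableZl mD k hf). Qed.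

Lemma integrable_fZr k f : m.-integrable D (EFin \o f) ->
  m.-integrable D (EFin \o (fun x => f x * k)).
Proof. by move=> hf; apply: eq_integrable (integrableZr mD k hf). Qed.

End integrable_real.

(** * Integration against a density *)

Section density.
Local Open Scope ereal_scope.
Context d (T : measurableType d) (R : realType) (m nu : {measure set T -> \bar R}).
Variables (g : T -> \bar R).
Hypotheses (mg : measurable_fun setT g) (g0 : forall x, 0 <= g x)
  (gfin : forall x, g x \is a fin_num).
Hypothesis nuE : forall A, measurable A -> nu A = \int[m]_(x in A) g x.
Import HBNNSimple.

Let nnsfun_density (h : {nnsfun T >-> R}) :
  \int[nu]_x (h x)%:E = \int[m]_x ((h x)%:E * g x).
Proof.
have mh r : measurable (h @^-1` [set r]) by exact: measurable_sfunP.
have h0 r x : 0 <= r%:E * (\1_(h @^-1` [set r]) x)%:E.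
  have [r0|r0] := leP 0%R r; first by rewrite mule_ge0 ?lee_fin.
  rewrite indicE memNset ?mule0//= => hx.
  by have : (0 <= h x)%R by []; rewrite hx leNgt r0.
have gE r : nu (h @^-1` [set r]) = \int[m]_x ((\1_(h @^-1` [set r]) x)%:E * g x).
  rewrite nuE// integral_mkcond; apply: eq_integral => x _.
  by rewrite patchE indicE; case: (x \in _); rewrite ?mul1e ?mul0e.
rewrite integralT_nnsfun sintegralE.
transitivity (\sum_(r \in range h) \int[m]_x (r%:E * (\1_(h @^-1` [set r]) x)%:E * g x)).
  apply: eq_fsbigr => r; rewrite inE => -[y _ <-]; rewrite gE -ge0_integralZl//.
  - by apply: eq_integral => x _; rewrite muleA.
  - by apply: emeasurable_funM => //; exact/measurable_EFinP/measurable_indic.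
  - by move=> x _; rewrite mule_ge0 ?lee_fin.
  - by rewrite lee_fin.
rewrite -ge0_integral_fsum//.
- apply: eq_integral => x _; rewrite -ge0_mule_fsuml//; congr (_ * _).
  by rewrite [in RHS]fimfunE -fsumEFin//; apply: eq_fsbigr => r _; rewrite EFinM.
- move=> r; apply: emeasurable_funM => //; apply: emeasurable_funM => //.
  exact/measurable_EFinP/measurable_indic.
- by move=> r x _; rewrite mule_ge0.
Qed.

(** True by definition on indicators, hence on simple functions, hence in general
    by monotone convergence. *)
Lemma ge0_integral_density (f : T -> \bar R) :
  measurable_fun setT f -> (forall x, 0 <= f x) ->
  \int[nu]_x f x = \int[m]_x (f x * g x).
Proof.
move=> mf f0; pose h := nnsfun_approx measurableT mf.
have hf x : (h n x)%:E @[n --> \oo] --> f x by exact: cvg_nnsfun_approx.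
have mh n : measurable_fun setT (fun x => (h n x)%:E) by exact/measurable_EFinP.
have hh x : {homo (fun n => (h n x)%:E) : n k / (n <= k)%N >-> n <= k}.
  by move=> n k nk; rewrite lee_fin; exact/lefP/nd_nnsfun_approx.
have c1 : \int[nu]_x (h n x)%:E @[n --> \oo] --> \int[nu]_x f x.
  rewrite (eq_integral (fun x => lim ((h n x)%:E @[n --> \oo]))); last first.
    by move=> x _; apply/esym/cvg_lim.
  by apply: cvg_monotone_convergence => // n x _; rewrite lee_fin.
have c2 : \int[m]_x ((h n x)%:E * g x) @[n --> \oo] --> \int[m]_x (f x * g x).
  rewrite (eq_integral (fun x => lim ((h n x)%:E * g x @[n --> \oo]))); last first.
    by move=> x _; apply/esym/cvg_lim => //; apply: cvgeZr.
  apply: cvg_monotone_convergence => //.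
  - by move=> n; exact: emeasurable_funM.
  - by move=> n x _; rewrite mule_ge0 ?lee_fin.
  - by move=> x _ n k nk; rewrite lee_wpmul2r//; exact: hh.
have e : (fun n => \int[nu]_x (h n x)%:E) = (fun n => \int[m]_x ((h n x)%:E * g x)).
  by apply/funext => n; exact: nnsfun_density.
by rewrite e in c1; exact: cvg_unique c1 c2.
Qed.

End density.

(** * The fundamental theorem of calculus, and the substitution t = x exp u *)

Section ftc_total.
Context {R : realType}.
Notation mu := (@lebesgue_measure R).
Implicit Types (f F : R -> R).

Lemma is_derive_continuous f F : (forall x, is_derive x (1 : R) F (f x)) ->
  continuous F.
Proof.
move=> dF x; apply/differentiable_continuous/derivable1_diffP.
exact: ex_derive.
Qed.

Lemma is_derive_derive1 f F : (forall x, is_derive x (1 : R) F (f x)) ->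
  derive1 F =1 f.
Proof. by move=> dF x; rewrite derive1E; exact: derive_val. Qed.

Lemma integral_segment_is_derive f F a b : a <= b ->
  (forall x, is_derive x (1 : R) F (f x)) -> continuous f ->
  (\int[mu]_(x in `[a, b]) (f x)%:E = (F b - F a)%:E)%E.
Proof.
rewrite le_eqVlt => /predU1P[<-|ab] dF cf.
  by rewrite set_itv1 integral_set1 subrr.
have cF := is_derive_continuous dF.
rewrite EFinB; apply: continuous_FTC2 => //.
- by apply: continuous_subspaceT.
- split.
  + by move=> x _; exact: ex_derive.
  + by apply: cvg_at_right_filter; exact: cF.
  + by apply: cvg_at_left_filter; exact: cF.
- by move=> x _; exact: is_derive_derive1.
Qed.

Lemma Rintegral_segment_is_derive f F a b : a <= b ->
  (forall x, is_derive x (1 : R) F (f x)) -> continuous f ->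
  \int[mu]_(x in `[a, b]) f x = F b - F a.
Proof.
by move=> ab dF cf; rewrite /Rintegral (integral_segment_is_derive ab dF).
Qed.

(** For a nonnegative integrand, integrability is the existence of the limit of
    the primitive. *)
Lemma integral_halfline_is_derive f F (a l : R) :
  (forall x, a <= x -> 0 <= f x) ->
  (forall x, is_derive x (1 : R) F (f x)) -> continuous f ->
  F x @[x --> +oo] --> l ->
  (\int[mu]_(x in `[a, +oo[) (f x)%:E = (l - F a)%:E)%E.
Proof.
move=> f0 dF cf Fl; have cF := is_derive_continuous dF.
rewrite EFinB; apply: ge0_continuous_FTC2y => //.
- by apply: continuous_subspaceT.
- by apply: cvg_at_right_filter; exact: cF.
- by move=> x _; exact: is_derive_derive1.
Qed.

End ftc_total.

Section exponential_substitution.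
Context {R : realType}.
Notation mu := (@lebesgue_measure R).
Variables (x : R).
Hypothesis x0 : 0 < x.
Let E : R -> R := fun u => x * expR u.

Let dE u : is_derive u (1 : R) E (E u).
Proof.
rewrite /E; apply: is_derive_eq. by rewrite -[LHS]/(x * expR u).
Qed.

Let cE : continuous E. Proof. exact: is_derive_continuous dE. Qed.
Let mE : measurable_fun setT E. Proof. exact: continuous_measurable_fun. Qed.
Let E0 u : 0 < E u. Proof. by rewrite mulr_gt0// expR_gt0. Qed.
Let g u := (E u)%:E.
Let mg : measurable_fun setT g. Proof. exact/measurable_EFinP. Qed.
Let g0 u : (0 <= g u)%E. Proof. by rewrite lee_fin ltW. Qed.

Let Eln y : 0 < y -> E (ln (y / x)) = y.
Proof. by move=> y0; rewrite /E lnK ?posrE ?divr_gt0// mulrCA mulfV ?mulr1// gt_eqF. Qed.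
Let ltE u v : (E u < E v) = (u < v). Proof. by rewrite /E ltr_pM2l// ltr_expR. Qed.
Let leE u v : (E u <= E v) = (u <= v). Proof. by rewrite /E ler_pM2l// ler_expR. Qed.

(** The image of the measure [E u du] under [E u = x * exp u] is computed on
    half-open intervals, where it agrees with Lebesgue measure on the positive
    axis; this transfers the substitution from continuous integrands to Borel
    ones. *)
Let dens : set (measurableTypeR R) -> \bar R := fun A => (\int[mu]_(u in A) g u)%E.

Let dens0 : dens set0 = 0%E. Proof. exact: integral_set0. Qed.
Let dens_ge0 A : (0 <= dens A)%E. Proof. exact: integral_ge0. Qed.
Let dens_sigma : semi_sigma_additive dens.
Proof. apply: (@semi_sigma_additive_nng_induced _ _ _ mu g mg). exact: g0. Qed.

HB.instance Definition _ := isMeasure.Build _ _ _ dens dens0 dens_ge0 dens_sigma.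

Let nu : {measure set (measurableTypeR R) -> \bar R} :=
  measure_function_pushforward__canonical__measure_function_Measure dens
    (mE : measurable_fun setT (E : R -> measurableTypeR R)).

Let nuE A : nu A = (\int[mu]_(u in E @^-1` A) g u)%E.
Proof. by []. Qed.

Let nu_itv_pos a b : 0 < a -> a <= b -> nu `]a, b]%classic = (b - a)%:E.
Proof.
move=> a0 ab; have b0 := lt_le_trans a0 ab; rewrite nuE.
have -> : E @^-1` `]a, b] = `]ln (a / x), ln (b / x)]%classic.
  apply/seteqP; split => u /=; rewrite !in_itv/=.
    by rewrite -{1}(Eln a0) -{1}(Eln b0) ltE leE.
  by rewrite -{2}(Eln a0) -{2}(Eln b0) ltE leE.
rewrite integral_itv_obnd_cbnd; last by apply: measurable_funTS.
rewrite (integral_segment_is_derive _ dE cE) ?Eln//.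
by rewrite -leE !Eln.
Qed.

Let dEN u : is_derive u (1 : R) (fun v => - E (- v)) (E (- u)).
Proof. rewrite /E; apply: is_derive_eq; rewrite /GRing.scale/=; ring. Qed.

Let nu_itv_neg a b : a <= 0 -> 0 < b -> nu `]a, b]%classic = b%:E.
Proof.
move=> a0 b0; rewrite nuE.
have -> : E @^-1` `]a, b] = `]-oo, ln (b / x)]%classic.
  apply/seteqP; split => u /=; rewrite !in_itv/=.
    by rewrite -{1}(Eln b0) leE => /andP[].
  by rewrite (le_lt_trans a0)//= -{2}(Eln b0) leE.
rewrite -[ln (b / x)]opprK ge0_integration_by_substitutionNy//; last 2 first.
- exact: continuous_subspaceT.
- by move=> u; rewrite ltW.
rewrite (@integral_halfline_is_derive _ _ _ _ 0 _ dEN) //.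
- by rewrite !opprK Eln// add0r.
- by move=> ? _; rewrite ltW.
- by move=> u; apply: continuous_comp; [exact: opp_continuous|exact: cE].
- rewrite (_ : (fun v => _) = (fun v => - x * expR (- v))); last first.
    by apply/funext => v; rewrite /E mulNr.
  by rewrite -(mulr0 (- x)); apply: cvgM; [exact: cvg_cst|exact: cvgr_expR].
Qed.

(** Lebesgue measure is determined by its values on half-open intervals; the
    image measure misses the nonpositive half-line, so the restriction of
    Lebesgue measure to that half-line is added before comparing. *)
Lemma lebesgue_measure_exp_image (A : set R) : measurable A -> A `<=` `]0, +oo[ ->
  mu A = (\int[mu]_(u in E @^-1` A) g u)%E.
Proof.
move=> mA A0.
pose nu' : {measure set (measurableTypeR R) -> \bar R} :=
  measure_add nu (mrestr mu (measurable_itv `]-oo, 0])).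
have nu'E B : nu' B = (nu B + mu (B `&` `]-oo, 0%R]%classic))%E.
  by rewrite /nu' /measure_add/= /msum/= !big_ord_recl big_ord0/= addr0.
have -> : mu A = nu' A.
  apply: lebesgue_measure_unique mA => _ [[a b] _ <-].
  rewrite nu'E; move: a b => /= a b.
  have [ba|ab] := leP b a.
    have -> : `]a, b]%classic = set0 by rewrite set_itv_ge// bnd_simp -leNgt.
    by rewrite set0I (measure0 nu) (measure0 mu) adde0.
  have muab : mu `]a, b]%classic = (b - a)%:E.
    by rewrite lebesgue_measure_itv/= lte_fin ab.
  apply: (etrans muab).
  have [a0|a0] := ltP 0 a.
    rewrite nu_itv_pos//; last exact: ltW.
    rewrite (_ : _ `&` _ = set0) ?measure0 ?adde0//.
    apply/seteqP; split => // u /=; rewrite !in_itv/= => -[/andP[au _] u0].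
    by have := lt_le_trans au u0; rewrite ltNge (ltW a0).
  have [b0|b0] := ltP 0 b.
    rewrite nu_itv_neg// (_ : _ `&` _ = `]a, 0]%classic).
      rewrite lebesgue_measure_itv/= lte_fin; case: ltgtP a0 => // [a0 _|-> _].
        by rewrite add0e.
      by rewrite subr0 adde0.
    apply/seteqP; split => u /=; rewrite !in_itv/=.
      by move=> [/andP[-> _] ->].
    by move=> /andP[-> u0]; rewrite u0 (le_trans u0 (ltW b0)).
  rewrite nuE (_ : _ @^-1` _ = set0).
    rewrite integral_set0 add0e (_ : _ `&` _ = `]a, b]%classic).
      exact/esym/muab.
    apply/seteqP; split => u /=; rewrite !in_itv/=; first by case.
    by move=> /andP[au ub]; rewrite au ub (le_trans ub).
  apply/seteqP; split => // u /=; rewrite !in_itv/= => /andP[_ ub].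
  by have := le_trans ub b0; rewrite leNgt E0.
rewrite nu'E (_ : A `&` _ = set0) ?measure0 ?adde0//.
apply/seteqP; split => // u [/A0]/=; rewrite !in_itv/= andbT => u0.
by rewrite leNgt u0.
Qed.

Lemma ge0_integral_exp_subst (F : R -> \bar R) :
  measurable_fun (`]0, +oo[%classic : set R) F -> (forall t, 0 < t -> (0 <= F t)%E) ->
  (\int[mu]_(t in `]0%R, +oo[) F t = \int[mu]_u (F (x * expR u)%R * (x * expR u)%:E))%E.
Proof.
move=> mF F0.
have E0oo : E @^-1` `]0, +oo[ = [set: R].
  by apply/seteqP; split => // u _ /=; rewrite in_itv/= andbT.
rewrite (eq_measure_integral nu); last first.
  by move=> A mA A0; exact: lebesgue_measure_exp_image.
rewrite (@ge0_integral_pushforward _ _ (measurableTypeR R) (measurableTypeR R)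
  R E mE dens)//; last first.
  by move=> t; rewrite inE/= in_itv/= andbT; exact: F0.
rewrite E0oo (@ge0_integral_density _ _ _ mu dens g mg g0)//.
  apply: (measurable_comp _ _ mF mE); first exact: measurable_itv.
  by move=> _ [u _ <-]; rewrite /= in_itv/= andbT.
by move=> u; exact: F0.
Qed.

End exponential_substitution.

(** * Signed integrands, reflection, and Fubini for dominated kernels *)

Section substitution_signed.
Context {R : realType}.
Notation mu := (@lebesgue_measure R).
Notation Rp := (`]0%R, +oo[%classic : set R).

Section exponential.
Variables (x : R).
Hypothesis x0 : 0 < x.
Implicit Type F : R -> R.
Let E u := x * expR u.
Let E0 u : 0 < E u. Proof. by rewrite mulr_gt0// expR_gt0. Qed.

Let mcomp F : measurable_fun Rp F -> measurable_fun setT (fun u => F (E u) * E u).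
Proof.
move=> mF; have mE : measurable_fun setT E by exact: measurable_funM.
apply: measurable_funM => //.
apply: (measurable_comp _ _ mF mE); first exact: measurable_itv.
by move=> _ [u _ <-]; rewrite /= in_itv/= andbT.
Qed.

(** The factor [E u] is positive, so it commutes with taking positive and negative
    parts. *)
Lemma integral_exp_subst F : measurable_fun Rp F ->
  (\int[mu]_(t in Rp) (F t)%:E = \int[mu]_u (F (E u) * E u)%:E)%E.
Proof.
move=> mF; rewrite [LHS]integralE [RHS]integralE.
rewrite !(ge0_integral_exp_subst x0)//.
- have M a u : Num.max a 0 * E u = Num.max (a * E u) 0.
    by rewrite maxr_pMl ?mul0r// ltW.
  congr (_ - _)%E; apply: eq_integral => u _.
    by rewrite !funeposE -!EFin_max -EFinM M.
  by rewrite !funenegE -!EFinN -!EFin_max -EFinM M mulNr.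
- exact/measurable_funeneg/measurable_EFinP.
- exact/measurable_funepos/measurable_EFinP.
Qed.

Lemma Rintegral_exp_subst F : measurable_fun Rp F ->
  \int[mu]_(t in Rp) F t = \int[mu]_u (F (E u) * E u).
Proof. by move=> mF; rewrite /Rintegral integral_exp_subst. Qed.

Lemma integrable_exp_subst F : measurable_fun Rp F ->
  mu.-integrable Rp (EFin \o F) <->
  mu.-integrable setT (EFin \o (fun u => F (E u) * E u)).
Proof.
move=> mF.
have e : (\int[mu]_(t in Rp) `|(F t)%:E| = \int[mu]_u `|(F (E u) * E u)%:E|)%E.
  rewrite (ge0_integral_exp_subst x0)//.
    by apply: eq_integral => u _; rewrite -[RHS]/(`|_|%:E) normrM (ger0_norm (ltW (E0 u))).
  by apply: measurableT_comp => //; exact/measurable_EFinP.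
split => /integrableP[_ iF]; apply/integrableP; split.
- by apply/measurable_EFinP; exact: mcomp.
- by rewrite /= -e.
- exact/measurable_EFinP.
- by rewrite /= e.
Qed.

End exponential.

Section reflection.
Implicit Type f : R -> R.

Let mN : measurable_fun setT (-%R : R -> measurableTypeR R).
Proof. exact: oppr_measurable. Qed.

Let ge0_integral_opp (F : R -> \bar R) : measurable_fun setT F ->
  (forall t, (0 <= F t)%E) -> (\int[mu]_t F (- t)%R = \int[mu]_t F t)%E.
Proof.
move=> mF F0.
have := @ge0_integral_pushforward _ _ (measurableTypeR R) (measurableTypeR R)
  R -%R mN mu setT F measurableT mF (fun _ _ => F0 _).
rewrite preimage_setT => <-.
by apply: eq_measure_integral => A mA _; exact: lebesgue_measureN.
Qed.

Lemma integral_opp f : measurable_fun setT f ->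
  (\int[mu]_t (f (- t))%:E = \int[mu]_t (f t)%:E)%E.
Proof.
move=> mf; rewrite [LHS]integralE [RHS]integralE; congr (_ - _)%E.
  rewrite -[RHS]ge0_integral_opp//.
    by apply: eq_integral => t _; rewrite !funeposE.
  exact/measurable_funepos/measurable_EFinP.
rewrite -[RHS]ge0_integral_opp//.
  by apply: eq_integral => t _; rewrite !funenegE.
exact/measurable_funeneg/measurable_EFinP.
Qed.

Lemma Rintegral_opp f : measurable_fun setT f ->
  \int[mu]_t f (- t) = \int[mu]_t f t.
Proof. by move=> mf; rewrite /Rintegral integral_opp. Qed.

Lemma Rintegral_odd f : mu.-integrable setT (EFin \o f) ->
  (forall t, f (- t) = - f t) -> \int[mu]_t f t = 0.
Proof.
move=> fi fN; have /measurable_EFinP mf := measurable_int _ fi.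
have : \int[mu]_t f t = - \int[mu]_t f t.
  rewrite -mulN1r -RintegralZl// -Rintegral_opp//.
  by apply: eq_Rintegral => t _; rewrite fN mulN1r.
by move/eqP; rewrite -addr_eq0 -mulr2n mulrn_eq0/= => /eqP.
Qed.

Let setT_halves : [set: R] = `]-oo, 0%R[%classic `|` `[0%R, +oo[%classic.
Proof.
by apply/seteqP; split => // t _ /=; rewrite !in_itv/= andbT; case: ltP; [left|right].
Qed.

Lemma ge0_integral_even (F : R -> \bar R) : measurable_fun setT F ->
  (forall t, (0 <= F t)%E) -> (forall t, F (- t)%R = F t) ->
  (\int[mu]_t F t = 2%:E * \int[mu]_(t in `[0%R, +oo[) F t)%E.
Proof.
move=> mF F0 FN.
rewrite setT_halves ge0_integral_setU//=; last 2 first.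
- by rewrite -setT_halves.
- apply/disj_setPS => t [/=]; rewrite !in_itv/= andbT => t0.
  by rewrite leNgt t0.
rewrite integral_itv_bndo_bndc; last exact: measurable_funTS.
rewrite -[X in (X + _)%E](_ : \int[mu]_(t in `[0%R, +oo[) F t = _)%E; last first.
  rewrite ge0_integration_by_substitution0//.
  by apply: eq_integral => t _; rewrite FN.
by rewrite -mule2n mule_natl.
Qed.

Lemma integrable_even f : measurable_fun setT f -> (forall t, f (- t) = f t) ->
  mu.-integrable `[0%R, +oo[ (EFin \o f) -> mu.-integrable setT (EFin \o f).
Proof.
move=> mf fN /integrableP[_ fi]; apply/integrableP; split.
  exact/measurable_EFinP.
rewrite ge0_integral_even//; last 2 first.
- by apply: measurableT_comp => //; exact/measurable_EFinP.
- by move=> t /=; rewrite fN.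
by rewrite lte_mul_pinfty.
Qed.

Lemma Rintegral_even f : mu.-integrable setT (EFin \o f) ->
  (forall t, f (- t) = f t) ->
  \int[mu]_t f t = 2 * \int[mu]_(t in `[0, +oo[) f t.
Proof.
move=> fi fN; have /measurable_EFinP mf := measurable_int _ fi.
have fi0 : mu.-integrable `[0%R, +oo[ (EFin \o f).
  by apply: integrableS fi.
have fi1 : mu.-integrable `]-oo, 0%R[ (EFin \o f).
  by apply: integrableS fi.
rewrite setT_halves Rintegral_setU//=; last 2 first.
- by rewrite -setT_halves.
- apply/disj_setPS => t [/=]; rewrite !in_itv/= andbT => t0.
  by rewrite leNgt t0.
rewrite mulr_natl mulr2n; congr (_ + _).
rewrite Rintegral_itv_bndo_bndc//.
rewrite Rintegral_mkcond [RHS]Rintegral_mkcond -Rintegral_opp; last first.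
  apply/(measurable_restrictT f) => //. exact: measurable_funTS.
apply: eq_Rintegral => t _; rewrite !patchE !mem_setE !in_itv/= andbT.
by rewrite oppr_le0 fN.
Qed.

End reflection.
End substitution_signed.

Section product_dominated.
Context d1 d2 (T1 : measurableType d1) (T2 : measurableType d2) (R : realType).
Variables (m1 : {sigma_finite_measure set T1 -> \bar R})
  (m2 : {sigma_finite_measure set T2 -> \bar R}).
Variables (K : T1 -> T2 -> R) (a : T1 -> R) (b : T2 -> R).
Hypotheses (mK : measurable_fun setT (fun z : T1 * T2 => K z.1 z.2))
  (ia : m1.-integrable setT (EFin \o a)) (ib : m2.-integrable setT (EFin \o b))
  (Kab : forall x y, `|K x y| <= a x * b y).

Let iK : (m1 \x m2)%E.-integrable setT (fun z => (K z.1 z.2)%:E).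
Proof.
apply/integrable12ltyP; first exact/measurable_EFinP.
have ma := measurable_int _ ia; have mb := measurable_int _ ib.
have mb' : measurable_fun setT (fun y => `|(b y)%:E|)%E by exact: measurableT_comp mb.
have ma' : measurable_fun setT (fun x => `|(a x)%:E|)%E by exact: measurableT_comp ma.
apply: (@le_lt_trans _ _ (\int[m1]_x (`|(a x)%:E| * \int[m2]_y `|(b y)%:E|))%E).
  apply: ge0_le_integral => //.
  - by move=> x _; exact: integral_ge0.
  - apply: (@measurable_fun_fubini_tonelli_F _ _ _ _ _ m2
      (fun z => `|(K z.1 z.2)%:E|)%E) => //.
    by apply: measurableT_comp => //; exact/measurable_EFinP.
  - exact: emeasurable_funM.
  - move=> x _; rewrite -ge0_integralZl//.
    apply: ge0_le_integral => //.
    + apply: measurableT_comp => //; apply/measurable_EFinP.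
      exact (measurable_fun_pair2 x mK).
    + exact: emeasurable_funM.
    + move=> y _; rewrite -EFinM lee_fin (le_trans (Kab x y))//.
      by rewrite (le_trans (ler_norm _))// normrM.
move/integrableP : ia => [_ ia']; move/integrableP : ib => [_ ib'].
rewrite ge0_integralZr//.
  by rewrite lte_mul_pinfty// ?integral_ge0// ge0_fin_numE// integral_ge0.
exact: integral_ge0.
Qed.

Lemma measurable_section1 x : measurable_fun setT (K x).
Proof. exact (measurable_fun_pair2 x mK). Qed.

Lemma measurable_section2 y : measurable_fun setT (K ^~ y).
Proof. exact (measurable_fun_pair1 y mK). Qed.

Lemma integrable_section1 x : m2.-integrable setT (EFin \o K x).
Proof.
apply: (@integrable_le _ _ _ _ _ _ (fun y => a x * b y)) => //.
  exact: measurable_section1.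
by rewrite /comp; under eq_fun do rewrite EFinM; exact: integrableZl.
Qed.

Lemma integrable_section2 y : m1.-integrable setT (EFin \o K ^~ y).
Proof.
apply: (@integrable_le _ _ _ _ _ _ (fun x => a x * b y)) => //.
  exact: measurable_section2.
by rewrite /comp; under eq_fun do rewrite EFinM; exact: integrableZr.
Qed.

Lemma integrable_Rintegral1 :
  m1.-integrable setT (EFin \o (fun x => \int[m2]_y K x y)).
Proof.
apply: eq_integrable (integrable_fubini_F iK) => //= x _.
by rewrite /fubini_F fineK//; apply: integrable_fin_num => //; exact: integrable_section1.
Qed.

(** A majorant of product form is integrable for the product measure. *)
Lemma Rfubini : \int[m1]_x (\int[m2]_y K x y) = \int[m2]_y (\int[m1]_x K x y).
Proof.
rewrite /Rintegral.
have := Fubini iK => /= fub.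
transitivity (fine (\int[m1]_x \int[m2]_y (K x y)%:E))%E.
  congr fine; apply: eq_integral => x _; rewrite fineK//.
  by apply: integrable_fin_num => //; exact: integrable_section1.
rewrite fub; congr fine; apply: eq_integral => y _; rewrite fineK//.
by apply: integrable_fin_num => //; exact: integrable_section2.
Qed.

End product_dominated.

(** * Partial fractions of the hyperbolic tangent *)

Global Instance is_derive_powf {R : realType} (f : R -> R) (n : nat) (t df : R) :
  is_derive t (1 : R) f df ->
  is_derive t (1 : R) (fun u => f u ^+ n) (n%:R * f t ^+ n.-1 * df).
Proof.
case: n => [|n] dF.
  by rewrite !mul0r; exact: is_derive_cst.
rewrite (_ : (fun u => _) = f ^+ n.+1); last first.
  by apply/funext => u; rewrite fctE.
exact: is_derive_eq.
Qed.

Section mittag_leffler_tanh.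
Context {R : realType}.
Notation mu := (@lebesgue_measure R).
Variable tau : R.
Let c : R := 2 * tau.
Let ch t := expR (c * t) + expR (- (c * t)).
Let sh t := expR (c * t) - expR (- (c * t)).

Let dch t : is_derive t (1 : R) ch (c * sh t).
Proof. by apply: is_derive_eq; rewrite /sh /GRing.scale/=; ring. Qed.
Let dsh t : is_derive t (1 : R) sh (c * ch t).
Proof. by apply: is_derive_eq; rewrite /ch /GRing.scale/=; ring. Qed.

Let cch : continuous ch. Proof. exact: is_derive_continuous dch. Qed.
Let csh : continuous sh. Proof. exact: is_derive_continuous dsh. Qed.
Let ccos n : continuous (fun t : R => cos t ^+ n).
Proof.
move=> t; apply: (@continuous_comp _ _ _ cos (fun y => y ^+ n)).
  exact: continuous_cos.
exact: exprn_continuous.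
Qed.
Let cid : continuous (fun t : R => 2 * t).
Proof. by move=> t; apply: cvgM; [exact: cvg_cst|exact: cvg_id]. Qed.
Let cfi n : continuous (fun t : R => ch t * cos t ^+ n).
Proof. by move=> t; apply: cvgM; [exact: cch|exact: ccos]. Qed.
Let cfj n : continuous (fun t : R => 2 * t * sh t * cos t ^+ n).
Proof.
by move=> t; apply: cvgM; [apply: cvgM; [exact: cid|exact: csh]|exact: ccos].
Qed.
Let S : set R := `[0, pi / 2].
Let mS : measurable S. Proof. exact: measurable_itv. Qed.
Let piS : 0 <= pi / 2 :> R. Proof. by rewrite divr_ge0// pi_ge0. Qed.

Let intS f : continuous f -> mu.-integrable S (EFin \o f).
Proof.
move=> cf; apply: continuous_compact_integrable; first exact: segment_compact.
exact: continuous_subspaceT.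
Qed.

Let I n := \int[mu]_(t in S) (ch t * cos t ^+ n).
Let J n := \int[mu]_(t in S) (2 * t * sh t * cos t ^+ n).

Let FTC f F : (forall t, is_derive t (1 : R) F (f t)) -> continuous f ->
  \int[mu]_(t in S) f t = F (pi / 2) - F 0.
Proof. exact: Rintegral_segment_is_derive. Qed.

Let ch0 : ch 0 = 2. Proof. by rewrite /ch mulr0 oppr0 expR0. Qed.
Let sh0 : sh 0 = 0. Proof. by rewrite /sh mulr0 oppr0 expR0 subrr. Qed.

(** Two integrations by parts; the primitive [F] is the sum of the two boundary
    terms. *)
Let I_rec n : (n.+2%:R ^+ 2 + c ^+ 2) * I n.+2 = n.+2%:R * n.+1%:R * I n.
Proof.
pose F t := c * sh t * cos t ^+ n.+2 + n.+2%:R * ch t * cos t ^+ n.+1 * sin t.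
pose f t := (n.+2%:R ^+ 2 + c ^+ 2) * (ch t * cos t ^+ n.+2)
            - n.+2%:R * n.+1%:R * (ch t * cos t ^+ n).
have dF t : is_derive t (1 : R) F (f t).
  apply: is_derive_eq; rewrite /f /GRing.scale/=.
  have cs := sin2cos2 t.
  rewrite !exprS. rewrite -[n.+2]addn2 -[n.+1]addn1 !natrD.
  rewrite /ch /sh. ring: cs.
have cf : continuous f.
  move=> t; apply: cvgB; apply: cvgM; (try exact: cvg_cst); exact: cfi.
have := FTC dF cf.
rewrite /F sh0 sin0 cos_pihalf !expr0n/= !(mul0r, mulr0, addr0, subr0).
rewrite /f RintegralB//; last 2 first.
- by apply: (@intS (fun t => _ * _)) => t; apply: cvgM; [exact: cvg_cst|exact: cfi].
- by apply: (@intS (fun t => _ * _)) => t; apply: cvgM; [exact: cvg_cst|exact: cfi].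
rewrite !RintegralZl//; try by apply: intS; exact: cfi.
by move/eqP; rewrite subr_eq0 => /eqP.
Qed.

(** The derivative of [I_rec] with respect to [tau], obtained from the primitive
    of [I_rec] differentiated in [tau]. *)
Let J_rec n : (n.+2%:R ^+ 2 + c ^+ 2) * J n.+2 + 4 * c * I n.+2
  = n.+2%:R * n.+1%:R * J n.
Proof.
pose F t := (2 * sh t + c * (2 * t) * ch t) * cos t ^+ n.+2
  + n.+2%:R * (2 * t * sh t) * cos t ^+ n.+1 * sin t.
pose f t := (n.+2%:R ^+ 2 + c ^+ 2) * (2 * t * sh t * cos t ^+ n.+2)
            + 4 * c * (ch t * cos t ^+ n.+2)
            - n.+2%:R * n.+1%:R * (2 * t * sh t * cos t ^+ n).
have dF t : is_derive t (1 : R) F (f t).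
  apply: is_derive_eq; rewrite /f /GRing.scale/=.
  have cs := sin2cos2 t.
  rewrite !exprS -[n.+2]addn2 -[n.+1]addn1 !natrD.
  rewrite /ch /sh; ring: cs.
have ic1 : mu.-integrable S (EFin \o (fun t => (n.+2%:R ^+ 2 + c ^+ 2) * (2 * t * sh t * cos t ^+ n.+2))).
  by apply: intS => t; apply: cvgM; [exact: cvg_cst|exact: cfj].
have ic2 : mu.-integrable S (EFin \o (fun t => 4 * c * (ch t * cos t ^+ n.+2))).
  by apply: intS => t; apply: cvgM; [exact: cvg_cst|exact: cfi].
have ic3 : mu.-integrable S (EFin \o (fun t => n.+2%:R * n.+1%:R * (2 * t * sh t * cos t ^+ n))).
  by apply: intS => t; apply: cvgM; [exact: cvg_cst|exact: cfj].
have cf : continuous f.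
  move=> t; apply: cvgB; [apply: cvgD|]; (apply: cvgM; first exact: cvg_cst).
  - exact: cfj.
  - exact: cfi.
  - exact: cfj.
have := FTC dF cf.
rewrite /F sh0 sin0 cos_pihalf !expr0n/= !(mul0r, mulr0, addr0, subr0).
rewrite /f RintegralB//; last first.
  by rewrite /comp; under eq_fun do rewrite EFinD; exact: integrableD.
rewrite RintegralD// !RintegralZl//; try (by apply: intS; exact: cfi);
  try (by apply: intS; exact: cfj).
by move/eqP; rewrite subr_eq0 => /eqP.
Qed.

Let I1 : (1 + c ^+ 2) * I 1 = ch (pi / 2).
Proof.
pose F t := c * sh t * cos t + ch t * sin t.
have dF t : is_derive t (1 : R) F ((1 + c ^+ 2) * (ch t * cos t ^+ 1)).
  by apply: is_derive_eq; rewrite /GRing.scale/= /ch /sh; ring.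
have cf : continuous (fun t => (1 + c ^+ 2) * (ch t * cos t ^+ 1)).
  by move=> t; apply: cvgM; [exact: cvg_cst|exact: cfi].
have := FTC dF cf.
rewrite RintegralZl//; last by apply: intS; exact: cfi.
by rewrite /F sh0 sin0 cos_pihalf sin_pihalf !(mul0r, mulr0, addr0, subr0, add0r, mulr1).
Qed.

Let J1 : (1 + c ^+ 2) * J 1 + 4 * c * I 1 = pi * sh (pi / 2).
Proof.
pose F t := (2 * sh t + c * (2 * t) * ch t) * cos t + (2 * t * sh t) * sin t.
pose f t := (1 + c ^+ 2) * (2 * t * sh t * cos t ^+ 1) + 4 * c * (ch t * cos t ^+ 1).
have dF t : is_derive t (1 : R) F (f t).
  by apply: is_derive_eq; rewrite /f /GRing.scale/= /ch /sh; ring.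
have ic1 : mu.-integrable S (EFin \o (fun t => (1 + c ^+ 2) * (2 * t * sh t * cos t ^+ 1))).
  by apply: intS => t; apply: cvgM; [exact: cvg_cst|exact: cfj].
have ic2 : mu.-integrable S (EFin \o (fun t => 4 * c * (ch t * cos t ^+ 1))).
  by apply: intS => t; apply: cvgM; [exact: cvg_cst|exact: cfi].
have cf : continuous f.
  by move=> t; apply: cvgD; (apply: cvgM; first exact: cvg_cst); [exact: cfj|exact: cfi].
have := FTC dF cf.
rewrite /f RintegralD// !RintegralZl//; try (by apply: intS; exact: cfi);
  try (by apply: intS; exact: cfj).
move=> ->; rewrite /F sh0 sin0 cos_pihalf sin_pihalf.
by rewrite !(mul0r, mulr0, addr0, subr0, add0r, mulr1) mulrCA mulfV// mulr1.
Qed.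

Let ch_gt0 t : 0 < ch t. Proof. by rewrite addr_gt0// expR_gt0. Qed.

Let cosS t : S t -> 0 <= cos t.
Proof.
rewrite /S/= in_itv/= => /andP[t0 t1]; apply: cos_ge0_pihalf; rewrite t1 andbT.
by rewrite (le_trans _ t0)// oppr_le0.
Qed.

(** The recursion propagates positivity from [I 1], and thus spares a strict
    comparison of integrals. *)
Let I_gt0 n : 0 < I n.*2.+1.
Proof.
elim: n => [|n IH].
  by have := ch_gt0 (pi / 2); rewrite -I1 pmulr_rgt0// ltr_pwDl// sqr_ge0.
have := I_rec n.*2.+1; rewrite doubleS => h.
rewrite -(pmulr_rgt0 _ (_ : 0 < n.*2.+3%:R ^+ 2 + c ^+ 2)); last first.
  by rewrite ltr_pwDl// ?sqr_ge0// exprn_gt0.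
by rewrite h !mulr_gt0.
Qed.

(** [t <= tan t], in a form that makes sense at [pi / 2] and beyond. *)
Let le_cos_sin (t : R) : 0 <= t <= pi -> t * cos t <= sin t.
Proof.
move=> /andP[t0 tpi]; rewrite -subr_ge0.
pose F (s : R) := sin s - s * cos s.
have dF s : is_derive s (1 : R) F (s * sin s).
  by apply: is_derive_eq; rewrite /GRing.scale/=; ring.
have cf : continuous (fun s : R => s * sin s).
  by move=> s; apply: cvgM; [exact: cvg_id|exact: continuous_sin].
have := Rintegral_segment_is_derive t0 dF cf.
rewrite /F sin0 mul0r !subr0 => <-.
apply: Rintegral_ge0 => s /=; rewrite in_itv/= => /andP[s0 st].
by rewrite mulr_ge0// sin_ge0_pi// s0 (le_trans st).
Qed.

(** [|tanh y| <= |y|], with the denominator cleared. *)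
Let sinh_le (y : R) : `|expR y - expR (- y)| <= `|y| * (expR y + expR (- y)).
Proof.
have H (t : R) : 0 <= t -> 0 <= expR t - expR (- t) <= t * (expR t + expR (- t)).
  move=> t0; have e0 (s : R) : 0 <= s -> 0 <= expR s - expR (- s).
    by move=> s0; rewrite subr_ge0 ler_expR (le_trans _ s0)// oppr_le0.
  rewrite e0//= -subr_ge0.
  pose F (s : R) := s * (expR s + expR (- s)) - (expR s - expR (- s)).
  have dF s : is_derive s (1 : R) F (s * (expR s - expR (- s))).
    by apply: is_derive_eq; rewrite /GRing.scale/=; ring.
  have cf : continuous (fun s : R => s * (expR s - expR (- s))).
    move=> s; apply: cvgM; first exact: cvg_id.
    apply: cvgB; first exact: continuous_expR.
    apply: (@continuous_comp _ _ _ -%R expR); first exact: opp_continuous.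
    exact: continuous_expR.
  have := Rintegral_segment_is_derive t0 dF cf.
  rewrite /F oppr0 mul0r subrr !subr0 => <-.
  apply: Rintegral_ge0 => s /=; rewrite in_itv/= => /andP[s0 _].
  by rewrite mulr_ge0// e0.
have [y0|y0] := leP 0 y.
  by have /andP[h1 h2] := H _ y0; rewrite !ger0_norm.
have yN0 : 0 <= - y by rewrite oppr_ge0 ltW.
have /andP[] := H _ yN0; rewrite opprK => h1 h2; rewrite distrC (ger0_norm h1) (ltr0_norm y0).
by rewrite [X in _ * X]addrC.
Qed.

Let intI n : mu.-integrable S (EFin \o (fun t => ch t * cos t ^+ n)).
Proof. by apply: intS; exact: cfi. Qed.
Let intJ n : mu.-integrable S (EFin \o (fun t => 2 * t * sh t * cos t ^+ n)).
Proof. by apply: intS; exact: cfj. Qed.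

(** On the segment [(t cos t) ^ 2 <= sin t ^ 2 = 1 - cos t ^ 2], and two of the
    cosines of [J n.+2] are spent on the factor [t] and on the [t] of
    [|sh t| <= |c| t * ch t]. *)
Let J_le n : `|J n.+2| <= 2 * `|c| * (I n - I n.+2).
Proof.
rewrite /I -RintegralB// -RintegralZl//; last first.
  exact: integrable_fB.
apply: (le_trans (le_normr_Rintegral _ (intJ n.+2))) => //.
apply: le_Rintegral => //.
- exact: integrable_norm.
- apply: intS => t; apply: cvgM; first exact: cvg_cst.
  by apply: cvgB; exact: cfi.
move=> t St; have ct := cosS St.
have := St; rewrite /S/= in_itv/= => /andP[t0 tpi2].
have tpi : t <= pi by rewrite (le_trans tpi2)// ler_pdivrMr// ler_peMr ?pi_ge0// ler1n.
have tc := le_cos_sin (introT andP (conj t0 tpi)).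
have tc0 : 0 <= t * cos t by rewrite mulr_ge0.
have h1 : (t * cos t) ^+ 2 <= 1 - cos t ^+ 2.
  by rewrite -sin2cos2 ler_pXn2r// nnegrE// (le_trans tc0).
rewrite (normrM (2 * t * sh t)) (normrM (2 * t)) (normrM 2) (ger0_norm t0)
  (ger0_norm (exprn_ge0 n.+2 ct)) (@ger0_norm _ 2)//.
apply: (@le_trans _ _ (2 * t * (`|c| * t * ch t) * cos t ^+ n.+2)).
  rewrite ler_wpM2r ?exprn_ge0// ler_wpM2l ?mulr_ge0//.
  by have := sinh_le (c * t); rewrite normrM (ger0_norm t0).
rewrite (_ : 2 * t * _ * _ = 2 * `|c| * (ch t * cos t ^+ n * (t * cos t) ^+ 2)); last first.
  by rewrite !exprS; ring.
rewrite ler_wpM2l ?mulr_ge0//.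
rewrite (_ : _ - _ = ch t * cos t ^+ n * (1 - cos t ^+ 2)); last first.
  by rewrite !exprS; ring.
by rewrite ler_wpM2l// mulr_ge0 ?exprn_ge0// ltW.
Qed.

Let d n : 0 < n.+1%:R ^+ 2 + c ^+ 2.
Proof. by rewrite ltr_pwDl// ?sqr_ge0// exprn_gt0. Qed.

Let partial_sum n :
  \sum_(0 <= k < n.+1) (4 * c / (k.*2.+1%:R ^+ 2 + c ^+ 2))
  = pi * sh (pi / 2) / ch (pi / 2) - J n.*2.+1 / I n.*2.+1.
Proof.
elim: n => [|n IH].
  rewrite big_nat1 expr1n -J1 -I1.
  have d0 := d 0; rewrite expr1n in d0; have i0 := I_gt0 0.
  by field; rewrite !gt_eqF.
rewrite big_nat_recr//= IH doubleS.
have i0 := I_gt0 n; have i1 := I_gt0 n.+1; rewrite doubleS in i1.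
have e1 := I_rec n.*2.+1; have e2 := J_rec n.*2.+1; have dn := d n.*2.+2.
set a := n.*2.+3%:R ^+ 2 + c ^+ 2 in e1 e2 dn *.
set b := n.*2.+3%:R * n.*2.+2%:R in e1 e2 *.
have b0 : 0 < b by rewrite mulr_gt0.
have -> : J n.*2.+1 / I n.*2.+1 = (b * J n.*2.+1) / (b * I n.*2.+1).
  by field; rewrite !gt_eqF.
rewrite -e1 -e2.
have ch0' := ch_gt0 (pi / 2).
by field; rewrite !gt_eqF.
Qed.

Let ratio_le n : `|J n.*2.+3 / I n.*2.+3| <= `|c| * (1 + c ^+ 2) / n.+1%:R.
Proof.
have i0 := I_gt0 n; have i1 := I_gt0 n.+1; rewrite doubleS in i1.
have e1 := I_rec n.*2.+1.
rewrite normrM normfV (gtr0_norm i1) ler_pdivrMr//.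
apply: (le_trans (J_le n.*2.+1)).
set x := I n.*2.+3 in i1 e1 *; set y := I n.*2.+1 in i0 e1 *.
set N : R := n.+1%:R; have N0 : 0 < N by rewrite ltr0n.
have eA : n.*2.+3%:R = 2 * N + 1 :> R.
  by rewrite -addn1 natrD -doubleS -mul2n natrM.
have eB : n.*2.+2%:R = 2 * N :> R by rewrite -doubleS -mul2n natrM.
rewrite eA eB in e1.
have A0 : 0 < 2 * N + 1 by rewrite addr_gt0// mulr_gt0.
have B0 : 0 < 2 * N by rewrite mulr_gt0.
have {e1}-> : y = ((2 * N + 1) ^+ 2 + c ^+ 2) * x / ((2 * N + 1) * (2 * N)).
  by rewrite e1 mulrAC mulfV ?mul1r// mulf_neq0// gt_eqF.
have -> : 2 * `|c| * (((2 * N + 1) ^+ 2 + c ^+ 2) * x / ((2 * N + 1) * (2 * N)) - x) =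
  `|c| * ((2 * N + 1 + c ^+ 2) / (2 * N + 1) / N) * x.
  by field; rewrite !gt_eqF.
rewrite ler_pM2r// -!mulrA ler_wpM2l// mulrA ler_pM2r ?invr_gt0//.
rewrite ler_pdivrMr//; have := sqr_ge0 c; nra.
Qed.

(** Partial-fraction expansion of [pi tanh (pi tau)].  The ratios
    [int (2 t) sinh (2 tau t) (cos t)^n / int cosh (2 tau t) (cos t)^n] over
    [0, pi/2] satisfy, by two integrations by parts, a recursion in [n] that
    telescopes to the partial sums; the bound is the one on the last ratio. *)
Lemma tanh_partial_fractions n :
  `|\sum_(0 <= k < n.+2) 2 * tau / ((k%:R + 2^-1) ^+ 2 + tau ^+ 2)
    - pi * ((expR (pi * tau) - expR (- (pi * tau))) /
            (expR (pi * tau) + expR (- (pi * tau))))|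
  <= `|c| * (1 + c ^+ 2) / n.+1%:R.
Proof.
have -> : pi * ((expR (pi * tau) - expR (- (pi * tau))) /
   (expR (pi * tau) + expR (- (pi * tau)))) = pi * sh (pi / 2) / ch (pi / 2).
  by rewrite /sh /ch /c (_ : 2 * tau * (pi / 2) = pi * tau) ?mulrA//; field.
have -> : \sum_(0 <= k < n.+2) 2 * tau / ((k%:R + 2^-1) ^+ 2 + tau ^+ 2) =
  \sum_(0 <= k < n.+2) (4 * c / (k.*2.+1%:R ^+ 2 + c ^+ 2)).
  apply: eq_bigr => k _.
  have h1 : 0 < (k%:R + 2^-1) ^+ 2 + tau ^+ 2.
    by rewrite ltr_pwDl ?sqr_ge0// exprn_gt0// ltr_wpDl.
  have -> : k.*2.+1%:R ^+ 2 + c ^+ 2 = 4 * ((k%:R + 2^-1) ^+ 2 + tau ^+ 2) :> R.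
    by rewrite -addn1 -mul2n natrD natrM /c; field.
  by rewrite /c -mulf_div divff ?mul1r.
by rewrite partial_sum doubleS addrAC subrr add0r normrN ratio_le.
Qed.
End mittag_leffler_tanh.

(** * The kernel 1 / (2 sinh (u / 2)) and its majorants *)

Section kernels.
Context {R : realType}.
Notation mu := (@lebesgue_measure R).
Notation integrableT f := (mu.-integrable setT (EFin \o f)).

(** Twice [sinh (u / 2)]: what [t - x] becomes, up to a factor [sqrt (t * x)], when
    [t = x * exp u]. *)
Definition sh2 (u : R) : R := expR (u / 2) - expR (- (u / 2)).

Lemma Rintegral_segment_cst (k a b : R) : a <= b ->
  \int[mu]_(x in `[a, b]) k = k * (b - a).
Proof.
move=> ab; rewrite mulrBr.
apply: (@Rintegral_segment_is_derive _ (fun=> k) (fun x => k * x)) => //.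
  by move=> x; apply: is_derive_eq; rewrite /GRing.scale/= mulr1.
exact: cst_continuous.
Qed.

Lemma integrable_segment (f : R -> R) (a b : R) : continuous f ->
  mu.-integrable `[a, b] (EFin \o f).
Proof.
move=> cf; apply: continuous_compact_integrable; first exact: segment_compact.
exact: continuous_subspaceT.
Qed.

Lemma sh20 : sh2 0 = 0. Proof. by rewrite /sh2 mul0r oppr0 subrr. Qed.

Lemma sh2N u : sh2 (- u) = - sh2 u.
Proof. by rewrite /sh2 mulNr opprK opprB. Qed.

Lemma continuous_sh2 : continuous sh2.
Proof.
have d t : is_derive t (1 : R) sh2 (2^-1 * expR (t / 2) + 2^-1 * expR (- (t / 2))).
  by apply: is_derive_eq; rewrite /GRing.scale/=; ring.
exact: is_derive_continuous d.
Qed.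

Lemma measurable_sh2 : measurable_fun setT sh2.
Proof. exact: continuous_measurable_fun continuous_sh2. Qed.

(** [sh2 u] is larger than [exp (u / 2) - 1], and so than each nonconstant term
    of the exponential series; the linear bound with constant [1] comes from
    [cosh >= 1] instead. *)
Lemma sh2_ge u : 0 <= u -> [/\ u <= sh2 u, u ^+ 2 <= 8 * sh2 u & u ^+ 3 <= 48 * sh2 u].
Proof.
move=> u0; have y0 : 0 <= u / 2 by rewrite divr_ge0.
have e1 : expR (- (u / 2)) <= 1 by rewrite expR_le1 oppr_le0.
have h (n : nat) : (u / 2) ^+ n.+1 / n.+1`!%:R <= sh2 u.
  by have := expR_ge1Dxn n y0; rewrite /sh2; lra.
split.
- pose F (t : R) := expR t - expR (- t).
  pose f (t : R) := expR t + expR (- t).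
  have dF t : is_derive t (1 : R) F (f t).
    by apply: is_derive_eq; rewrite /f /GRing.scale/=; ring.
  have df t : is_derive t (1 : R) f (F t).
    by apply: is_derive_eq; rewrite /F /GRing.scale/=; ring.
  have cf := is_derive_continuous df.
  have <- : \int[mu]_(t in `[0, u / 2]) f t = sh2 u.
    by rewrite (Rintegral_segment_is_derive y0 dF cf) /F oppr0 subrr subr0.
  apply: (@le_trans _ _ (\int[mu]_(x in `[0, u / 2]) 2)).
    by rewrite Rintegral_segment_cst// subr0; lra.
  apply: le_Rintegral => //.
  + by apply: integrable_segment; exact: cst_continuous.
  + exact: integrable_segment.
  + move=> t _; rewrite /f expRN; have e0 := expR_gt0 t.
    rewrite -subr_ge0 (_ : _ - 2 = (expR t - 1) ^+ 2 / expR t) ?divr_ge0 ?sqr_ge0 ?ltW//.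
    by field; rewrite gt_eqF.
- by have := h 1; rewrite exprMn/= (_ : 2`!%:R = 2)//; lra.
- by have := h 2; rewrite exprMn/= (_ : 3`!%:R = 6)//; lra.
Qed.

Lemma norm_sh2_ge u :
  [/\ `|u| <= `|sh2 u|, `|u| ^+ 2 <= 8 * `|sh2 u| & `|u| ^+ 3 <= 48 * `|sh2 u|].
Proof.
have H v : 0 <= v -> [/\ `|v| <= `|sh2 v|, `|v| ^+ 2 <= 8 * `|sh2 v| & `|v| ^+ 3 <= 48 * `|sh2 v|].
  move=> v0; have [h1 h2 h3] := sh2_ge v0.
  by rewrite !ger0_norm// (le_trans v0).
have [/H//|u0] := leP 0 u.
by rewrite -(normrN u) -(normrN (sh2 u)) -sh2N; apply: H; rewrite oppr_ge0 ltW.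
Qed.

(** The fourth root of [|u|]: a modulus of continuity weak enough that
    [q u / sh2 u] is integrable at the origin. *)
Definition q (u : R) : R := `|u| `^ 4^-1.

Lemma q_ge0 u : 0 <= q u. Proof. exact: powR_ge0. Qed.

Lemma q4 u : q u ^+ 4 = `|u|.
Proof. by rewrite /q -powR_mulrn ?powR_ge0// -powRrM mulVf// powRr1. Qed.

Lemma q0 : q 0 = 0. Proof. by rewrite /q normr0 powR0. Qed.

Lemma qN u : q (- u) = q u. Proof. by rewrite /q normrN. Qed.

Lemma qM u v : q (u * v) = q u * q v.
Proof. by rewrite /q normrM powRM. Qed.

Lemma measurable_q : measurable_fun setT q.
Proof.
apply: (measurableT_comp (f := fun x : R => x `^ 4^-1)); first exact: measurable_powR.
exact: normr_measurable.
Qed.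

Lemma q_gt0 u : u != 0 -> 0 < q u.
Proof. by move=> u0; rewrite powR_gt0// normr_gt0. Qed.

(** An explicit integrable function, of order [|u| ^ (- 3/4)] at the origin and
    [|u| ^ (- 5/4)] at infinity: on the positive axis it is, up to a constant,
    the derivative of [atan (u ^ (1/4))]. *)
Definition w (u : R) : R := (q u ^+ 3 * (1 + q u ^+ 2))^-1.

Lemma measurable_w : measurable_fun setT w.
Proof.
apply: measurable_funV; apply: measurable_funM.
  by apply: measurable_funX; exact: measurable_q.
by apply: measurable_funD => //; apply: measurable_funX; exact: measurable_q.
Qed.

Lemma w_ge0 u : 0 <= w u.
Proof. by rewrite invr_ge0 mulr_ge0 ?exprn_ge0 ?addr_ge0 ?sqr_ge0 ?q_ge0. Qed.

(** The integral over [s, t] is [F t - F s], at most [2 * C]; exhaust the half-line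
    by such segments. *)
Lemma integrable_oy_is_derive (f F : R -> R) (C : R) :
  (forall x : R, 0 < x -> is_derive x (1 : R) F (f x)) ->
  (forall x : R, 0 < x -> {for x, continuous f}) ->
  (forall x : R, 0 < x -> 0 <= f x) -> (forall x : R, 0 < x -> `|F x| <= C) ->
  mu.-integrable `]0%R, +oo[ (EFin \o f).
Proof.
move=> dF cf f0 FC.
pose s n : R := n.+1%:R^-1; pose t n : R := n.+2%:R.
have s0 n : 0 < s n by rewrite invr_gt0.
have st n : s n < t n.
  by rewrite (@le_lt_trans _ _ 1) ?invf_le1 ?ler1n// ltr1n.
pose A n : set R := `[s n, t n]%classic.
have A0 n x : A n x -> 0 < x.
  by rewrite /A/= in_itv/= => /andP[sx _]; rewrite (lt_le_trans (s0 n)).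
have cover : (`]0%R, +oo[%classic : set R) = \bigcup_n A n.
  apply/seteqP; split => x /=; last by move=> [n _ /A0]; rewrite in_itv/= andbT.
  rewrite in_itv/= andbT => x0.
  pose n := Num.bound (Num.max x x^-1).
  have : Num.max x x^-1 < n%:R.
    by apply: archi_boundP; rewrite le_max (ltW x0).
  rewrite gt_max => /andP[xn xVn]; exists n => //; rewrite /A/= in_itv/=; apply/andP; split.
    by rewrite /s invf_ple ?posrE// (le_trans (ltW xVn))// ler_nat.
  by rewrite (le_trans (ltW xn))// ler_nat -addn2 leq_addr.
have mf : measurable_fun (`]0%R, +oo[%classic : set R) f.
  apply: open_continuous_measurable_fun => // x; rewrite inE/= in_itv/= andbT.
  exact: cf.
apply/integrableP; split; first exact/measurable_EFinP.
under eq_integral => x.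
  rewrite inE/= in_itv/= andbT => x0; rewrite /= (ger0_norm (f0 _ x0)); over.
rewrite cover.
have := @ge0_nondecreasing_set_cvg_integral _ (measurableTypeR R) R A (EFin \o f) mu.
have ndA : nondecreasing_seq A.
  move=> m n mn; rewrite subsetEset => x; rewrite /A/= !in_itv/= => /andP[h1 h2].
  apply/andP; split.
    by rewrite (le_trans _ h1)// /s lef_pV2 ?posrE// ler_nat ltnS.
  by rewrite (le_trans h2)// ler_nat.
move=> /(_ ndA (fun=> measurable_itv _)).
have mfA n : measurable_fun (A n) (EFin \o f).
  apply/measurable_EFinP; apply: measurable_funS mf => // x /A0 x0.
  by rewrite /= in_itv/= andbT.
have f0A n x : A n x -> (0 <= (EFin \o f) x)%E by move=> /A0 /f0; rewrite lee_fin.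
move=> /(_ mfA f0A) cvg.
have intA n : (\int[mu]_(x in A n) (EFin \o f) x = (F (t n) - F (s n))%:E)%E.
  rewrite EFinB; apply: continuous_FTC2 => //.
  - by apply: continuous_in_subspaceT => x; rewrite inE => /A0; exact: cf.
  - have cF x : 0 < x -> {for x, continuous F}.
      move=> x0; apply/differentiable_continuous/derivable1_diffP.
      by have := dF _ x0 => ?; exact: ex_derive.
    split.
    + move=> x; rewrite in_itv/= => /andP[sx _].
      by have := dF _ (lt_trans (s0 n) sx) => ?; exact: ex_derive.
    + by apply: cvg_at_right_filter; apply: cF.
    + by apply: cvg_at_left_filter; apply: cF; rewrite (lt_trans _ (st n)).
  - move=> x; rewrite in_itv/= => /andP[sx _].
    by have := dF _ (lt_trans (s0 n) sx) => ?; rewrite derive1E; exact: derive_val.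
apply: (@le_lt_trans _ _ (C + C)%:E); last by rewrite ltry.
rewrite -(cvg_lim _ cvg)//; apply: lime_le; first by apply/cvg_ex; eexists; exact: cvg.
apply: nearW => n; rewrite intA lee_fin.
have := FC _ (s0 n); have := FC (t n) (lt_trans (s0 n) (st n)).
rewrite !ler_norml => /andP[_ h1] /andP[h2 _]; lra.
Qed.

Lemma integrable_itv_oy_cy (f : R -> R) : measurable_fun setT f ->
  mu.-integrable `]0%R, +oo[ (EFin \o f) -> mu.-integrable `[0%R, +oo[ (EFin \o f).
Proof.
move=> mf /integrableP[_ fi]; apply/integrableP; split.
  by apply/measurable_EFinP; exact: measurable_funTS.
rewrite -integral_itv_obnd_cbnd//.
by apply: measurableT_comp => //; apply/measurable_EFinP; exact: measurable_funTS.
Qed.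

Lemma integrable_w : integrableT w.
Proof.
apply: integrable_even; first exact: measurable_w.
  by move=> t; rewrite /w qN.
apply: integrable_itv_oy_cy; first exact: measurable_w.
pose f (u : R) := u `^ (4^-1 - 1) / (1 + (u `^ 4^-1) ^+ 2).
suff fi : mu.-integrable `]0%R, +oo[ (EFin \o f).
  apply: eq_integrable fi => // u; rewrite inE/= in_itv/= andbT => u0; congr EFin.
  rewrite /f /w /q (gtr0_norm u0); have r0 : 0 < u `^ 4^-1 by exact: powR_gt0.
  rewrite (_ : u `^ (4^-1 - 1) = ((u `^ 4^-1) ^+ 3)^-1); first by rewrite [RHS]invfM.
  rewrite -powR_mulrn ?powR_ge0// -powRrM -powRN; congr (_ `^ _); by field.
pose F (x : R) := 4 * atan (x `^ 4^-1).
apply: (@integrable_oy_is_derive f F (4 * pi)).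
- move=> x x0; have h := @is_derive1_powR R 4^-1 x x0.
  apply: is_derive_eq; rewrite /GRing.scale/=.
  have r0 : 0 < x `^ 4^-1 by exact: powR_gt0.
  by rewrite /f; field; rewrite gt_eqF// ltr_pwDl// sqr_ge0.
- move=> x x0.
  have c a : {for x, continuous (fun y : R => y `^ a)}.
    apply/differentiable_continuous/derivable1_diffP.
    by apply: ex_derive; exact: is_derive1_powR.
  apply: cvgM; first exact: c.
  apply: cvgV; first by rewrite gt_eqF// ltr_pwDl// sqr_ge0.
  apply: cvgD; first exact: cvg_cst.
  by apply: cvgM; exact: c.
- by move=> x x0; rewrite divr_ge0 ?powR_ge0// addr_ge0// sqr_ge0.
- move=> x x0; rewrite /F normrM ger0_norm// ler_pM2l//.
  have := atan_ltpi2 (x `^ 4^-1); have := atan_gtNpi2 (x `^ 4^-1).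
  by have := pi_gt0 R; rewrite ler_norml; lra.
Qed.

Lemma integrable_oneDsqrV : integrableT (fun u : R => (1 + u ^+ 2)^-1).
Proof.
have m : measurable_fun setT (fun u : R => (1 + u ^+ 2)^-1).
  by apply: measurable_funV; apply: measurable_funD => //; exact: measurable_funX.
apply: integrable_even => //; first by move=> t; rewrite sqrrN.
apply/integrableP; split; first by apply/measurable_EFinP; exact: measurable_funTS.
under eq_integral => x _.
  rewrite /= ger0_norm; last by rewrite invr_ge0 addr_ge0// sqr_ge0.
  over.
by rewrite integral0y_oneDsqr ltry.
Qed.

(** [q u / |sh2 u|] is at most [|u| ^ (- 3/4)] near the origin and decays faster
    than [w] at infinity. *)
Lemma integrable_q_sh2 : integrableT (fun u => q u / `|sh2 u|).
Proof.
apply: (integrable_le _ _ (integrable_fZl measurableT 6 integrable_w)) => //.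
- apply: measurable_funM; first exact: measurable_q.
  apply: measurable_funV; apply: measurableT_comp => //; exact: measurable_sh2.
move=> u _; rewrite ger0_norm ?divr_ge0 ?q_ge0//.
have [->|u0] := eqVneq u 0; first by rewrite q0 mul0r mulr_ge0// w_ge0.
have r0 := q_gt0 u0; have [h1 h2 _] := norm_sh2_ge u.
have s0 : 0 < `|sh2 u| by rewrite (lt_le_trans _ h1)// normr_gt0.
rewrite /w ler_pdivrMr// mulrAC ler_pdivlMr; last by rewrite mulr_gt0 ?exprn_gt0// ltr_pwDl// sqr_ge0.
rewrite (_ : q u * _ = q u ^+ 4 + q u ^+ 4 * q u ^+ 2); last by ring.
have : q u ^+ 2 <= (1 + q u ^+ 4) / 2.
  have := sqr_ge0 (q u ^+ 2 - 1).
  rewrite (_ : (q u ^+ 2 - 1) ^+ 2 = q u ^+ 4 - 2 * q u ^+ 2 + 1); first lra.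
  by ring.
rewrite q4 => h3.
have : `|u| * q u ^+ 2 <= `|u| * ((1 + `|u|) / 2) by rewrite ler_wpM2l.
by rewrite mulrA mulrDr mulr1 -expr2; lra.
Qed.

Lemma integrable_id_sh2 : integrableT (fun u => u / sh2 u).
Proof.
apply: (integrable_le _ _ (integrable_fZl measurableT 49 integrable_oneDsqrV)) => //.
- by apply: measurable_funM => //; apply: measurable_funV; exact: measurable_sh2.
move=> u _; have d0 : 0 < 1 + u ^+ 2 by rewrite ltr_pwDl// sqr_ge0.
have [->|u0] := eqVneq u 0; first by rewrite mul0r normr0 mulr_ge0// invr_ge0 ltW// expr0n addr0.
have [h1 _ h3] := norm_sh2_ge u.
have s0 : 0 < `|sh2 u| by rewrite (lt_le_trans _ h1)// normr_gt0.
rewrite normrM normfV ler_pdivrMr// mulrAC ler_pdivlMr//.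
rewrite -(real_normK (num_real u)) mulrDr mulr1 -exprS; lra.
Qed.

Lemma sin_le_norm (y : R) : `|sin y| <= `|y|.
Proof.
have H (t : R) : 0 <= t -> `|sin t| <= `|t|.
  move=> t0.
  have <- : \int[mu]_(x in `[0, t]) cos x = sin t.
    by rewrite (Rintegral_segment_is_derive t0 (@is_derive_sin R) (@continuous_cos R)) sin0 subr0.
  have ic : mu.-integrable `[0, t] (EFin \o cos).
    by apply: integrable_segment; exact: continuous_cos.
  apply: (le_trans (le_normr_Rintegral _ ic)) => //.
  apply: (@le_trans _ _ (\int[mu]_(x in `[0, t]) 1)).
    apply: le_Rintegral => //.
    + exact: integrable_norm.
    + by apply: integrable_segment; exact: cst_continuous.
    + by move=> x _; exact: cos_max.
  by rewrite Rintegral_segment_cst// subr0 mul1r ger0_norm.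
have [/H//|y0] := leP 0 y.
by rewrite -(normrN y) -(normrN (sin y)) -sinN; apply: H; rewrite oppr_ge0 ltW.
Qed.

(** Near the origin [|y| <= q y] because [q y <= 1]; elsewhere [q y >= 1]. *)
Lemma sin_le_q (y : R) : `|sin y| <= q y.
Proof.
have [y1|y1] := leP `|y| 1.
  apply: (le_trans (sin_le_norm y)); rewrite -q4.
  have r0 := q_ge0 y; have r1 : q y <= 1.
    by rewrite -(@ler_pXn2r _ 4) ?nnegrE// q4 expr1n.
  by rewrite exprSr ler_piMl// exprn_ile1.
apply: (le_trans (sin_max y)); rewrite -(@ler_pXn2r _ 4) ?nnegrE ?q_ge0// q4 expr1n.
exact: ltW.
Qed.

Lemma oneBcos_sin (y : R) : `|cos y - 1| <= 2 * `|sin (y / 2)|.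
Proof.
have -> : cos y - 1 = - (2 * sin (y / 2) ^+ 2).
  rewrite {1}(_ : y = (y / 2) *+ 2) ?cos_mulr2n ?sin2cos2; last by rewrite mulr2n; lra.
  by rewrite mulr2n; ring.
rewrite normrN normrM ger0_norm// ler_pM2l// normrX expr2 ler_piMl//.
exact: sin_max.
Qed.

Lemma oneBcos_le_q (y : R) : `|cos y - 1| <= 2 * q y.
Proof.
apply: (le_trans (oneBcos_sin y)); rewrite ler_pM2l// (le_trans (sin_le_q _))//.
rewrite qM ler_piMr ?q_ge0//.
rewrite -(@ler_pXn2r _ 4) ?nnegrE ?q_ge0// q4 expr1n ger0_norm//; lra.
Qed.

Lemma oneBcos_le_norm (y : R) : `|cos y - 1| <= `|y|.
Proof.
apply: (le_trans (oneBcos_sin y)).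
rewrite (_ : `|y| = 2 * `|y / 2|) ?ler_pM2l ?sin_le_norm//.
by rewrite normrM [X in _ * (_ * X)]ger0_norm//; lra.
Qed.

End kernels.

(** * Laplace transforms of sine and cosine *)

Section laplace.
Context {R : realType}.
Notation mu := (@lebesgue_measure R).

(** [f + g] and [g] are nonnegative, so the half-line theorem for nonnegative
    integrands applies to both; subtract. *)
Lemma Rintegral_halfline_dominated (f F g G : R -> R) (a l m : R) :
  (forall x, is_derive x (1 : R) F (f x)) -> continuous f ->
  (forall x, is_derive x (1 : R) G (g x)) -> continuous g ->
  (forall x, a <= x -> `|f x| <= g x) ->
  F x @[x --> +oo] --> l -> G x @[x --> +oo] --> m ->
  mu.-integrable `[a, +oo[ (EFin \o f) /\ \int[mu]_(x in `[a, +oo[) f x = l - F a.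
Proof.
move=> dF cf dG cg fg Fl Gm.
have mf : measurable_fun setT f by exact: continuous_measurable_fun.
have mg : measurable_fun setT g by exact: continuous_measurable_fun.
have g0 x : a <= x -> 0 <= g x by move=> /fg; exact: le_trans.
have Ig := integral_halfline_is_derive g0 dG cg Gm.
have ig : mu.-integrable `[a, +oo[ (EFin \o g).
  apply/integrableP; split; first by apply/measurable_EFinP; exact: measurable_funTS.
  under eq_integral => x.
    rewrite inE/= in_itv/= andbT => ax; rewrite /= (ger0_norm (g0 _ ax)); over.
  by rewrite Ig ltry.
have if_ : mu.-integrable `[a, +oo[ (EFin \o f).
  apply: (integrable_le _ _ ig) => //; first exact: measurable_funTS.
  by move=> x /=; rewrite in_itv/= andbT; exact: fg.
split=> //.
have fg0 x : a <= x -> 0 <= f x + g x.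
  by move=> /fg; rewrite ler_norml => /andP[]; lra.
have dFG x : is_derive x (1 : R) (fun y => F y + G y) (f x + g x).
  by have := dF x; have := dG x => ? ?; exact: is_deriveD.
have cfg : continuous (fun x => f x + g x).
  by move=> x; apply: cvgD; [exact: cf|exact: cg].
have Ifg := integral_halfline_is_derive fg0 dFG cfg (cvgD Fl Gm).
have e1 : \int[mu]_(x in `[a, +oo[) g x = m - G a by rewrite /Rintegral Ig.
have e2 : \int[mu]_(x in `[a, +oo[) (f x + g x) = l + m - (F a + G a).
  by rewrite /Rintegral Ifg.
by rewrite RintegralD// e1 in e2; apply: (addIr (m - G a)); rewrite e2; ring.
Qed.

Lemma cvg_expRN_scale (a : R) : 0 < a -> expR (- (a * u)) @[u --> +oo] --> (0 : R).
Proof.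
move=> a0; apply: (@cvg_comp _ _ _ (fun u => a * u) (fun v => expR (- v)) +oo +oo).
  by apply: gt0_cvgMry => //; exact: cvg_id.
exact: cvgr_expR.
Qed.

Lemma continuous_expRN_scale (a : R) : continuous (fun u => expR (- (a * u))).
Proof.
apply: (@is_derive_continuous _ (fun u => - a * expR (- (a * u)))) => u.
by apply: is_derive_eq; rewrite /GRing.scale/=; ring.
Qed.

Lemma continuous_scale_comp (f : R -> R) (a : R) : continuous f -> continuous (fun u => f (a * u)).
Proof.
move=> cf u; apply: (@continuous_comp _ _ _ (fun u => a * u) f); last exact: cf.
by apply: cvgM; [exact: cvg_cst|exact: cvg_id].
Qed.

Lemma cvg_expRN_bounded (a C : R) (h : R -> R) : 0 < a -> (forall u, `|h u| <= C) ->
  expR (- (a * u)) * h u @[u --> +oo] --> (0 : R).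
Proof.
move=> a0 hC; apply: norm_cvg0.
apply: (@squeeze_cvgr _ _ _ _ (fun=> 0) (fun u => expR (- (a * u)) * C)).
- apply: nearW => u; rewrite normr_ge0 normrM ger0_norm ?expR_ge0//.
  by rewrite ler_wpM2l// expR_ge0.
- exact: cvg_cst.
- rewrite -[X in _ --> X](mul0r C); apply: cvgM; last exact: cvg_cst.
  exact: cvg_expRN_scale.
Qed.

Section exponential_sum.
Variables (a tau : R).
Hypothesis a0 : 0 < a.

Let D : 0 < a ^+ 2 + tau ^+ 2.
Proof. by rewrite ltr_pwDl ?sqr_ge0// exprn_gt0. Qed.

Let g u := expR (- (a * u)).
Let G u := - (a^-1 * expR (- (a * u))).
Let dG u : is_derive u (1 : R) G (g u).
Proof. by apply: is_derive_eq; rewrite /g /GRing.scale/=; field; rewrite gt_eqF. Qed.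
Let cg : continuous g. Proof. exact: continuous_expRN_scale. Qed.
Let G0 : G u @[u --> +oo] --> (0 : R).
Proof.
rewrite -oppr0 -(mulr0 a^-1); apply: cvgN; apply: cvgM; first exact: cvg_cst.
exact: cvg_expRN_scale.
Qed.

Lemma laplace_cst :
  mu.-integrable `[0%R, +oo[ (EFin \o g) /\ \int[mu]_(u in `[0, +oo[) g u = a^-1.
Proof.
have gg x : 0 <= x -> `|g x| <= g x by rewrite ger0_norm ?expR_ge0.
have [i ->] := Rintegral_halfline_dominated dG cg dG cg gg G0 G0.
by split => //; rewrite /G mulr0 oppr0 expR0 mulr1; lra.
Qed.

Let dom (h : R -> R) : (forall u, `|h u| <= 1) -> forall u, 0 <= u ->
  `|expR (- (a * u)) * h u| <= g u.
Proof.
by move=> h1 u _; rewrite normrM ger0_norm ?expR_ge0// ler_piMr ?expR_ge0.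
Qed.

Let norm_lin (x y : R) u : `|x * sin (tau * u) + y * cos (tau * u)| <= `|x| + `|y|.
Proof.
rewrite (le_trans (ler_normD _ _))// !normrM lerD// ler_piMr//.
  exact: sin_max.
exact: cos_max.
Qed.

Lemma laplace_sin :
  mu.-integrable `[0%R, +oo[ (EFin \o (fun u => expR (- (a * u)) * sin (tau * u))) /\
  \int[mu]_(u in `[0, +oo[) (expR (- (a * u)) * sin (tau * u)) = tau / (a ^+ 2 + tau ^+ 2).
Proof.
pose F u := expR (- (a * u)) *
  (- a / (a ^+ 2 + tau ^+ 2) * sin (tau * u) + - tau / (a ^+ 2 + tau ^+ 2) * cos (tau * u)).
have dF u : is_derive u (1 : R) F (expR (- (a * u)) * sin (tau * u)).
  by apply: is_derive_eq; rewrite /GRing.scale/=; field; rewrite gt_eqF.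
have cf : continuous (fun u => expR (- (a * u)) * sin (tau * u)).
  move=> u; apply: cvgM; first exact: continuous_expRN_scale.
  by apply: (@continuous_scale_comp sin); exact: continuous_sin.
have F0 : F u @[u --> +oo] --> (0 : R) by apply: (cvg_expRN_bounded a0); exact: norm_lin.
have [i ->] := Rintegral_halfline_dominated dF cf dG cg (dom (fun u => sin_max _)) F0 G0.
split => //; rewrite /F !mulr0 oppr0 expR0 sin0 cos0; field; by rewrite gt_eqF.
Qed.

Lemma laplace_cos :
  mu.-integrable `[0%R, +oo[ (EFin \o (fun u => expR (- (a * u)) * cos (tau * u))) /\
  \int[mu]_(u in `[0, +oo[) (expR (- (a * u)) * cos (tau * u)) = a / (a ^+ 2 + tau ^+ 2).
Proof.
pose F u := expR (- (a * u)) *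
  (tau / (a ^+ 2 + tau ^+ 2) * sin (tau * u) + - a / (a ^+ 2 + tau ^+ 2) * cos (tau * u)).
have dF u : is_derive u (1 : R) F (expR (- (a * u)) * cos (tau * u)).
  by apply: is_derive_eq; rewrite /GRing.scale/=; field; rewrite gt_eqF.
have cf : continuous (fun u => expR (- (a * u)) * cos (tau * u)).
  move=> u; apply: cvgM; first exact: continuous_expRN_scale.
  by apply: (@continuous_scale_comp cos); exact: continuous_cos.
have F0 : F u @[u --> +oo] --> (0 : R) by apply: (cvg_expRN_bounded a0); exact: norm_lin.
have [i ->] := Rintegral_halfline_dominated dF cf dG cg (dom (fun u => cos_max _)) F0 G0.
split => //; rewrite /F !mulr0 oppr0 expR0 sin0 cos0; field; by rewrite gt_eqF.
Qed.

End exponential_sum.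
End laplace.

(** * Fourier transforms of the kernels *)

Section multiplier.
Context {R : realType}.
Notation mu := (@lebesgue_measure R).
Notation integrableT f := (mu.-integrable setT (EFin \o f)).

(** [pi * tanh (pi * tau)], the multiplier by which the Hilbert transform acts
    on the Mellin side, up to a factor [- i]. *)
Definition ptanh (tau : R) : R := pi * ((expR (pi * tau) - expR (- (pi * tau))) /
  (expR (pi * tau) + expR (- (pi * tau)))).

Let den (tau : R) : 0 < expR (pi * tau) + expR (- (pi * tau)).
Proof. by rewrite addr_gt0// expR_gt0. Qed.

(** The Riccati equation of [pi tanh (pi tau)] is where the theorem comes from:
    the multiplier of the iterated Stieltjes transform is the derivative of
    [ptanh], hence [pi ^ 2 - ptanh ^ 2]. *)
Lemma is_derive_ptanh tau : is_derive tau (1 : R) ptanh (pi ^+ 2 - ptanh tau ^+ 2).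
Proof.
have d0 := den tau.
have dd : is_derive tau (1 : R) (fun t => expR (pi * t) + expR (- (pi * t)))
    (pi * (expR (pi * tau) - expR (- (pi * tau)))).
  by apply: is_derive_eq; rewrite /GRing.scale/=; ring.
have dV := @is_deriveV R (fun t => expR (pi * t) + expR (- (pi * t))) tau _ 1 (lt0r_neq0 d0) dd.
by apply: is_derive_eq; rewrite /ptanh /GRing.scale/=; field; rewrite gt_eqF.
Qed.

Lemma measurable_ptanh : measurable_fun setT ptanh.
Proof.
exact: continuous_measurable_fun (is_derive_continuous is_derive_ptanh).
Qed.

Lemma norm_ptanh_le tau : `|ptanh tau| <= pi.
Proof.
rewrite /ptanh normrM (ger0_norm (pi_ge0 R)) ler_piMr ?pi_ge0//.
rewrite normrM normfV (gtr0_norm (den tau)) ler_pdivrMr ?den// mul1r.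
have := expR_gt0 (pi * tau); have := expR_gt0 (- (pi * tau)).
by rewrite ler_norml; lra.
Qed.

Let m_sh2V : measurable_fun setT (fun u : R => (sh2 u)^-1).
Proof. by apply: measurable_funV; exact: measurable_sh2. Qed.

Let m_scale (f : R -> R) (tau : R) : measurable_fun setT f ->
  measurable_fun setT (fun u : R => f (tau * u)).
Proof. by move=> mf; apply: (measurableT_comp mf); exact: measurable_funM. Qed.

Lemma integrable_sin_sh2 tau : integrableT (fun u => sin (tau * u) / sh2 u).
Proof.
apply: (integrable_le _ _ (integrable_fZl measurableT `|tau| (integrable_norm integrable_id_sh2))) => //.
  by apply: measurable_funM => //; apply: m_scale; exact: measurable_sin.
move=> u _ /=; rewrite !normrM mulrA ler_wpM2r ?normr_ge0//.
by rewrite -normrM sin_le_norm.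
Qed.

Lemma integrable_cos1_sh2 tau : integrableT (fun u => (cos (tau * u) - 1) / sh2 u).
Proof.
apply: (integrable_le _ _ (integrable_fZl measurableT `|tau| (integrable_norm integrable_id_sh2))) => //.
  apply: measurable_funM => //; apply: measurable_funB => //.
  by apply: m_scale; exact: measurable_cos.
move=> u _ /=; rewrite !normrM mulrA ler_wpM2r ?normr_ge0//.
by rewrite -normrM oneBcos_le_norm.
Qed.

Lemma integrable_idcos_sh2 tau : integrableT (fun u => u / sh2 u * cos (tau * u)).
Proof.
apply: (integrable_le _ _ (integrable_norm integrable_id_sh2)) => //.
  apply: measurable_funM; first exact: measurable_funM.
  by apply: m_scale; exact: measurable_cos.
by move=> u _ /=; rewrite normrM ler_piMr ?normr_ge0// cos_max.
Qed.

Lemma integrable_idsin_sh2 tau : integrableT (fun u => u / sh2 u * sin (tau * u)).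
Proof.
apply: (integrable_le _ _ (integrable_norm integrable_id_sh2)) => //.
  apply: measurable_funM; first exact: measurable_funM.
  by apply: m_scale; exact: measurable_sin.
by move=> u _ /=; rewrite normrM ler_piMr ?normr_ge0// sin_max.
Qed.

Lemma Rintegral_cos1_sh2 tau : \int[mu]_u ((cos (tau * u) - 1) / sh2 u) = 0.
Proof.
apply: Rintegral_odd; first exact: integrable_cos1_sh2.
by move=> u; rewrite mulrN cosN sh2N invrN mulrN.
Qed.

Lemma Rintegral_idsin_sh2 tau : \int[mu]_u (u / sh2 u * sin (tau * u)) = 0.
Proof.
apply: Rintegral_odd; first exact: integrable_idsin_sh2.
by move=> u; rewrite mulrN sinN sh2N invrN mulrNN mulrN.
Qed.

Section sine_transform.
Variable tau : R.
Let r n (u : R) := expR (- (n%:R * u)) * (sin (tau * u) / sh2 u).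

Let mr n : measurable_fun setT (r n).
Proof.
apply: measurable_funM.
  by apply: continuous_measurable_fun; exact: continuous_expRN_scale.
by apply: measurable_funM => //; apply: m_scale; exact: measurable_sin.
Qed.

Let sin_sh2_le (u : R) : `|sin (tau * u) / sh2 u| <= `|tau|.
Proof.
have [->|u0] := eqVneq u 0; first by rewrite mulr0 sin0 mul0r normr0.
have [h1 _ _] := norm_sh2_ge u.
have s0 : 0 < `|sh2 u| by rewrite (lt_le_trans _ h1)// normr_gt0.
rewrite normrM normfV ler_pdivrMr// (le_trans (sin_le_norm _))// normrM.
by rewrite ler_wpM2l.
Qed.

Let ir n : mu.-integrable `[0%R, +oo[ (EFin \o r n).
Proof.
have i0 : mu.-integrable `[0%R, +oo[ (EFin \o (fun u => sin (tau * u) / sh2 u)).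
  exact: integrableS (integrable_sin_sh2 tau).
apply: (integrable_le _ _ (integrable_norm i0)) => //.
  by apply: measurable_funTS; exact: mr.
move=> u /=; rewrite in_itv/= andbT => u0.
by rewrite normrM ler_piMl// ger0_norm ?expR_ge0// expR_le1 oppr_le0 mulr_ge0.
Qed.

(** One step of the geometric expansion of [1 / sh2 u] in powers of
    [exp (- u)]; with the remainder kept, no series has to be interchanged
    with the integral. *)
Let rS n u : r n u = expR (- ((n%:R + 2^-1) * u)) * sin (tau * u) + r n.+1 u.
Proof.
rewrite /r; have [->|u0] := eqVneq u 0; first by rewrite !mulr0 sin0 !(mul0r, mulr0) addr0.
have [h1 _ _] := norm_sh2_ge u.
have s0 : sh2 u != 0 by rewrite -normr_gt0 (lt_le_trans _ h1)// normr_gt0.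
have -> : expR (- ((n%:R + 2^-1) * u)) = expR (- (n%:R * u)) * expR (- (u / 2)).
  by rewrite -expRD; congr expR; field.
have -> : expR (- (n.+1%:R * u)) = expR (- (n%:R * u)) * (expR (- (u / 2)) * expR (- (u / 2))).
  by rewrite -!expRD; congr expR; rewrite -natr1; field.
have : 1 = expR (- (u / 2)) * sh2 u + expR (- (u / 2)) * expR (- (u / 2)).
  by rewrite /sh2 mulrBr expRN mulVf ?gt_eqF ?expR_gt0// subrK.
set e := expR (- (u / 2)); set s := sh2 u in s0 * => h.
set A := expR (- (n%:R * u)); set S := sin _.
rewrite -[LHS]mul1r h; by field.
Qed.

Let I_r n : \int[mu]_(u in `[0, +oo[) r 0 u =
  \sum_(0 <= k < n) tau / ((k%:R + 2^-1) ^+ 2 + tau ^+ 2) + \int[mu]_(u in `[0, +oo[) r n u.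
Proof.
elim: n => [|n ->]; first by rewrite big_geq// add0r.
rewrite big_nat_recr//= -addrA; congr (_ + _).
have a0 : 0 < n%:R + 2^-1 :> R by rewrite ltr_wpDl.
have [il e] := laplace_sin tau a0.
rewrite -e -RintegralD//.
by apply: eq_Rintegral => u _; exact: rS.
Qed.

Let r_le n : `|\int[mu]_(u in `[0, +oo[) r n.+1 u| <= `|tau| / n.+1%:R.
Proof.
have [il e] := @laplace_cst R n.+1%:R (ltr0Sn _ _).
rewrite -e -RintegralZl//.
apply: (le_trans (le_normr_Rintegral _ (ir n.+1))) => //.
apply: le_Rintegral => //.
- exact: integrable_norm.
- exact: integrable_fZl.
move=> u _; rewrite /r normrM (ger0_norm (expR_ge0 _)) mulrC ler_wpM2r ?expR_ge0//.
Qed.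

(** The Fourier sine transform of [1 / sh2]: expand [1 / sh2 u] in powers of
    [exp (- u)] for [u > 0] and recognise the partial fractions of [tanh]. *)
Lemma Rintegral_sin_sh2 : \int[mu]_u (sin (tau * u) / sh2 u) = ptanh tau.
Proof.
rewrite Rintegral_even; [|exact: integrable_sin_sh2|]; last first.
  by move=> u; rewrite mulrN sinN sh2N invrN mulrNN.
have -> : \int[mu]_(u in `[0, +oo[) (sin (tau * u) / sh2 u) = \int[mu]_(u in `[0, +oo[) r 0 u.
  by apply: eq_Rintegral => u _; rewrite /r mul0r oppr0 expR0 mul1r.
set X := 2 * _.
pose C := 2 * `|tau| + `|2 * tau| * (1 + (2 * tau) ^+ 2).
have C0 : 0 <= C by rewrite addr_ge0// mulr_ge0// addr_ge0// sqr_ge0.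
have key n : `|X - ptanh tau| <= C / n.+1%:R.
  have h := tanh_partial_fractions tau n.
  rewrite -/(ptanh tau) in h.
  set S := \sum_(0 <= k < n.+2) _ in h.
  have -> : X - ptanh tau = (S - ptanh tau) + 2 * \int[mu]_(u in `[0, +oo[) r n.+2 u.
    rewrite /X (I_r n.+2) mulrDr mulr_sumr /S.
    rewrite (eq_bigr (fun k => 2 * tau / ((k%:R + 2^-1) ^+ 2 + tau ^+ 2))).
      by ring.
    by move=> k _; rewrite mulrA.
  apply: (le_trans (ler_normD _ _)).
  have -> : C / n.+1%:R = `|2 * tau| * (1 + (2 * tau) ^+ 2) / n.+1%:R + 2 * `|tau| / n.+1%:R.
    by rewrite /C; ring.
  apply: lerD => //.
  rewrite normrM ger0_norm// -mulrA ler_pM2l// (le_trans (r_le n.+1))//.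
  by rewrite ler_wpM2l// lef_pV2 ?posrE// ler_nat.
apply/eqP; rewrite -subr_eq0 -normr_le0 leNgt; apply/negP => d0.
have := archi_boundP (divr_ge0 C0 (ltW d0)); set n := Num.bound _ => hn.
have := key n; rewrite leNgt => /negP; apply.
rewrite ltr_pdivrMr// mulrC -ltr_pdivrMr// (lt_le_trans hn)// ler_nat//.
Qed.

End sine_transform.

(** Differentiate [Rintegral_sin_sh2] under the integral sign. *)
Lemma Rintegral_idcos_sh2 tau :
  \int[mu]_u (u / sh2 u * cos (tau * u)) = pi ^+ 2 - ptanh tau ^+ 2.
Proof.
pose f (t u : R) := sin (t * u) / sh2 u.
have df t u : is_derive t (1 : R) (fun s => f s u) (u / sh2 u * cos (t * u)).
  by apply: is_derive_eq; rewrite /GRing.scale/=; ring.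
have d1 t u : partial1of2 f t u = u / sh2 u * cos (t * u).
  by rewrite partial1of2E; exact: derive_val.
have -> : \int[mu]_u (u / sh2 u * cos (tau * u)) = \int[mu]_u partial1of2 f tau u.
  by apply: eq_Rintegral => u _; rewrite d1.
have Ia : `]tau - 1, tau + 1[%classic tau by rewrite /= in_itv/=; lra.
have := @differentiation_under_integral R _ _ mu f setT measurableT tau (tau - 1) (tau + 1) Ia.
move=> /(_ (fun t _ => integrable_sin_sh2 t)).
move=> /(_ (fun t u _ _ => @ex_derive _ _ _ _ _ _ _ (df t u))).
move=> /(_ _ _ (integrable_norm integrable_id_sh2)) <-; last 2 first.
- by move=> u /=; exact: normr_ge0.
- by move=> t u _ _; rewrite d1 /= normrM ler_piMr ?normr_ge0// cos_max.
rewrite (_ : (fun t => _) = ptanh); last first.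
  by apply/funext => t; exact: Rintegral_sin_sh2.
by rewrite derive1E; have := is_derive_ptanh tau => ?; exact: derive_val.
Qed.

End multiplier.

(** * Fourier integrals of weighted square-integrable functions *)

Section measurable_composition.
Context d (T : measurableType d) (R : realType) (D : set T).
Implicit Type f : T -> R.

Lemma measurable_fun_cos f : measurable_fun D f -> measurable_fun D (fun x => cos (f x)).
Proof. exact: measurableT_comp (@measurable_cos R). Qed.

Lemma measurable_fun_sin f : measurable_fun D f -> measurable_fun D (fun x => sin (f x)).
Proof. exact: measurableT_comp (@measurable_sin R). Qed.

Lemma measurable_fun_expR f : measurable_fun D f -> measurable_fun D (fun x => expR (f x)).
Proof. exact: measurableT_comp (@measurable_expR R). Qed.

Lemma measurable_fun_ln f : measurable_fun D f -> measurable_fun D (fun x => ln (f x)).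
Proof. exact: measurableT_comp (@measurable_ln R). Qed.

Lemma measurable_fun_sh2 f : measurable_fun D f -> measurable_fun D (fun x => sh2 (f x)).
Proof. exact: measurableT_comp (@measurable_sh2 R). Qed.

Lemma measurable_fun_q f : measurable_fun D f -> measurable_fun D (fun x => q (f x)).
Proof. exact: measurableT_comp (@measurable_q R). Qed.

Lemma measurable_fun_norm f : measurable_fun D f -> measurable_fun D (fun x => `|f x|).
Proof. by move=> mf; apply: measurableT_comp mf; exact: normr_measurable. Qed.

End measurable_composition.

Ltac meas := repeat first
  [ assumption
  | exact: measurable_cst
  | exact: measurable_id
  | exact: measurable_fst
  | exact: measurable_snd
  | apply: measurable_funD
  | apply: measurable_funB
  | apply: measurable_funN
  | apply: measurable_funM
  | apply: measurable_funV
  | apply: measurable_funX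
  | apply: measurable_fun_cos
  | apply: measurable_fun_sin
  | apply: measurable_fun_expR
  | apply: measurable_fun_ln
  | apply: measurable_fun_sh2
  | apply: measurable_fun_q
  | apply: measurable_fun_norm ].

Lemma eq_ler (R : realType) (a b : R) : a = b -> a <= b.
Proof. by move=> ->. Qed.

Section sobolev.
Context {R : realType}.
Notation mu := (@lebesgue_measure R).
Notation integrableT f := (mu.-integrable setT (EFin \o f)).
Implicit Types P Q : R -> R.

(** The Fourier side of the Sobolev space of order one; the weight is what
    square-integrability of [s * G s] on the line [Re s = 1/2] provides. *)
Definition h1 P := measurable_fun setT P /\
  integrableT (fun tau => (1 + tau ^+ 2) * P tau ^+ 2).

Let D (t : R) : 0 < 1 + t ^+ 2. Proof. by rewrite ltr_pwDl// sqr_ge0. Qed.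

Lemma h1_integrable_norm P : h1 P -> integrableT (fun tau => `|P tau|).
Proof.
move=> [mP iP].
apply: (integrable_le _ _ (integrable_fD measurableT iP integrable_oneDsqrV)) => //.
  by meas.
move=> t _ /=; rewrite ger0_norm//.
have := D t; set d := 1 + t ^+ 2 => d0.
rewrite -(ler_pM2r d0) mulrDl mulVf ?gt_eqF// -(real_normK (num_real (P t))).
have := sqr_ge0 (d * `|P t| - 2^-1).
nra.
Qed.

(** By the arithmetic-geometric inequality [|P| q] is at most
    [(1 + t ^ 2) P ^ 2 + q ^ 2 / (1 + t ^ 2)] up to constants, and the last term
    is of order [|t| ^ (- 3/2)] at infinity, which [w] dominates. *)
Lemma h1_integrable_norm_q P : h1 P -> integrableT (fun tau => `|P tau| * q tau).
Proof.
move=> [mP iP].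
apply: (integrable_le _ _ (integrable_fD measurableT iP
  (integrable_fZl measurableT 2 (@integrable_w R)))) => //; first by meas.
move=> t _ /=; have q0' := q_ge0 t; have w0 := w_ge0 t; have := D t; rewrite ger0_norm ?mulr_ge0//.
have [->|t0] := eqVneq t 0.
  by move=> /ltW d0; rewrite q0 mulr0 addr_ge0// mulr_ge0// ?sqr_ge0 ?w_ge0.
set d := 1 + t ^+ 2 => d0.
have qt := q_gt0 t0; have e4 := q4 t.
have ed : d = 1 + q t ^+ 8.
  by rewrite /d -(real_normK (num_real t)) -e4 -exprM.
have hw : q t ^+ 2 <= 2 * w t * d.
  rewrite /w mulrAC ler_pdivlMr; last by rewrite mulr_gt0 ?exprn_gt0// ltr_pwDl// sqr_ge0.
  rewrite ed; move: (q t) qt => r r0.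
  have r8 n : (n <= 8)%N -> r ^+ n <= 1 + r ^+ 8.
    have p8 : 0 <= r ^+ 8 by rewrite exprn_ge0// ltW.
    move=> n8; have [r1|r1] := leP r 1.
      have : r ^+ n <= 1 by rewrite exprn_ile1// ltW.
      lra.
    have : r ^+ n <= r ^+ 8 by rewrite ler_weXn2l// ltW.
    lra.
  have r5 := r8 5 isT; have r7 := r8 7 isT.
  have -> : r ^+ 2 * (r ^+ 3 * (1 + r ^+ 2)) = r ^+ 5 + r ^+ 7 by ring.
  by rewrite (le_trans (lerD r5 r7))//; apply: eq_ler; ring.
rewrite -(ler_pM2r d0) mulrDl -(real_normK (num_real (P t))).
have := sqr_ge0 (d * `|P t| - q t); move: hw.
move: (`|P t|) (q t) (w t) => p r v; nra.
Qed.

Lemma h1M P (m : R -> R) (C : R) : h1 P -> measurable_fun setT m ->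
  (forall t, `|m t| <= C) -> h1 (fun t => m t * P t).
Proof.
move=> [mP iP] mm mC; split; first by meas.
apply: (integrable_le _ _ (integrable_fZl measurableT (C ^+ 2) iP)) => //; first by meas.
move=> t _; have w0 (p : R) : 0 <= (1 + t ^+ 2) * p ^+ 2.
  by apply: mulr_ge0; [exact: ltW|exact: sqr_ge0].
rewrite ger0_norm// exprMn mulrCA; apply: ler_wpM2r => //.
rewrite -(real_normK (num_real (m t))) ler_pXn2r// nnegrE.
exact: le_trans (mC t).
Qed.

Lemma h1N P : h1 P -> h1 (fun t => - P t).
Proof.
move=> hP; have h : h1 (fun t => - 1 * P t) by apply: (@h1M _ (fun=> - 1) 1) => // t; rewrite normrN normr1.
by rewrite (_ : (fun t => _) = (fun t => - 1 * P t))//; apply/funext => t; rewrite mulN1r.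
Qed.

Lemma h1_ptanh P : h1 P -> h1 (fun t => ptanh t * P t).
Proof.
by move=> hP; apply: (h1M hP measurable_ptanh) => t; exact: norm_ptanh_le.
Qed.

End sobolev.

Section lebesgue_product.
Context {R : realType}.
Notation mu := (@lebesgue_measure R).
Variables (K : R -> R -> R) (a b : R -> R).
Hypotheses (mK : measurable_fun setT (fun z : R * R => K z.1 z.2))
  (ia : mu.-integrable setT (EFin \o a)) (ib : mu.-integrable setT (EFin \o b))
  (Kab : forall x y, `|K x y| <= a x * b y).

Lemma lebesgue_integrable_section1 x : mu.-integrable setT (EFin \o K x).
Proof.
exact: (@integrable_section1 _ _ (measurableTypeR R) (measurableTypeR R) R mu K a b).
Qed.

Lemma lebesgue_integrable_Rintegral1 :
  mu.-integrable setT (EFin \o (fun x => \int[mu]_y K x y)).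
Proof.
exact: (@integrable_Rintegral1 _ _ (measurableTypeR R) (measurableTypeR R) R mu mu K a b).
Qed.

Lemma lebesgue_fubini :
  \int[mu]_x (\int[mu]_y K x y) = \int[mu]_y (\int[mu]_x K x y).
Proof.
exact: (@Rfubini _ _ (measurableTypeR R) (measurableTypeR R) R mu mu K a b).
Qed.

End lebesgue_product.

Section phi.
Context {R : realType}.
Notation mu := (@lebesgue_measure R).
Notation integrableT f := (mu.-integrable setT (EFin \o f)).
Variables P Q : R -> R.
Hypotheses (hP : h1 P) (hQ : h1 Q).
Let mP : measurable_fun setT P := hP.1.
Let mQ : measurable_fun setT Q := hQ.1.

(** When [G = P + i Q], this is the real part of
    [int G t * exp (- i t y) dt]; the imaginary part is [phi Q (- P)]. *)
Definition phi (P Q : R -> R) (y : R) : R :=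
  \int[mu]_t (P t * cos (t * y) + Q t * sin (t * y)).

Let PQ t := `|P t| + `|Q t|.
Let iPQ : integrableT PQ.
Proof. by apply: integrable_fD => //; exact: h1_integrable_norm. Qed.
Let iPQq : integrableT (fun t => PQ t * q t).
Proof.
have h := integrable_fD measurableT (h1_integrable_norm_q hP) (h1_integrable_norm_q hQ).
by apply: eq_integrable h => // t _; rewrite /PQ /= mulrDl.
Qed.

Let le_PQ (a b t : R) (C : R) : `|a| <= C -> `|b| <= C -> `|P t * a + Q t * b| <= PQ t * C.
Proof.
move=> aC bC; rewrite (le_trans (ler_normD _ _))// !normrM /PQ mulrDl.
by rewrite lerD// ler_wpM2l.
Qed.

Lemma integrable_phi y : integrableT (fun t => P t * cos (t * y) + Q t * sin (t * y)).
Proof.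
apply: (integrable_le _ _ iPQ) => //; first by meas.
by move=> t _; rewrite (le_trans (le_PQ t (cos_max _) (sin_max _)))// mulr1.
Qed.

Lemma norm_phi_le y : `|phi P Q y| <= \int[mu]_t PQ t.
Proof.
apply: (le_trans (le_normr_Rintegral _ (integrable_phi y))) => //.
apply: le_Rintegral => //; first exact/integrable_norm/integrable_phi.
by move=> t _; rewrite (le_trans (le_PQ t (cos_max _) (sin_max _)))// mulr1.
Qed.

Lemma continuous_phi : continuous (phi P Q).
Proof.
move=> y; have yI : y \in (`]y - 1, y + 1[%classic : set R).
  by rewrite inE/= in_itv/=; apply/andP; split; lra.
apply: (@continuity_under_integral R _ _ mu (fun y t => P t * cos (t * y) + Q t * sin (t * y))
  setT measurableT (y - 1) (y + 1) _ _ PQ iPQ _ y yI).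
- by move=> z _; exact: integrable_phi.
- apply: aeW => t _ z _; apply: cvgD; apply: cvgM; try exact: cvg_cst.
    by apply: (@continuous_scale_comp _ cos); exact: continuous_cos.
  by apply: (@continuous_scale_comp _ sin); exact: continuous_sin.
- move=> z _; apply: aeW => t _.
  by rewrite (le_trans (le_PQ t (cos_max _) (sin_max _)))// mulr1.
Qed.

Lemma measurable_phi : measurable_fun setT (phi P Q).
Proof. exact: continuous_measurable_fun continuous_phi. Qed.

Let dphi (X u t : R) :=
  P t * (cos (t * (X + u)) - cos (t * X)) + Q t * (sin (t * (X + u)) - sin (t * X)).

Let dphiE X u t : dphi X u t =
  (P t * cos (t * X) + Q t * sin (t * X)) * (cos (t * u) - 1) +
  (Q t * cos (t * X) - P t * sin (t * X)) * sin (t * u).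
Proof. by rewrite /dphi (mulrDr t X u) cosD sinD; ring. Qed.

Let dphi_le X u t : `|dphi X u t| <= PQ t * (3 * (q t * q u)).
Proof.
have bnd (a b c s : R) : `|c| <= 1 -> `|s| <= 1 ->
    `|c * a - s * b| <= `|a| + `|b|.
  move=> c1 s1; rewrite (le_trans (ler_normB _ _))// !normrM lerD//.
    by rewrite ler_piMl.
  by rewrite ler_piMl.
have h : `|cos (t * u) - 1| + `|sin (t * u)| <= 3 * (q t * q u).
  by have := sin_le_q (t * u); have := oneBcos_le_q (t * u); rewrite qM; lra.
rewrite /dphi; apply: le_PQ; apply: le_trans h.
  rewrite (mulrDr t X u) cosD (_ : _ - cos (t * X) = cos (t * X) * (cos (t * u) - 1) - sin (t * X) * sin (t * u)); last by ring.
  by apply: bnd; [exact: cos_max|exact: sin_max].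
rewrite (mulrDr t X u) sinD (_ : _ - sin (t * X) = sin (t * X) * (cos (t * u) - 1) - (- cos (t * X)) * sin (t * u)); last by ring.
by apply: bnd; [exact: sin_max|rewrite normrN; exact: cos_max].
Qed.

Let integrable_dphi X u : integrableT (dphi X u).
Proof.
apply: (integrable_le _ _ (integrable_fZr measurableT (3 * q u) iPQq)) => //.
  by rewrite /dphi; meas.
by move=> t _; rewrite (le_trans (dphi_le _ _ _))// -mulrA (mulrCA 3).
Qed.

Let Rintegral_dphi X u : \int[mu]_t dphi X u t = phi P Q (X + u) - phi P Q X.
Proof.
rewrite -RintegralB//; try exact: integrable_phi.
by apply: eq_Rintegral => t _; rewrite /dphi; ring.
Qed.

(** The increments of [cos (t * y)] and [sin (t * y)] are at most [3 * q t * q u],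
    and [PQ * q] is integrable. The exponent [1/4] is a choice: the bound must be
    integrable against both [1 / sh2] and [PQ]. *)
Lemma phi_hoelder X u :
  `|phi P Q (X + u) - phi P Q X| <= 3 * \int[mu]_t (PQ t * q t) * q u.
Proof.
rewrite -Rintegral_dphi mulrAC -RintegralZl//.
apply: (le_trans (le_normr_Rintegral _ (integrable_dphi X u))) => //.
apply: le_Rintegral => //.
- exact/integrable_norm/integrable_dphi.
- exact: integrable_fZl.
- by move=> t _; rewrite (le_trans (dphi_le _ _ _))//; apply: eq_ler; ring.
Qed.

(** The regularised convolution of [phi] with [1 / sh2]: exchanging the
    integrals turns it into the multiplier [- i ptanh]. *)
Lemma phi_sh2 X : \int[mu]_u ((phi P Q (X + u) - phi P Q X) / sh2 u) =
  phi (fun t => ptanh t * Q t) (fun t => - (ptanh t * P t)) X.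
Proof.
pose K u t := dphi X u t / sh2 u.
have mK : measurable_fun setT (fun z : R * R => K z.1 z.2).
  rewrite /K /dphi; meas.
  - exact: (measurableT_comp mP measurable_snd).
  - exact: (measurableT_comp mQ measurable_snd).
have KL u t : `|K u t| <= (q u / `|sh2 u|) * (3 * (PQ t * q t)).
  rewrite /K normrM normfV mulrAC ler_wpM2r ?invr_ge0//.
  by rewrite (le_trans (dphi_le _ _ _))//; apply: eq_ler; ring.
have i3 := integrable_fZl measurableT 3 iPQq.
have := lebesgue_fubini mK integrable_q_sh2 i3 KL.
have -> : \int[mu]_u (\int[mu]_t K u t) = \int[mu]_u ((phi P Q (X + u) - phi P Q X) / sh2 u).
  by apply: eq_Rintegral => u _; rewrite /K RintegralZr// Rintegral_dphi.
move=> ->; apply: eq_Rintegral => t _.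
have -> : \int[mu]_u K u t = \int[mu]_u (
  (P t * cos (t * X) + Q t * sin (t * X)) * ((cos (t * u) - 1) / sh2 u) +
  (Q t * cos (t * X) - P t * sin (t * X)) * (sin (t * u) / sh2 u)).
  by apply: eq_Rintegral => u _; rewrite /K dphiE; ring.
have i1 := integrable_cos1_sh2 t; have i2 := integrable_sin_sh2 t.
rewrite RintegralD//; try exact: integrable_fZl.
rewrite !RintegralZl// Rintegral_cos1_sh2 Rintegral_sin_sh2; ring.
Qed.

(** Here the kernel [u / sh2 u] is integrable as it stands, and the exchange of
    integrals is direct. *)
Lemma phi_id_sh2 X : integrableT (fun u => phi P Q (X + u) * (u / sh2 u)) /\
  \int[mu]_u (phi P Q (X + u) * (u / sh2 u)) =
  phi (fun t => (pi ^+ 2 - ptanh t ^+ 2) * P t) (fun t => (pi ^+ 2 - ptanh t ^+ 2) * Q t) X.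
Proof.
pose K u t := (P t * cos (t * (X + u)) + Q t * sin (t * (X + u))) * (u / sh2 u).
have mK : measurable_fun setT (fun z : R * R => K z.1 z.2).
  rewrite /K; meas.
  - exact: (measurableT_comp mP measurable_snd).
  - exact: (measurableT_comp mQ measurable_snd).
have KL u t : `|K u t| <= `|u / sh2 u| * PQ t.
  rewrite /K normrM mulrC ler_wpM2l//.
  by rewrite (le_trans (le_PQ t (cos_max _) (sin_max _)))// mulr1.
have i1 := integrable_norm (@integrable_id_sh2 R).
have e u : \int[mu]_t K u t = phi P Q (X + u) * (u / sh2 u).
  by rewrite /K RintegralZr//; exact: integrable_phi.
split.
  have h := lebesgue_integrable_Rintegral1 mK i1 iPQ KL.
  by apply: eq_integrable h => // u _; rewrite /= e.
have := lebesgue_fubini mK i1 iPQ KL.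
have -> : \int[mu]_u (\int[mu]_t K u t) = \int[mu]_u (phi P Q (X + u) * (u / sh2 u)).
  by apply: eq_Rintegral => u _; rewrite e.
move=> ->; apply: eq_Rintegral => t _.
have -> : \int[mu]_u K u t = \int[mu]_u (
  (P t * cos (t * X) + Q t * sin (t * X)) * (u / sh2 u * cos (t * u)) +
  (Q t * cos (t * X) - P t * sin (t * X)) * (u / sh2 u * sin (t * u))).
  by apply: eq_Rintegral => u _; rewrite /K (mulrDr t X u) cosD sinD; ring.
have i3 := integrable_idcos_sh2 t; have i4 := integrable_idsin_sh2 t.
rewrite RintegralD//; try exact: integrable_fZl.
rewrite !RintegralZl// Rintegral_idcos_sh2 Rintegral_idsin_sh2; ring.
Qed.

End phi.

(** * The principal value in the logarithmic coordinate *)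

Section ae_eq.
Context {R : realType} d (T : measurableType d) (m : {measure set T -> \bar R}).

Lemma ae_eq_Rintegral (D : set T) (f g : T -> R) : measurable D ->
  measurable_fun D f -> measurable_fun D g ->
  {ae m, forall t, D t -> f t = g t} -> m.-integrable D (EFin \o g) ->
  m.-integrable D (EFin \o f) /\ \int[m]_(t in D) f t = \int[m]_(t in D) g t.
Proof.
move=> mD mf mg fg ig.
have emf : measurable_fun D (EFin \o f) by exact/measurable_EFinP.
have emg : measurable_fun D (EFin \o g) by exact/measurable_EFinP.
split.
  apply/integrableP; split => //; move/integrableP : ig => [_].
  congr (_ < _)%E; apply: ae_eq_integral => //.
  - by apply: measurableT_comp emg.
  - by apply: measurableT_comp emf.
  - by apply: filterS fg => t h Dt; rewrite /= h.
rewrite /Rintegral; congr fine; apply: ae_eq_integral => //.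
by apply: filterS fg => t h Dt; rewrite /= h.
Qed.

End ae_eq.

Section truncated_kernel.
Context {R : realType}.
Notation mu := (@lebesgue_measure R).
Notation integrableT f := (mu.-integrable setT (EFin \o f)).

(** The cut-off [e < |t - x|] for [t = x * exp u] and [eta = e / x]. *)
Definition chi (eta u : R) : R := (eta < `|expR u - 1|)%R%:R.

Lemma chi_ge0 eta u : 0 <= chi eta u. Proof. exact: ler0n. Qed.
Lemma chi_le1 eta u : chi eta u <= 1. Proof. by rewrite /chi lern1 leq_b1. Qed.

Lemma measurable_chi eta : measurable_fun setT (chi eta).
Proof.
rewrite (_ : chi eta = \1_[set u | eta < `|expR u - 1|]); last first.
  apply/funext => u; rewrite /chi indicE; congr (_%:R).
  by apply/esym; congr (nat_of_bool _); apply/idP/idP; rewrite inE.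
apply: measurable_indic.
have mf : measurable_fun setT (fun u : R => `|expR u - 1|) by meas.
rewrite (_ : [set u | _] = setT `&` (fun u : R => `|expR u - 1|) @^-1` `]eta, +oo[%classic).
  by apply: mf => //; exact: measurable_itv.
by rewrite setTI; apply/seteqP; split => u /=; rewrite in_itv/= andbT.
Qed.

Variable eta : R.
Hypothesis eta0 : 0 < eta.
Let d1 := ln (1 + eta).
Let d1_gt0 : 0 < d1. Proof. by rewrite ln_gt0// ltrDl. Qed.

Lemma chi_neq0 u : chi eta u != 0 -> d1 <= `|u|.
Proof.
rewrite /chi; case: ltP => h; last by rewrite mulr0n eqxx.
move=> _; rewrite -ler_expR lnK ?posrE; last by rewrite ltr_pwDl ?ltW.
have [u0|u0] := leP 0 u.
  have e1 : 1 <= expR u by rewrite -expR0 ler_expR.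
  by move: h; rewrite (ger0_norm u0) ger0_norm ?subr_ge0//; lra.
have e1 : expR u < 1 by rewrite -[ltRHS]expR0 ltr_expR.
move: h; rewrite (ltr0_norm u0) expRN ltr0_norm ?subr_lt0//.
have := expR_gt0 u; set a := expR u => a0 h.
by rewrite -[_^-1]mul1r ler_pdivlMr//; nra.
Qed.

Lemma chi_sh2_le u : `|chi eta u / sh2 u| <= (d1^-1 + 8) * (1 + u ^+ 2)^-1.
Proof.
have D0 : 0 < 1 + u ^+ 2 by rewrite ltr_pwDl// sqr_ge0.
have K0 : 0 < d1^-1 + 8 by rewrite addr_gt0// invr_gt0.
have [->|c0] := eqVneq (chi eta u) 0.
  by rewrite mul0r normr0 mulr_ge0 ?invr_ge0 ?ltW.
have d1u := chi_neq0 c0; have [h1 h2 _] := norm_sh2_ge u.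
have s0 : 0 < `|sh2 u| by rewrite (lt_le_trans _ h1)// (lt_le_trans _ d1u).
rewrite normrM normfV ger0_norm ?chi_ge0// ler_pdivrMr// mulrAC ler_pdivlMr//.
apply: (@le_trans _ _ (1 + u ^+ 2)); first by rewrite ler_piMl ?chi_le1 ?ltW.
rewrite mulrDl -(real_normK (num_real u)) lerD// mulrC ler_pdivlMr// mul1r.
exact: le_trans h1.
Qed.

Lemma integrable_chi_sh2 : integrableT (fun u => chi eta u / sh2 u).
Proof.
apply: (integrable_le _ _ (integrable_fZl measurableT (d1^-1 + 8) (@integrable_oneDsqrV R))) => //.
  by have := measurable_chi eta => ?; meas.
by move=> u _; exact: chi_sh2_le.
Qed.

Hypothesis eta1 : eta < 1.
Let d2 := - ln (1 - eta).

Let d12 : d2 - d1 <= d1 * (eta / (1 - eta)).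
Proof.
have p1 : 0 < 1 + eta by rewrite addr_gt0.
have p2 : 0 < 1 - eta by rewrite subr_gt0.
have l (y : R) : 0 < y -> 1 - y^-1 <= ln y.
  move=> y0; have y0' : 0 < y^-1 by rewrite invr_gt0.
  have h : -1 < y^-1 - 1 by lra.
  by have := le_ln1Dx h; rewrite addrC subrK lnV ?posrE//; lra.
have h1 := l _ p1.
have h2 := l _ (mulr_gt0 p2 p1); rewrite lnM ?posrE// in h2.
have p21 := mulr_gt0 p2 p1.
have e1 : 1 - (1 + eta)^-1 = eta / (1 + eta) by field; rewrite gt_eqF.
have e2 : 1 - ((1 - eta) * (1 + eta))^-1 = - (eta / (1 + eta) * (eta / (1 - eta))).
  by field; rewrite !gt_eqF.
apply: (@le_trans _ _ (eta / (1 + eta) * (eta / (1 - eta)))); last first.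
  by rewrite ler_wpM2r -?e1// divr_ge0 ?ltW.
by move: h2; rewrite e2 /d1 /d2; lra.
Qed.

(** The contributions of the two sides of the origin cancel up to the piece
    between [d1 = ln (1 + eta)] and [d2 = - ln (1 - eta)], of length of order
    [eta ^ 2]; this is what remains of the principal value. *)
Lemma Rintegral_chi_sh2_le : `|\int[mu]_u (chi eta u / sh2 u)| <= eta / (1 - eta).
Proof.
have mchi := measurable_chi eta.
have i1 := integrable_chi_sh2.
have mchiN : measurable_fun setT (fun u : R => chi eta (- u)).
  by apply: (measurableT_comp mchi); exact: oppr_measurable.
have i2 : integrableT (fun u => chi eta (- u) / sh2 u).
  apply: (integrable_le _ _ (integrable_fZl measurableT (d1^-1 + 8) (@integrable_oneDsqrV R))) => //.
    by meas.
  move=> u _; have := chi_sh2_le (- u).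
  by rewrite sqrrN sh2N invrN mulrN normrN.
set T := \int[mu]_u (chi eta u / sh2 u).
have T2 : \int[mu]_u (chi eta (- u) / sh2 u) = - T.
  rewrite /T -(@Rintegral_opp _ (fun u => chi eta u / sh2 u)); last by meas.
  rewrite -mulN1r -RintegralZl//.
    by apply: eq_Rintegral => u _; rewrite sh2N invrN mulrN mulN1r opprK.
  apply: eq_integrable (integrable_fZl measurableT (-1) i2) => // u _.
  by rewrite /= sh2N invrN mulrN mulN1r.
pose D u := chi eta u / sh2 u - chi eta (- u) / sh2 u.
have iD : integrableT D by exact: integrable_fB.
have TD : T = \int[mu]_(u in `[0, +oo[) D u.
  have : \int[mu]_u D u = 2 * T by rewrite RintegralB// T2 -/T; ring.
  rewrite Rintegral_even//; first by lra.
  by move=> u; rewrite /D opprK sh2N invrN; ring.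
pose S : set R := `[d1, d2]%classic.
have p1 : 0 < 1 + eta by rewrite addr_gt0.
have p2 : 0 < 1 - eta by rewrite subr_gt0.
have DS u : 0 <= u -> 0 <= D u <= ((fun=> d1^-1) \_ S) u.
  move=> u0; rewrite /D -mulrBl.
  have c1 : chi eta u = (d1 < u)%R%:R.
    have e1 : 1 <= expR u by rewrite -expR0 ler_expR.
    rewrite /chi ger0_norm ?subr_ge0// ltrBrDl.
    by rewrite -{1}(lnK p1) ltr_expR.
  have c2 : chi eta (- u) = (d2 < u)%R%:R.
    have e1 : expR (- u) <= 1 by rewrite -[leRHS]expR0 ler_expR oppr_le0.
    rewrite /chi ler0_norm ?subr_le0// opprB.
    by rewrite ltrBrDl -ltrBrDr -{1}(lnK p2) ltr_expR ltrNl.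
  have d1d2 : d1 <= d2.
    rewrite -subr_ge0 /d1 /d2 -opprD oppr_ge0 -lnM ?posrE// ln_le0//; nra.
  rewrite c1 c2 patchE.
  have [h2|h2] := ltP d2 u.
    rewrite (le_lt_trans d1d2 h2) subrr mul0r lexx/=; case: ifP => // _.
    by rewrite invr_ge0 ltW.
  have [h1|h1] := ltP d1 u; last first.
    by rewrite subrr mul0r lexx/=; case: ifP => // _; rewrite invr_ge0 ltW.
  rewrite subr0 mul1r mem_set; last by rewrite /S/= in_itv/= h2 ltW.
  have [hs _ _] := sh2_ge u0.
  have s0 : 0 < sh2 u by rewrite (lt_le_trans _ hs)// (lt_trans d1_gt0).
  by rewrite invr_ge0 (ltW s0)/= lef_pV2 ?posrE// (le_trans (ltW h1)).
have d1d2 : d1 <= d2.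
  rewrite -subr_ge0 /d1 /d2 -opprD oppr_ge0 -lnM ?posrE// ln_le0//; nra.
have iD0 : mu.-integrable `[0%R, +oo[ (EFin \o D) by exact: integrableS iD.
have iS : mu.-integrable `[0%R, +oo[ (EFin \o ((fun=> d1^-1) \_ S)).
  apply: (@integrableS _ _ _ _ setT) => //.
  have iS0 : mu.-integrable S (EFin \o (fun=> d1^-1)).
    by apply: integrable_segment; exact: cst_continuous.
  rewrite -restrict_EFin; apply: (integrable_mkcond _ _).1 iS0; exact: measurable_itv.
rewrite TD ger0_norm; last first.
  by apply: Rintegral_ge0 => u /=; rewrite in_itv/= andbT => /DS /andP[].
apply: (@le_trans _ _ (\int[mu]_(u in `[0, +oo[) ((fun=> d1^-1) \_ S) u)).
  apply: le_Rintegral => // u /=; rewrite in_itv/= andbT => /DS /andP[]//.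
rewrite -Rintegral_mkcondr (_ : _ `&` S = S); last first.
  apply/seteqP; split => u; first by case.
  rewrite /S/= !in_itv/= andbT => /andP[h h']; split; last by rewrite h.
  by rewrite (le_trans _ h)// ltW.
by rewrite Rintegral_segment_cst// mulrC ler_pdivrMr// mulrC.
Qed.

End truncated_kernel.

(** * The two transforms of a function given by its Fourier integral *)

Section lebesgue_dominated.
Context {R : realType}.
Notation mu := (@lebesgue_measure R).

Lemma lebesgue_dominated_cvg (f_ : nat -> R -> R) (f g : R -> R) :
  (forall n, measurable_fun setT (f_ n)) -> measurable_fun setT f ->
  {ae mu, forall u, f_ ^~ u @ \oo --> f u} ->
  mu.-integrable setT (EFin \o g) -> (forall n u, `|f_ n u| <= g u) ->
  \int[mu]_u f_ n u @[n --> \oo] --> \int[mu]_u f u.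
Proof.
move=> m1 m2 m3 ig m4.
have m3' : {ae mu, forall u, (setT : set R) u -> f_ ^~ u @ \oo --> f u}.
  by apply: (@filterS _ _ (ae_filter_ringOfSetsType mu) _ _ _ m3).
have [_ H] := @Rintegral_dominated_cvg R _ (measurableTypeR R) mu setT f_ f g
  measurableT m1 m2 m3' ig (fun n u _ => m4 n u).
exact: H.
Qed.

End lebesgue_dominated.

Section hilbert_real.
Context {R : realType}.
Notation mu := (@lebesgue_measure R).
Notation integrableT f := (mu.-integrable setT (EFin \o f)).

(** In Mellin terms: with [G (1/2 + i t) = P t + i Q t], the real part of the
    inverse Mellin transform of [G]; its imaginary part is [hphi Q (- P)]. *)
Definition hphi (P Q : R -> R) (t : R) : R := expR (- (ln t / 2)) * (phi P Q (ln t) / (2 * pi)).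

Let pi2 : 2 * pi != 0 :> R. Proof. by rewrite mulf_neq0// gt_eqF// pi_gt0. Qed.

Section representation.
Variables (P Q f : R -> R).
Hypotheses (hP : h1 P) (hQ : h1 Q) (mf : measurable_fun (Rpos : set R) f).
Hypothesis fE : {ae mu, forall t, (Rpos : set R) t -> f t = hphi P Q t}.

Let mphi := measurable_phi hP hQ.

Lemma measurable_hphi : measurable_fun setT (hphi P Q).
Proof.
rewrite /hphi; meas.
by apply: (measurableT_comp mphi); exact: measurable_ln.
Qed.

Let mRpos : measurable (Rpos : set (measurableTypeR R)).
Proof. exact: measurable_itv. Qed.

Variable x : R.
Hypothesis x0 : 0 < x.
Let X := ln x.
Let c := expR (- (X / 2)) / (2 * pi).

Let ln_exp u : ln (x * expR u) = X + u.
Proof. by rewrite lnM ?posrE ?expR_gt0// expRK. Qed.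

Let norm_exp u : `|x * expR u - x| = x * `|expR u - 1|.
Proof. by rewrite -{2}(mulr1 x) -mulrBr normrM gtr0_norm. Qed.

Let kernel_exp u : u != 0 ->
  expR (- ((X + u) / 2)) / (x * expR u - x) * (x * expR u) = expR (- (X / 2)) / sh2 u.
Proof.
move=> u0; have ee : expR u = expR (u / 2) * expR (u / 2) by rewrite -expRD; congr expR; field.
rewrite mulrDl opprD expRD /sh2 (expRN (u / 2)) ee.
have a0 := expR_gt0 (u / 2); set a := expR (u / 2) in a0 *.
have a1 : a ^+ 2 - 1 != 0.
  rewrite subr_eq0 expr2 -ee -expR0; apply/eqP => /expR_inj h.
  by rewrite h eqxx in u0.
have ex : x * (a * a) - x = x * (a ^+ 2 - 1) by ring.
by field; rewrite (gt_eqF a0)/= ex -expr2 mulf_neq0 ?a1 ?gt_eqF.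
Qed.

Section truncation.
Variable e : R.
Hypothesis e0 : 0 < e.
Let eta := e / x.
Let eta0 : 0 < eta. Proof. exact: divr_gt0. Qed.

Let moff : measurable (off_diagonal x e : set (measurableTypeR R)).
Proof.
apply: measurableI => //.
have m : measurable_fun setT (fun t : R => `|t - x|) by meas.
rewrite (_ : [set t | _] = setT `&` (fun t : R => `|t - x|) @^-1` `]e, +oo[%classic).
  by apply: m => //; exact: measurable_itv.
by rewrite setTI; apply/seteqP; split => u /=; rewrite in_itv/= andbT.
Qed.

Lemma integrable_chi_phi : integrableT (fun u => chi eta u * (phi P Q (X + u) / sh2 u)).
Proof.
have i1 := integrable_chi_sh2 eta0.
apply: (integrable_le _ _ (integrable_fZl measurableT
  (\int[mu]_t (`|P t| + `|Q t|)) (integrable_norm i1))) => //.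
  have := @measurable_chi R eta => ?; meas.
  by apply: (measurableT_comp mphi); meas.
move=> u _ /=; rewrite mulrCA normrM ler_wpM2r//.
exact: norm_phi_le.
Qed.

(** Under [t = x * exp u] the factor [t ^ (- 1/2)] of [hphi] combines with
    [dt / (t - x)] into [x ^ (- 1/2) du / sh2 u]. *)
Lemma truncated_hilbert_exp :
  mu.-integrable (off_diagonal x e) (EFin \o (fun t => f t / (t - x))) /\
  \int[mu]_(t in off_diagonal x e) (f t / (t - x)) =
    c * \int[mu]_u (chi eta u * (phi P Q (X + u) / sh2 u)).
Proof.
pose k (t : R) := (e < `|t - x|)%R%:R * (hphi P Q t / (t - x)).
have mhphi := measurable_hphi.
have mk : measurable_fun setT k.
  apply: measurable_funM; last by meas.
  rewrite (_ : (fun t => _) = \1_[set t | e < `|t - x|]).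
    apply: measurable_indic.
    have m : measurable_fun setT (fun t : R => `|t - x|) by meas.
    rewrite (_ : [set t | _] = setT `&` (fun t : R => `|t - x|) @^-1` `]e, +oo[%classic).
      by apply: m => //; exact: measurable_itv.
    by rewrite setTI; apply/seteqP; split => u /=; rewrite in_itv/= andbT.
  apply/funext => u; rewrite indicE; congr (_%:R).
  by apply/esym; congr (nat_of_bool _); apply/idP/idP; rewrite inE.
have kE u : k (x * expR u) * (x * expR u) = c * (chi eta u * (phi P Q (X + u) / sh2 u)).
  have -> : chi eta u = (e < `|x * expR u - x|)%R%:R.
    by rewrite /chi norm_exp /eta ltr_pdivrMr// mulrC.
  rewrite /k /hphi ln_exp; have [->|u0] := eqVneq u 0.
    by rewrite expR0 mulr1 subrr normr0 ltNge (ltW e0)/= !mul0r mulr0.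
  have h := kernel_exp u0.
  rewrite (_ : _ * (x * expR u) = (e < `|x * expR u - x|)%R%:R * (phi P Q (X + u) / (2 * pi)) *
     (expR (- ((X + u) / 2)) / (x * expR u - x) * (x * expR u))); last by ring.
  by rewrite h /c; ring.
have ik : mu.-integrable (Rpos : set R) (EFin \o k).
  apply/(integrable_exp_subst x0); first exact: measurable_funTS.
  apply: eq_integrable (integrable_fZl measurableT c integrable_chi_phi) => // u _.
  by rewrite /= kE.
have offR : (off_diagonal x e : set R) `<=` Rpos by move=> t [].
have ik' : mu.-integrable (off_diagonal x e) (EFin \o k).
  by apply: integrableS ik => //.
have koff (t : R) : (off_diagonal x e : set R) t -> hphi P Q t / (t - x) = k t.
  by move=> [_ /= h]; rewrite /k h mul1r.
have [i1 ->] : mu.-integrable (off_diagonal x e) (EFin \o (fun t => f t / (t - x))) /\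
   \int[mu]_(t in off_diagonal x e) (f t / (t - x)) = \int[mu]_(t in off_diagonal x e) k t.
  apply: ae_eq_Rintegral => //.
  - have mf' : measurable_fun (off_diagonal x e : set R) f by apply: measurable_funS mf.
    by meas.
  - exact: measurable_funTS.
  - by apply: (@filterS _ _ (ae_filter_ringOfSetsType mu) _ _ _ fE) => t h ht; rewrite -koff// h//; exact: offR.
split => //.
rewrite -RintegralZl//; last exact: integrable_chi_phi.
rewrite /off_diagonal Rintegral_mkcondr.
transitivity (\int[mu]_(t in Rpos) k t).
  apply: eq_Rintegral => t _; rewrite patchE; case: ifPn => //.
  by rewrite notin_setE/= => /negP; rewrite /k => /negbTE ->; rewrite mul0r.
rewrite (Rintegral_exp_subst x0); last exact: measurable_funTS.
by apply: eq_Rintegral => u _; rewrite kE.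
Qed.

End truncation.

(** Subtract [phi X] at the singularity: the difference quotient is dominated by
    [q u / |sh2 u|], and what was subtracted tends to [0] since the cut-off
    is almost symmetric in [u]. *)
Lemma truncated_hilbert_cvg :
  \int[mu]_(t in off_diagonal x e) (f t / (t - x)) @[e --> 0^'+] -->
  hphi (fun t => ptanh t * Q t) (fun t => - (ptanh t * P t)) x.
Proof.
apply/cvg_at_rightP => e_ [e_gt0 e_cvg].
pose eta n := e_ n / x.
have eta0 n : 0 < eta n by rewrite divr_gt0.
have eta_cvg : eta n @[n --> \oo] --> (0 : R).
  by rewrite -(mul0r x^-1); apply: cvgM => //; exact: cvg_cst.
rewrite /hphi -/X -phi_sh2//.
set L := \int[mu]_u _.
pose d u := (phi P Q (X + u) - phi P Q X) / sh2 u.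
have md : measurable_fun setT d.
  by rewrite /d; meas; apply: (measurableT_comp mphi); meas.
pose C := 3 * \int[mu]_t ((`|P t| + `|Q t|) * q t).
have dq u : `|d u| <= C * (q u / `|sh2 u|).
  by rewrite /d normrM normfV mulrA ler_wpM2r ?invr_ge0//; exact: phi_hoelder.
have iq := integrable_fZl measurableT C (@integrable_q_sh2 R).
have mchi n := @measurable_chi R (eta n).
have split_int n : \int[mu]_(t in off_diagonal x (e_ n)) (f t / (t - x)) =
    c * (\int[mu]_u (chi (eta n) u * d u) + phi P Q X * \int[mu]_u (chi (eta n) u / sh2 u)).
  have [_ ->] := truncated_hilbert_exp (e_gt0 n); congr (_ * _).
  have i1 := integrable_chi_sh2 (eta0 n).
  have i2 : integrableT (fun u => chi (eta n) u * d u).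
    apply: (integrable_le _ _ iq) => //; first by have := mchi n => ?; meas.
    move=> u _; apply: le_trans (dq u).
    by rewrite normrM ler_piMl// ger0_norm ?chi_ge0// chi_le1.
  rewrite -RintegralZl// -RintegralD//; last exact: integrable_fZl.
  by apply: eq_Rintegral => u _; rewrite /d; ring.
rewrite (_ : (fun n => _) = (fun n => c * (\int[mu]_u (chi (eta n) u * d u) +
    phi P Q X * \int[mu]_u (chi (eta n) u / sh2 u)))); last first.
  by apply/funext => n; rewrite -split_int.
have -> : expR (- (X / 2)) * (L / (2 * pi)) = c * (L + phi P Q X * 0).
  by rewrite /c; ring.
apply: cvgM; first exact: cvg_cst.
apply: cvgD; last first.
  apply: cvgM; first exact: cvg_cst.
  apply: norm_cvg0.
  apply: (@squeeze_cvgr _ _ _ _ (fun=> 0) (fun n => eta n / (1 - eta n))).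
  - have : \forall n \near \oo, eta n < 1 by exact: (cvgr_lt _ eta_cvg).
    apply: filterS => n h; rewrite normr_ge0/=; exact: Rintegral_chi_sh2_le.
  - exact: cvg_cst.
  - rewrite -[X in _ --> X](mul0r (1 - 0)^-1); apply: cvgM => //.
    apply: cvgV; first by rewrite subr0 oner_neq0.
    by apply: cvgB => //; exact: cvg_cst.
have m1 n : measurable_fun setT (fun u => chi (eta n) u * d u).
  by have := mchi n => ?; meas.
have m2 : {ae mu, forall u, (fun n => chi (eta n) u * d u) @ \oo --> d u}.
  apply: aeW => u; have [->|u0] := eqVneq u 0.
    by rewrite /d sh20 invr0 mulr0; under eq_fun do rewrite mulr0; exact: cvg_cst.
  have p : 0 < `|expR u - 1|.
    by rewrite normr_gt0 subr_eq0 -expR0; apply/eqP => /expR_inj h; rewrite h eqxx in u0.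
  apply: cvg_near_cst.
  have : \forall n \near \oo, eta n < `|expR u - 1| by exact: (cvgr_lt _ eta_cvg).
  by apply: filterS => n h; rewrite /chi h mul1r.
have m3 n u : `|chi (eta n) u * d u| <= C * (q u / `|sh2 u|).
  apply: le_trans (dq u).
  by rewrite normrM ler_piMl// ger0_norm ?chi_ge0// chi_le1.
exact: (lebesgue_dominated_cvg m1 md m2 iq m3).
Qed.

(** The same substitution turns the logarithmic kernel into [u / sh2 u], off the
    null set [t = x]. *)
Lemma stieltjes_exp :
  mu.-integrable (Rpos : set R) (EFin \o (fun t => stieltjes2_kernel x t * f t)) /\
  \int[mu]_(t in Rpos) (stieltjes2_kernel x t * f t) =
  hphi (fun t => (pi ^+ 2 - ptanh t ^+ 2) * P t) (fun t => (pi ^+ 2 - ptanh t ^+ 2) * Q t) x.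
Proof.
have mhphi := measurable_hphi.
pose k (t : R) := (ln x - ln t) / (x - t) * hphi P Q t.
have mk : measurable_fun setT k by rewrite /k; meas.
have [iphi phiE] := phi_id_sh2 hP hQ X.
have kE u : k (x * expR u) * (x * expR u) = c * (phi P Q (X + u) * (u / sh2 u)).
  rewrite /k /hphi ln_exp -/X; have [->|u0] := eqVneq u 0.
    by rewrite addr0 subrr !mul0r !mulr0.
  have h := kernel_exp u0.
  have -> : (X - (X + u)) / (x - x * expR u) = u / (x * expR u - x).
    by rewrite opprD addrA subrr add0r -[in RHS]opprB invrN mulrN mulNr.
  rewrite (_ : _ * (x * expR u) = u * (phi P Q (X + u) / (2 * pi)) *
     (expR (- ((X + u) / 2)) / (x * expR u - x) * (x * expR u))); last by ring.
  by rewrite h /c; ring.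
have ik : mu.-integrable (Rpos : set R) (EFin \o k).
  apply/(integrable_exp_subst x0); first exact: measurable_funTS.
  apply: eq_integrable (integrable_fZl measurableT c iphi) => // u _.
  by rewrite /= kE.
have xneq : {ae mu, forall t : R, t != x}.
  exists [set x]; split => //; first exact: lebesgue_measure_set1.
  by move=> t /= /negP; rewrite negbK => /eqP.
have [i1 ->] : mu.-integrable (Rpos : set R) (EFin \o (fun t => stieltjes2_kernel x t * f t)) /\
   \int[mu]_(t in Rpos) (stieltjes2_kernel x t * f t) = \int[mu]_(t in Rpos) k t.
  apply: ae_eq_Rintegral => //.
  - apply: measurable_funM => //; apply: measurable_funTS.
    rewrite /stieltjes2_kernel; apply: measurable_fun_ifT => //; last by meas.
    by apply: measurable_fun_eqr => //.
  - exact: measurable_funTS.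
  - apply: (@filterS2 _ _ (ae_filter_ringOfSetsType mu) _ _ _ _ fE xneq) => t h tx ht; rewrite h// /stieltjes2_kernel.
    by rewrite (negbTE tx).
split => //.
rewrite (Rintegral_exp_subst x0); last exact: measurable_funTS.
transitivity (c * \int[mu]_u (phi P Q (X + u) * (u / sh2 u))).
  by rewrite -RintegralZl//; apply: eq_Rintegral => u _; rewrite kE.
by rewrite phiE /hphi /c; ring.
Qed.

End representation.
End hilbert_real.

(** * Abel summation and the Poisson kernel *)

Section poisson.
Context {R : realType}.
Notation mu := (@lebesgue_measure R).
Notation integrableT f := (mu.-integrable setT (EFin \o f)).

(** Abel's convergence factor: the Fourier integral of [wtrunc] need not converge
    absolutely, and this factor makes the exchange of integrals legitimate. *)
Definition abel (eps t : R) : R := expR (- (eps * `|t|)).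
(** The Fourier transform of [abel eps]; its total mass is [2 * pi], not [1]. *)
Definition poisson (eps v : R) : R := 2 * (eps / (eps ^+ 2 + v ^+ 2)).

Lemma measurable_fun_poisson d (T : measurableType d) (D : set T) (eps : R) (f : T -> R) :
  measurable_fun D f -> measurable_fun D (fun x => poisson eps (f x)).
Proof. by move=> mf; rewrite /poisson; meas. Qed.

Lemma measurable_fun_abel d (T : measurableType d) (D : set T) (eps : R) (f : T -> R) :
  measurable_fun D f -> measurable_fun D (fun x => abel eps (f x)).
Proof. by move=> mf; rewrite /abel; meas. Qed.

Section abel_kernel.
Variables (eps v : R).
Hypothesis eps0 : 0 < eps.

Lemma abel_ge0 t : 0 <= abel eps t. Proof. exact: expR_ge0. Qed.

Lemma abel_le1 t : abel eps t <= 1.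
Proof. by rewrite /abel -expR0 ler_expR oppr_le0 mulr_ge0// ltW. Qed.

Let half (h : R -> R) (t : R) : (`[0%R, +oo[%classic : set R) t ->
  expR (- (eps * t)) * h t = abel eps t * h t.
Proof. by rewrite /= in_itv/= andbT /abel => /ger0_norm ->. Qed.

Lemma abel_cos : integrableT (fun t => abel eps t * cos (v * t)) /\
  \int[mu]_t (abel eps t * cos (v * t)) = poisson eps v.
Proof.
have [i h] := laplace_cos v eps0.
have ev (t : R) : abel eps (- t) * cos (v * - t) = abel eps t * cos (v * t).
  by rewrite /abel normrN mulrN cosN.
have i' : integrableT (fun t => abel eps t * cos (v * t)).
  apply: integrable_even => //.
    by apply: measurable_funM; [exact: measurable_fun_abel|meas].
  apply: eq_integrable i => // t; rewrite inE => ht.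
  by rewrite /= (half (fun t => cos (v * t)) ht).
split => //; rewrite Rintegral_even// /poisson -h; congr (_ * _).
by apply: eq_Rintegral => t; rewrite inE => ht; rewrite (half (fun t => cos (v * t)) ht).
Qed.

Lemma integrable_abel : integrableT (abel eps).
Proof.
have [i _] := laplace_cst eps0.
apply: integrable_even => //; first exact: measurable_fun_abel.
  by move=> t; rewrite /abel normrN.
apply: eq_integrable i => // t; rewrite inE => ht.
by have := half (fun=> 1) ht; rewrite /= !mulr1 => ->.
Qed.

Lemma abel_sin : integrableT (fun t => abel eps t * sin (v * t)) /\
  \int[mu]_t (abel eps t * sin (v * t)) = 0.
Proof.
have i : integrableT (fun t => abel eps t * sin (v * t)).
  apply: (integrable_le _ _ integrable_abel) => //.
    by apply: measurable_funM; [exact: measurable_fun_abel|meas].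
  by move=> t _; rewrite normrM ger0_norm ?abel_ge0// ler_piMr ?abel_ge0// sin_max.
split => //; apply: Rintegral_odd => // t.
by rewrite /abel normrN !mulrN sinN mulrN.
Qed.

End abel_kernel.

(** Multiplying by the integrable weight [1 / (1 + t ^ 2)] puts the kernel in the
    scope of Fubini; dividing by it afterwards keeps measurability. *)
Lemma measurable_Rintegral_bounded (K : R -> R -> R) (a : R -> R) :
  measurable_fun setT (fun z : R * R => K z.1 z.2) ->
  integrableT a -> (forall t u, `|K t u| <= a u) ->
  measurable_fun setT (fun t => \int[mu]_u K t u).
Proof.
move=> mK ia Ka.
pose w2 (t : R) := (1 + t ^+ 2)^-1.
have w0 t : 0 < w2 t by rewrite invr_gt0 ltr_pwDl// sqr_ge0.
have mw : measurable_fun setT (fun z : R * R => w2 z.1 * K z.1 z.2).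
  by apply: measurable_funM => //; rewrite /w2; meas.
have Kw t u : `|w2 t * K t u| <= w2 t * a u.
  by rewrite normrM gtr0_norm// ler_pM2l.
have /measurable_int/measurable_EFinP m := lebesgue_integrable_Rintegral1 mw
  (@integrable_oneDsqrV R) ia Kw.
rewrite (_ : (fun t => _) = (fun t => (1 + t ^+ 2) * \int[mu]_u (w2 t * K t u))).
  by apply: measurable_funM => //; meas.
apply/funext => t; rewrite -RintegralZl//; last first.
  have i := lebesgue_integrable_section1 mw ia Kw t.
  by apply: eq_integrable i.
by apply: eq_Rintegral => u _; rewrite /w2 mulVKf// gt_eqF// ltr_pwDl// sqr_ge0.
Qed.

Section fourier_truncated.

(** For [g = g1 + i g2] this is the real part of the truncated Fourier integral of
    [g u * exp (i t u)]; the imaginary part is [wtrunc g2 (- g1)]. *)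
Definition wtrunc (g1 g2 : R -> R) (k t : R) : R :=
  \int[mu]_(u in `[- k, k]) (g1 u * cos (t * u) - g2 u * sin (t * u)).

Variables (g1 g2 : R -> R).
Hypotheses (mg1 : measurable_fun setT g1) (mg2 : measurable_fun setT g2).
Hypotheses (ig1 : integrableT (fun u => g1 u ^+ 2)) (ig2 : integrableT (fun u => g2 u ^+ 2)).

Definition win (k u : R) : R := (`|u| <= k)%R%:R.

Lemma win_ge0 k u : 0 <= win k u. Proof. exact: ler0n. Qed.
Lemma win_le1 k u : win k u <= 1. Proof. by rewrite /win lern1 leq_b1. Qed.

Lemma winE k u : win k u = \1_(`[- k, k]%classic : set R) u.
Proof.
by rewrite indicE /win; congr (nat_of_bool _)%:R; apply/idP/idP;
   rewrite ?inE/= in_itv/= ler_norml.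
Qed.

Lemma measurable_win k : measurable_fun setT (win k).
Proof.
rewrite (_ : win k = \1_(`[- k, k]%classic : set R)); last by apply/funext => u; exact: winE.
by apply: measurable_indic; exact: measurable_itv.
Qed.

Lemma Rintegral_win (k : R) (f : R -> R) : \int[mu]_(u in `[- k, k]) f u = \int[mu]_u (win k u * f u).
Proof.
rewrite Rintegral_mkcond; apply: eq_Rintegral => u _.
rewrite patchE winE indicE; case: (u \in _); rewrite ?mul1r ?mul0r //.
Qed.

Lemma integrable_sqr_decay (g : R -> R) : measurable_fun setT g ->
  integrableT (fun u => g u ^+ 2) -> integrableT (fun u => `|g u| * (1 + u ^+ 2)^-1).
Proof.
move=> mg ig.
apply: (integrable_le _ _ (integrable_fD measurableT ig (@integrable_oneDsqrV R))) => //.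
  by meas.
move=> u _ /=.
have D : 1 <= 1 + u ^+ 2 by rewrite lerDl sqr_ge0.
have D0 : 0 < 1 + u ^+ 2 by apply: lt_le_trans D.
have V0 : 0 <= (1 + u ^+ 2)^-1 by rewrite invr_ge0 ltW.
have V1 : (1 + u ^+ 2)^-1 <= 1 by rewrite invf_le1.
rewrite ger0_norm; last by rewrite mulr_ge0.
rewrite -(real_normK (num_real (g u))).
move: V0 V1 (normr_ge0 (g u)); set b := _^-1; set a := `|_|; nra.
Qed.

Lemma integrable_win (g : R -> R) k : measurable_fun setT g ->
  integrableT (fun u => g u ^+ 2) -> integrableT (fun u => win k u * `|g u|).
Proof.
move=> mg ig.
apply: (integrable_le _ _ (integrable_fZl measurableT (1 + k ^+ 2) (integrable_sqr_decay mg ig))) => //.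
  by have := @measurable_win k => ?; meas.
move=> u _ /=.
have D0 : 0 < 1 + u ^+ 2 by rewrite ltr_pwDl// sqr_ge0.
rewrite normrM normr_id (ger0_norm (win_ge0 _ _)) mulrCA mulrC ler_wpM2l//.
rewrite ler_pdivlMr// /win; case: (boolP (`|u| <= k)%R) => [h|_] /=.
  rewrite mul1r lerD2l -(real_normK (num_real u)) -(real_normK (num_real k)).
  by rewrite ler_sqr ?nnegrE//; apply: le_trans h (ler_norm _).
by rewrite mul0r addr_ge0// sqr_ge0.
Qed.

Let a k u := win k u * `|g1 u| + win k u * `|g2 u|.
Let ia k : integrableT (a k).
Proof. by apply: integrable_fD => //; exact: integrable_win. Qed.

Lemma measurable_wtrunc k : measurable_fun setT (wtrunc g1 g2 k).
Proof.
rewrite (_ : wtrunc _ _ _ = fun t => \int[mu]_u (win k u * (g1 u * cos (t * u) - g2 u * sin (t * u)))); last first.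
  by apply/funext => t; rewrite /wtrunc Rintegral_win.
apply: (measurable_Rintegral_bounded _ (ia k)).
  have m1 : measurable_fun setT (fun z : R * R => win k z.2).
    by apply: (measurableT_comp (@measurable_win k)); meas.
  have m2 : measurable_fun setT (fun z : R * R => g1 z.2).
    by apply: (measurableT_comp mg1); meas.
  have m3 : measurable_fun setT (fun z : R * R => g2 z.2).
    by apply: (measurableT_comp mg2); meas.
  by meas.
move=> t u; rewrite normrM ger0_norm ?win_ge0// /a -mulrDr ler_wpM2l ?win_ge0//.
apply: le_trans (ler_normB _ _) _; rewrite !normrM lerD// ler_piMr//.
  exact: cos_max.
exact: sin_max.
Qed.

Lemma integrable_wtrunc k t :
  mu.-integrable `[- k, k] (EFin \o (fun u => g1 u * cos (t * u) - g2 u * sin (t * u))).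
Proof.
have mD : measurable (`[- k, k]%classic : set (measurableTypeR R)) by exact: measurable_itv.
have i : mu.-integrable `[- k, k] (EFin \o a k) by apply: integrableS (ia k).
apply: (integrable_le _ _ i) => //; first by apply: measurable_funTS; meas.
move=> u; rewrite /= in_itv/= -ler_norml /a /win => ->; rewrite !mul1r.
apply: le_trans (ler_normB _ _) _; rewrite !normrM lerD// ler_piMr//.
  exact: cos_max.
exact: sin_max.
Qed.

End fourier_truncated.

Section poisson_trunc.
Variables (g1 g2 : R -> R).
Hypotheses (mg1 : measurable_fun setT g1) (mg2 : measurable_fun setT g2).
Hypotheses (ig1 : integrableT (fun u => g1 u ^+ 2)) (ig2 : integrableT (fun u => g2 u ^+ 2)).
Variables (eps y k : R).
Hypothesis eps0 : 0 < eps.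

Let K (u t : R) := win k u * (abel eps t * (g1 u * cos ((u - y) * t) - g2 u * sin ((u - y) * t))).
Let a u := win k u * `|g1 u| + win k u * `|g2 u|.
Let ia : integrableT a.
Proof. by apply: integrable_fD => //; exact: integrable_win. Qed.

Let mK : measurable_fun setT (fun z : R * R => K z.1 z.2).
Proof.
have m1 : measurable_fun setT (fun z : R * R => win k z.1).
  by apply: (measurableT_comp (@measurable_win k)); meas.
have m2 : measurable_fun setT (fun z : R * R => g1 z.1).
  by apply: (measurableT_comp mg1); meas.
have m3 : measurable_fun setT (fun z : R * R => g2 z.1).
  by apply: (measurableT_comp mg2); meas.
have m4 : measurable_fun setT (fun z : R * R => abel eps z.2).
  by apply: measurable_fun_abel; meas.
by rewrite /K; meas.
Qed.

Let Kab u t : `|K u t| <= a u * abel eps t.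
Proof.
rewrite /K /a !normrM (ger0_norm (win_ge0 _ _)) (ger0_norm (abel_ge0 _ _)).
rewrite -mulrDr mulrAC mulrA ler_wpM2l//.
  by rewrite mulr_ge0 ?win_ge0 ?abel_ge0.
apply: le_trans (ler_normB _ _) _; rewrite !normrM lerD// ler_piMr//.
  exact: cos_max.
exact: sin_max.
Qed.

(** Fubini, and the addition formulas: the part of the integrand that involves [g2]
    is odd in [t]. *)
Lemma poisson_trunc :
  \int[mu]_t ((wtrunc g1 g2 k t * cos (t * y) + wtrunc g2 (fun u => - g1 u) k t * sin (t * y)) * abel eps t) =
  \int[mu]_u (win k u * (g1 u * poisson eps (u - y))).
Proof.
transitivity (\int[mu]_u \int[mu]_t K u t); last first.
  apply: eq_Rintegral => u _.
  have [i1 h1] := @abel_cos eps (u - y) eps0.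
  have [i2 h2] := @abel_sin eps (u - y) eps0.
  transitivity (\int[mu]_t (win k u * (g1 u * (abel eps t * cos ((u - y) * t)) - g2 u * (abel eps t * sin ((u - y) * t))))).
    by apply: eq_Rintegral => t _; rewrite /K; ring.
  rewrite RintegralZl//; last by apply: integrable_fB => //; exact: integrable_fZl.
  rewrite RintegralB//; [|exact: integrable_fZl|exact: integrable_fZl].
  by rewrite !RintegralZl// h1 h2 mulr0 subr0.
rewrite (lebesgue_fubini mK ia (integrable_abel eps0) Kab).
apply: eq_Rintegral => t _; rewrite /wtrunc !Rintegral_win.
have mw := @measurable_win k.
have j1 (h : R -> R) : measurable_fun setT h -> (forall u, `|h u| <= a u) -> integrableT h.
  by move=> mh ha; apply: (integrable_le _ _ ia).
have j (f g : R -> R) : measurable_fun setT f -> measurable_fun setT g ->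
  (forall u, `|f u| + `|g u| = `|g1 u| + `|g2 u|) ->
  integrableT (fun u => win k u * (f u * cos (t * u) - g u * sin (t * u))).
  move=> mf mg fg; apply: j1; first by meas.
  move=> u; rewrite normrM ger0_norm ?win_ge0// /a -mulrDr ler_wpM2l ?win_ge0//.
  rewrite -fg; apply: le_trans (ler_normB _ _) _; rewrite !normrM lerD// ler_piMr//.
    exact: cos_max.
  exact: sin_max.
have k1 := j g1 g2 mg1 mg2 (fun=> erefl).
have k2 : integrableT (fun u => win k u * (g2 u * cos (t * u) - (- g1 u) * sin (t * u))).
  by apply: j => //; [meas|move=> u; rewrite normrN addrC].
rewrite mulrDl mulrAC [X in _ + X]mulrAC -mulrA -[X in _ + X]mulrA.
rewrite ![(\int[mu]_x _) * _]mulrC -!RintegralZl//.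
rewrite -RintegralD//; [|exact: integrable_fZl|exact: integrable_fZl].
apply: eq_Rintegral => u _; rewrite /K mulrBl cosB sinB !(mulrC _ t); ring.
Qed.

End poisson_trunc.
End poisson.

(** * The Abel-Poisson identity *)

Section segments.
Context {R : realType}.
Notation mu := (@lebesgue_measure R).

(** At a Lebesgue point [x] the averages of [|h - h x|] over small balls tend to
    [0], yet each of them is at least [|h x|], since [h] has average [0]. *)
Lemma segments_ae0 (h : R -> R) : measurable_fun setT h ->
  (forall a b, mu.-integrable `[a, b] (EFin \o h)) ->
  (forall a b, a <= b -> \int[mu]_(y in `[a, b]) h y = 0) ->
  {ae mu, forall x, h x = 0}.
Proof.
move=> mh ih h0.
have lh : locally_integrable setT h.
  split => //; first exact: openT.
  move=> K _ cK.
  have [M [Mr MK]] := compact_bounded cK.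
  pose N := `|M| + 1.
  have KN : K `<=` `[- N, N]%classic.
    move=> t Kt; rewrite /= in_itv/= -ler_norml.
    by apply: (MK N) => //; rewrite /N ltr_pwDr// ler_norm.
  apply: le_lt_trans (integrableP _ _ _ (ih (- N) N)).2.
  apply: ge0_subset_integral => //=.
    exact: compact_measurable.
  by apply/measurable_EFinP; apply: measurable_fun_norm; exact: measurable_funTS.
apply: (@filterS _ _ (ae_filter_ringOfSetsType mu) _ _ _ (lebesgue_differentiation lh)) => x hx.
apply/eqP; apply: contraT => hx0.
have p : (0 < `|h x|%:E)%E by rewrite lte_fin normr_gt0.
have : \forall r \near 0^'+, (davg h x r < `|h x|%:E)%E.
  exact: (hx [set z | (z < `|h x|%:E)%E] (open_ereal_lt' p)).
move=> near_lt.
have [r [r0 rlt]] : exists r : R, 0 < r /\ (davg h x r < `|h x|%:E)%E.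
  near (0 : R)^'+ => r; exists r; split; first by near: r; exact: nbhs_right_gt.
  by near: r.
move: rlt; rewrite ltNge => /negP; case.
have ballE : ball x r = `]x - r, x + r[%classic by rewrite ball_itv.
rewrite /davg /iavg ballE lebesgue_measure_itv/= lte_fin ltrBlDr -addrA ltrDl addr_gt0//.
rewrite -EFinB (_ : x + r - (x - r) = 2 * r); last by ring.
have r2 : 0 < 2 * r by rewrite mulr_gt0.
have ic0 : mu.-integrable `[x - r, x + r] (EFin \o (fun=> h x)).
  by apply: integrable_segment; exact: cst_continuous.
have ihr := ih (x - r) (x + r).
have ic : mu.-integrable `[x - r, x + r] (EFin \o (fun y => h y - h x)).
  apply: (integrable_fB _ (ih _ _) ic0) => //.
have io : mu.-integrable `]x - r, x + r[ (EFin \o (fun y => h y - h x)).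
  by apply: integrableS ic => //; exact: subset_itv_oo_cc.
have J : \int[mu]_(y in `]x - r, x + r[) (h y - h x) = - (h x * (2 * r)).
  rewrite Rintegral_itv_obnd_cbnd; last by apply: eq_integrable io.
  rewrite Rintegral_itv_bndo_bndc; last first.
    by apply: integrableS ic => //; exact: subset_itv_co_cc.
  have xr : x - r <= x + r by rewrite lerBlDr -addrA lerDl addr_ge0// ltW.
  rewrite RintegralB//.
  by rewrite h0// Rintegral_segment_cst// sub0r; congr (- (_ * _)); ring.
have le1 : (`| h x |%:E * (2 * r)%R%:E <= \int[mu]_(y in `](x - r)%R, (x + r)%R[) `|(h y - h x)%R%:E|)%E.
  have -> : (`| h x |%:E * (2 * r)%R%:E = `| \int[mu]_(y in `](x - r)%R, (x + r)%R[) (h y - h x)%R%:E |)%E.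
    rewrite -(fineK (integrable_fin_num _ io))//.
    have -> : fine (\int[mu]_(y in `](x - r)%R, (x + r)%R[) (h y - h x)%R%:E)%E = - (h x * (2 * r)) by rewrite -J.
    by rewrite -EFinM/= normrN normrM (gtr0_norm r2).
  by apply: le_abse_integral => //; have := measurable_int _ io.
rewrite inver (gt_eqF r2).
rewrite muleC lee_pdivlMr//.
Unshelve. all: by end_near.
Qed.

End segments.

Section abel_poisson.
Context {R : realType}.
Notation mu := (@lebesgue_measure R).
Notation integrableT f := (mu.-integrable setT (EFin \o f)).

Lemma poisson_ge0 (eps v : R) : 0 < eps -> 0 <= poisson eps v.
Proof.
move=> e0; rewrite /poisson mulr_ge0// divr_ge0 ?ltW//.
by rewrite ltr_pwDl ?exprn_gt0// sqr_ge0.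
Qed.

(** From [1 + u ^ 2 <= (1 + 2 m ^ 2) + 2 (u - y) ^ 2] for [|y| <= m]. *)
Lemma poisson_le (eps m y u : R) : 0 < eps -> `|y| <= m ->
  poisson eps (u - y) <= 2 * ((1 + 2 * m ^+ 2) / eps + 2 * eps) * (1 + u ^+ 2)^-1.
Proof.
move=> e0 ym.
have D0 : 0 < 1 + u ^+ 2 by rewrite ltr_pwDl// sqr_ge0.
have E0 : 0 < eps ^+ 2 + (u - y) ^+ 2 by rewrite ltr_pwDl ?exprn_gt0// sqr_ge0.
rewrite /poisson -mulrA ler_pM2l//.
rewrite ler_pdivrMr// mulrAC ler_pdivlMr//.
have y2 : y ^+ 2 <= m ^+ 2.
  by rewrite -(real_normK (num_real y)) ler_sqr ?nnegrE// (le_trans (normr_ge0 y)).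
have h : 1 + u ^+ 2 <= (1 + 2 * m ^+ 2) + 2 * (u - y) ^+ 2.
  have := sqr_ge0 (u - 2 * y); nra.
have -> : ((1 + 2 * m ^+ 2) / eps + 2 * eps) * (eps ^+ 2 + (u - y) ^+ 2) =
  eps * ((1 + 2 * m ^+ 2) + 2 * (u - y) ^+ 2) + ((1 + 2 * m ^+ 2) / eps * (u - y) ^+ 2 + 2 * eps * eps ^+ 2).
  by field; rewrite gt_eqF.
apply: le_trans (_ : eps * ((1 + 2 * m ^+ 2) + 2 * (u - y) ^+ 2) <= _).
  by rewrite ler_pM2l.
have m0 : 0 <= 1 + 2 * m ^+ 2 by rewrite addr_ge0// mulr_ge0// sqr_ge0.
have e1 := ltW e0.
rewrite lerDl addr_ge0//.
  by apply: mulr_ge0; [exact: divr_ge0|exact: sqr_ge0].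
by apply: mulr_ge0; [exact: mulr_ge0|exact: sqr_ge0].
Qed.

Section pairing.
Variables (h : R -> R) (p q : nat -> R -> R).
Hypotheses (ih : integrableT h) (h01 : forall t, 0 <= h t <= 1).
Hypotheses (mp : forall n, measurable_fun setT (p n)) (mq : forall n, measurable_fun setT (q n)).
Hypotheses (ipq : forall n, integrableT (fun t => p n t ^+ 2 + q n t ^+ 2)).
Hypothesis pq0 : \int[mu]_t (p n t ^+ 2 + q n t ^+ 2) @[n --> \oo] --> (0 : R).

(** A weak form of the Cauchy-Schwarz inequality: [|p| h <= l h + p ^ 2 / l] for
    [0 <= h <= 1], with [l] slightly larger than the L2 norm, so that [l] tends to [0] and never
    vanishes. *)
Lemma pairing_cvg0 (c s : R -> R) : measurable_fun setT c -> measurable_fun setT s ->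
  (forall t, `|c t| <= 1) -> (forall t, `|s t| <= 1) ->
  (forall n, integrableT (fun t => (p n t * c t + q n t * s t) * h t)) /\
  (\int[mu]_t ((p n t * c t + q n t * s t) * h t) @[n --> \oo] --> (0 : R)).
Proof.
move=> mc ms c1 s1.
have mh : measurable_fun setT h by apply/measurable_EFinP; exact: measurable_int ih.
pose I n := \int[mu]_t (p n t ^+ 2 + q n t ^+ 2).
have I0 n : 0 <= I n by apply: Rintegral_ge0 => t _; rewrite addr_ge0 ?sqr_ge0.
pose l n : R := Num.sqrt (I n) + n.+1%:R^-1.
have l0 n : 0 < l n by rewrite ltr_wpDl ?sqrtr_ge0 ?invr_gt0.
have bound n t : `|(p n t * c t + q n t * s t) * h t| <=
    l n * h t + (l n)^-1 * (p n t ^+ 2 + q n t ^+ 2).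
  have /andP[a0 a1] := h01 t.
  have b1 : `|p n t * c t + q n t * s t| <= `|p n t| + `|q n t|.
    by apply: le_trans (ler_normD _ _) _; rewrite !normrM lerD// ler_piMr.
  rewrite normrM (ger0_norm a0); apply: le_trans (ler_wpM2r a0 b1) _.
  rewrite -(real_normK (num_real (p n t))) -(real_normK (num_real (q n t))).
  have ll : l n * (l n)^-1 = 1 by rewrite mulfV// gt_eqF.
  have L0 := l0 n; have V0 : 0 < (l n)^-1 by rewrite invr_gt0.
  have am (a : R) : 0 <= a -> a * h t <= l n * h t / 2 + (l n)^-1 * a ^+ 2 / 2.
    move=> a0'.
    have e : l n * h t ^+ 2 / 2 + (l n)^-1 * a ^+ 2 / 2 - a * h t = (l n)^-1 * (a - l n * h t) ^+ 2 / 2.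
      by field; rewrite gt_eqF.
    have g : 0 <= (l n)^-1 * (a - l n * h t) ^+ 2 / 2 by rewrite divr_ge0// mulr_ge0 ?sqr_ge0// ltW.
    have hh : h t ^+ 2 <= h t by rewrite expr2 ler_piMl.
    have := ler_wpM2l (ltW L0) hh; lra.
  have sq (a : R) : 0 <= (l n)^-1 * a ^+ 2 by rewrite mulr_ge0 ?sqr_ge0// ltW.
  have := am _ (normr_ge0 (p n t)); have := am _ (normr_ge0 (q n t)).
  have := sq `|p n t|; have := sq `|q n t|; lra.
have ib n : integrableT (fun t => l n * h t + (l n)^-1 * (p n t ^+ 2 + q n t ^+ 2)).
  by apply: integrable_fD => //; exact: integrable_fZl.
have ii n : integrableT (fun t => (p n t * c t + q n t * s t) * h t).
  by apply: (integrable_le _ _ (ib n)) => //; have := mp n; have := mq n => ? ?; meas.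
split => //.
apply: norm_cvg0.
pose H := \int[mu]_t h t.
apply: (@squeeze_cvgr _ _ _ _ (fun=> 0) (fun n => l n * (H + 1))).
- apply: nearW => n; rewrite normr_ge0/=.
  apply: le_trans (le_normr_Rintegral _ (ii n)) _ => //.
  apply: le_trans (_ : \int[mu]_t (l n * h t + (l n)^-1 * (p n t ^+ 2 + q n t ^+ 2)) <= _).
    by apply: le_Rintegral => //; exact: integrable_norm (ii n).
  rewrite RintegralD//; [|exact: integrable_fZl|exact: integrable_fZl].
  rewrite !RintegralZl// mulrDr mulr1 lerD2l -/(I n) mulrC ler_pdivrMr//.
  rewrite -{1}(sqr_sqrtr (I0 n)) -expr2 ler_sqr ?nnegrE ?sqrtr_ge0 ?ltW//.
  by rewrite ltrDl invr_gt0.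
- exact: cvg_cst.
- rewrite -[X in _ --> X](mul0r (H + 1)); apply: cvgM; last exact: cvg_cst.
  rewrite -[X in _ --> X](addr0 0); apply: cvgD; last exact: cvg_harmonic.
  rewrite -(@sqrtr0 R); apply: cvg_comp pq0 _; exact: sqrt_continuous.
Qed.

End pairing.

Section limit.
Variables (P Q g1 g2 : R -> R) (k : nat -> R).
Hypotheses (hP : h1 P) (hQ : h1 Q).
Hypotheses (mg1 : measurable_fun setT g1) (mg2 : measurable_fun setT g2).
Hypotheses (ig1 : integrableT (fun u => g1 u ^+ 2)) (ig2 : integrableT (fun u => g2 u ^+ 2)).
Hypothesis k_cvg : k n @[n --> \oo] --> +oo.
Let p n t := wtrunc g1 g2 (k n) t - P t.
Let q n t := wtrunc g2 (fun u => - g1 u) (k n) t - Q t.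
Hypotheses (ipq : forall n, integrableT (fun t => p n t ^+ 2 + q n t ^+ 2)).
Hypothesis pq0 : \int[mu]_t (p n t ^+ 2 + q n t ^+ 2) @[n --> \oo] --> (0 : R).

(** Let the window of [poisson_trunc] grow: the left-hand side converges by the L2
    convergence of the truncated transforms, the right-hand side by
    dominated convergence. *)
Lemma abel_poisson (eps y : R) : 0 < eps ->
  \int[mu]_t ((P t * cos (t * y) + Q t * sin (t * y)) * abel eps t) =
  \int[mu]_u (g1 u * poisson eps (u - y)).
Proof.
move=> e0.
have mN1 : measurable_fun setT (fun u => - g1 u) by meas.
have iN1 : integrableT (fun u => (- g1 u) ^+ 2).
  by apply: eq_integrable ig1 => // u _; rewrite /= sqrrN.
have mP := hP.1; have mQ := hQ.1.
have mp n : measurable_fun setT (p n).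
  by have := measurable_wtrunc mg1 mg2 ig1 ig2 (k n) => ?; rewrite /p; meas.
have mq n : measurable_fun setT (q n).
  by have := measurable_wtrunc mg2 mN1 ig2 iN1 (k n) => ?; rewrite /q; meas.
have a01 t : 0 <= abel eps t <= 1 by rewrite abel_ge0 abel_le1.
have mc : measurable_fun setT (fun t : R => cos (t * y)) by meas.
have ms : measurable_fun setT (fun t : R => sin (t * y)) by meas.
have [ii lim1] := pairing_cvg0 (integrable_abel e0) a01 mp mq ipq pq0 mc ms
  (fun t => cos_max _) (fun t => sin_max _).
set L := \int[mu]_t _.
have iL : integrableT (fun t => (P t * cos (t * y) + Q t * sin (t * y)) * abel eps t).
  apply: (integrable_le _ _ (integrable_norm (integrable_phi hP hQ y))) => //.
    by have := @measurable_fun_abel R _ _ setT eps _ (@measurable_id _ _ setT) => ?; meas.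
  by move=> t _; rewrite normrM ler_piMr// ger0_norm ?abel_ge0// abel_le1.
have lim2 : \int[mu]_t ((wtrunc g1 g2 (k n) t * cos (t * y) +
     wtrunc g2 (fun u => - g1 u) (k n) t * sin (t * y)) * abel eps t) @[n --> \oo] --> L.
  rewrite -[X in _ --> X](add0r L).
  rewrite (_ : (fun n => _) = (fun n => \int[mu]_t ((p n t * cos (t * y) + q n t * sin (t * y)) * abel eps t) + L)).
    by apply: cvgD => //; exact: cvg_cst.
  apply/funext => n; rewrite /L -RintegralD//.
  by apply: eq_Rintegral => t _; rewrite /p /q; ring.
have lim3 : \int[mu]_t ((wtrunc g1 g2 (k n) t * cos (t * y) +
     wtrunc g2 (fun u => - g1 u) (k n) t * sin (t * y)) * abel eps t) @[n --> \oo] -->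
   \int[mu]_u (g1 u * poisson eps (u - y)).
  under eq_fun => n do rewrite poisson_trunc//.
  pose C := 2 * ((1 + 2 * `|y| ^+ 2) / eps + 2 * eps).
  have mpo : measurable_fun setT (fun u : R => poisson eps (u - y)).
    by apply: measurable_fun_poisson; meas.
  apply: (lebesgue_dominated_cvg _ _ _ (integrable_fZl measurableT C (integrable_sqr_decay mg1 ig1))).
  - by move=> n; have := @measurable_win R (k n) => ?; meas.
  - by meas.
  - apply: aeW => u; apply: cvg_near_cst.
    have : \forall n \near \oo, `|u| <= k n by move/cvgryPge: k_cvg; exact.
    by apply: filterS => n un; rewrite /win un mul1r.
  - move=> n u /=; rewrite normrM (ger0_norm (win_ge0 _ _)).
    apply: le_trans (ler_piMl _ (win_le1 _ _)) _ => //.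
    rewrite normrM (ger0_norm (poisson_ge0 _ e0)) [leRHS]mulrCA ler_wpM2l//.
    exact: poisson_le.
exact: cvg_unique lim2 lim3.
Qed.

End limit.
End abel_poisson.

(** * Fourier inversion *)

Section inversion.
Context {R : realType}.
Notation mu := (@lebesgue_measure R).
Notation integrableT f := (mu.-integrable setT (EFin \o f)).

Lemma norm_le_max (a b y : R) : a <= y <= b -> `|y| <= Num.max `|a| `|b|.
Proof.
move=> /andP[ay yb]; rewrite le_max; have [y0|y0] := leP 0 y.
  by rewrite (ger0_norm y0) (le_trans yb (ler_norm _)) orbT.
by rewrite (ltr0_norm y0) -(normrN a) (le_trans _ (ler_norm (- a)))// lerN2.
Qed.

Section window.
Variables (a b : R).

Definition box (u : R) : R := \1_(`[a, b]%classic : set R) u.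

Lemma box_ge0 u : 0 <= box u. Proof. exact: ler0n. Qed.

Lemma box_le1 u : box u <= 1. Proof. by rewrite /box indicE lern1 leq_b1. Qed.

Lemma boxE u : box u = (a <= u <= b)%R%:R.
Proof.
by rewrite /box indicE; congr (nat_of_bool _)%:R; apply/idP/idP; rewrite ?inE/= in_itv.
Qed.

Lemma measurable_box : measurable_fun setT box.
Proof. by apply: measurable_indic; exact: measurable_itv. Qed.

Lemma Rintegral_box (f : R -> R) : \int[mu]_(u in `[a, b]) f u = \int[mu]_u (box u * f u).
Proof.
rewrite Rintegral_mkcond; apply: eq_Rintegral => u _.
by rewrite patchE /box indicE; case: (u \in _); rewrite ?mul1r ?mul0r.
Qed.

Lemma integrable_box : integrableT box.
Proof.
apply: (integrable_le _ _ (integrable_fZl measurableT (1 + Num.max `|a| `|b| ^+ 2) (@integrable_oneDsqrV R))) => //.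
  exact: measurable_box.
move=> u _ /=; have D0 : 0 < 1 + u ^+ 2 by rewrite ltr_pwDl// sqr_ge0.
rewrite ger0_norm ?box_ge0// ler_pdivlMr// boxE; case: (boolP (a <= u <= b)) => [/norm_le_max um|_] /=.
  by rewrite mul1r lerD2l -(real_normK (num_real u)) ler_sqr ?nnegrE// (le_trans _ um).
by rewrite mul0r addr_ge0// sqr_ge0.
Qed.

End window.

Section poisson_average.
Variables (a b eps : R).
Hypotheses (ab : a <= b) (e0 : 0 < eps).

(** The integral over the segment from [a] to [b] of the function [y] |-> [poisson eps (u - y)]; as [eps] tends to
    [0] it tends to [2 * pi] inside the segment and to [0] outside. *)
Definition poisson_avg (u : R) : R := 2 * (atan ((b - u) / eps) - atan ((a - u) / eps)).

Let den (v : R) : 0 < eps ^+ 2 + v ^+ 2.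
Proof. by rewrite ltr_pwDl ?exprn_gt0// sqr_ge0. Qed.

Let dpoisson (u y : R) :
  is_derive y (1 : R) (fun y => 2 * atan ((y - u) / eps)) (poisson eps (u - y)).
Proof.
apply: is_derive_eq; rewrite /GRing.scale/= /poisson.
have h := den (u - y); have h' : 1 + ((y - u) / eps) ^+ 2 != 0.
  by rewrite gt_eqF// ltr_pwDl// sqr_ge0.
have -> : 1 + ((y - u) / eps) ^+ 2 = (eps ^+ 2 + (u - y) ^+ 2) / eps ^+ 2.
  by field; rewrite gt_eqF.
by field; rewrite !gt_eqF.
Qed.

Let cpoisson (u : R) : continuous (fun y => poisson eps (u - y)).
Proof.
move=> y; rewrite /poisson; apply: cvgM; first exact: cvg_cst.
apply: cvgM; first exact: cvg_cst.
apply: cvgV; first by rewrite gt_eqF.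
apply: cvgD; first exact: cvg_cst.
have h : u - z @[z --> y] --> u - y by apply: cvgB; [exact: cvg_cst|exact: cvg_id].
by rewrite expr2; under eq_fun do rewrite expr2; exact: cvgM.
Qed.

Lemma Rintegral_poisson (u : R) : \int[mu]_(y in `[a, b]) poisson eps (u - y) = poisson_avg u.
Proof.
rewrite (Rintegral_segment_is_derive ab (dpoisson u) (@cpoisson u)).
by rewrite /poisson_avg mulrBr.
Qed.

Lemma poisson_avg_ge0 u : 0 <= poisson_avg u.
Proof.
rewrite -Rintegral_poisson; apply: Rintegral_ge0 => y _; exact: poisson_ge0.
Qed.

(** Uniform in [eps <= 1], as dominated convergence requires: multiply the
    integral by [1 + u ^ 2] and expand around [y]. *)
Lemma poisson_avg_le (u : R) : eps <= 1 ->
  poisson_avg u <= ((1 + 2 * Num.max `|a| `|b| ^+ 2) * (2 * pi) + 4 * (b - a)) * (1 + u ^+ 2)^-1.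
Proof.
move=> e1; set m := Num.max _ _.
have D0 : 0 < 1 + u ^+ 2 by rewrite ltr_pwDl// sqr_ge0.
have m0 : 0 <= m by rewrite le_max normr_ge0.
rewrite ler_pdivlMr// mulrC.
have step (y : R) : (`[a, b]%classic : set R) y ->
   (1 + u ^+ 2) * poisson eps (u - y) <= (1 + 2 * m ^+ 2) * poisson eps (u - y) + 4.
  rewrite /= in_itv/= => /norm_le_max ym.
  have y2 : y ^+ 2 <= m ^+ 2.
    by rewrite -(real_normK (num_real y)) ler_sqr ?nnegrE.
  have h : 1 + u ^+ 2 <= (1 + 2 * m ^+ 2) + 2 * (u - y) ^+ 2.
    have := sqr_ge0 (u - 2 * y); nra.
  apply: le_trans (ler_wpM2r (poisson_ge0 _ e0) h) _.
  rewrite mulrDl lerD2l /poisson.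
  have -> : 2 * (u - y) ^+ 2 * (2 * (eps / (eps ^+ 2 + (u - y) ^+ 2))) =
    4 * (eps * (u - y) ^+ 2) / (eps ^+ 2 + (u - y) ^+ 2) by field; rewrite gt_eqF.
  rewrite ler_pdivrMr// ler_pM2l//.
  apply: le_trans (_ : (u - y) ^+ 2 <= _); last by rewrite lerDr sqr_ge0.
  by rewrite ler_piMl// sqr_ge0.
have cst_seg (c : R) : mu.-integrable `[a, b] (EFin \o (fun=> c)).
  by apply: integrable_segment; exact: cst_continuous.
have ip := integrable_segment a b (@cpoisson u).
have ic := cst_seg 4.
have i1 : mu.-integrable `[a, b] (EFin \o (fun y => (1 + u ^+ 2) * poisson eps (u - y))).
  by apply: integrable_fZl.
have i2 : mu.-integrable `[a, b] (EFin \o (fun y => (1 + 2 * m ^+ 2) * poisson eps (u - y))).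
  by apply: integrable_fZl.
have i3 : mu.-integrable `[a, b] (EFin \o (fun y => (1 + 2 * m ^+ 2) * poisson eps (u - y) + 4)).
  by apply: (integrable_fD _ i2 ic).
have : (1 + u ^+ 2) * poisson_avg u <= (1 + 2 * m ^+ 2) * poisson_avg u + 4 * (b - a).
  rewrite -Rintegral_poisson -(Rintegral_segment_cst 4 ab) -!RintegralZl// -RintegralD//.
  exact: le_Rintegral.
move=> H; apply: le_trans H _; rewrite lerD2r ler_wpM2l//.
  by rewrite addr_ge0// mulr_ge0// sqr_ge0.
rewrite /poisson_avg ler_pM2l//.
by have := atan_ltpi2 ((b - u) / eps); have := atan_gtNpi2 ((a - u) / eps); lra.
Qed.

Lemma measurable_poisson_avg : measurable_fun setT poisson_avg.
Proof.
have ma : measurable_fun setT (@atan R).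
  by apply: continuous_measurable_fun; exact: continuous_atan.
have m1 : measurable_fun setT (fun u : R => atan ((b - u) / eps)).
  by apply: (measurableT_comp ma); meas.
have m2 : measurable_fun setT (fun u : R => atan ((a - u) / eps)).
  by apply: (measurableT_comp ma); meas.
by rewrite /poisson_avg; meas.
Qed.

End poisson_average.

Lemma atan_scale_cvg (c : R) : c != 0 ->
  atan (c / n.+1%:R^-1) @[n --> \oo] --> (if 0 < c then pi / 2 else - (pi / 2) : R).
Proof.
have pos (d : R) : 0 < d -> atan (d / n.+1%:R^-1) @[n --> \oo] --> (pi / 2 : R).
  move=> d0; under eq_fun => n do rewrite invrK.
  apply: (cvg_comp _ _ _ (@cvgy_atan R)).
  apply/cvgryPge => A; exists (Num.truncn (`|A| / d)) => // n /= An.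
  rewrite mulrC -ler_pdivrMr//.
  apply: le_trans (_ : `|A| / d <= _).
    by rewrite ler_pM2r ?invr_gt0// ler_norm.
  apply: ltW; apply: lt_le_trans (truncnS_gt _) _.
  by rewrite ler_nat ltnS.
move=> c0; case: ifPn => [|]; first exact: pos.
rewrite -leNgt le_eqVlt (negbTE c0)/= => c1.
rewrite (_ : (fun n => _) = (fun n => - atan (- c / n.+1%:R^-1))); last first.
  by apply/funext => n; rewrite mulNr atanN opprK.
by apply: cvgN; apply: pos; rewrite oppr_gt0.
Qed.

Section segment.
Variables (P Q g : R -> R).
Hypotheses (hP : h1 P) (hQ : h1 Q).
Hypotheses (mg : measurable_fun setT g) (ig : integrableT (fun u => g u ^+ 2)).
Hypothesis abelE : forall eps y, 0 < eps ->
  \int[mu]_t ((P t * cos (t * y) + Q t * sin (t * y)) * abel eps t) =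
  \int[mu]_u (g u * poisson eps (u - y)).
Variables (a b : R).
Hypothesis ab : a <= b.

Let m := Num.max `|a| `|b|.

Let swap (eps : R) : 0 < eps ->
  \int[mu]_y (box a b y * \int[mu]_u (g u * poisson eps (u - y))) =
  \int[mu]_u (g u * poisson_avg a b eps u).
Proof.
move=> e0.
pose K y u := box a b y * (g u * poisson eps (u - y)).
pose C := 2 * ((1 + 2 * m ^+ 2) / eps + 2 * eps).
have mK : measurable_fun setT (fun z : R * R => K z.1 z.2).
  have m1 : measurable_fun setT (fun z : R * R => box a b z.1).
    by apply: (measurableT_comp (measurable_box a b)); meas.
  have m2 : measurable_fun setT (fun z : R * R => g z.2).
    by apply: (measurableT_comp mg); meas.
  have m3 : measurable_fun setT (fun z : R * R => poisson eps (z.2 - z.1)).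
    by apply: measurable_fun_poisson; meas.
  by rewrite /K; meas.
have iC := integrable_fZl measurableT C (integrable_sqr_decay mg ig).
have Kab y u : `|K y u| <= box a b y * (C * (`|g u| * (1 + u ^+ 2)^-1)).
  rewrite /K normrM (ger0_norm (box_ge0 _ _ _)) boxE.
  case: (boolP (a <= y <= b)) => [/norm_le_max ym|_] /=; last by rewrite !mul0r.
  rewrite !mul1r normrM (ger0_norm (poisson_ge0 _ e0)) [leRHS]mulrCA ler_wpM2l//.
  exact: poisson_le.
have iK y : integrableT (fun u => g u * poisson eps (u - y)).
  have iC' := integrable_fZl measurableT (2 * ((1 + 2 * `|y| ^+ 2) / eps + 2 * eps)) (integrable_sqr_decay mg ig).
  apply: (integrable_le _ _ iC') => //.
    by have := @measurable_fun_poisson R _ _ setT eps (fun u : R => u - y) => h; meas; apply: h; meas.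
  move=> u _ /=; rewrite normrM (ger0_norm (poisson_ge0 _ e0)) [leRHS]mulrCA ler_wpM2l//.
  exact: poisson_le.
transitivity (\int[mu]_y \int[mu]_u K y u).
  by apply: eq_Rintegral => y _; rewrite -RintegralZl.
rewrite (lebesgue_fubini mK (integrable_box a b) iC Kab).
apply: eq_Rintegral => u _.
rewrite -Rintegral_poisson// Rintegral_box -RintegralZl//.
  by apply: eq_Rintegral => y _; rewrite /K mulrCA.
have Ki : integrableT (fun y => C * box a b y) by apply: integrable_fZl => //; exact: integrable_box.
apply: (integrable_le _ _ Ki) => //.
  have m3 : measurable_fun setT (fun y : R => poisson eps (u - y)).
    by apply: measurable_fun_poisson; meas.
  by have := measurable_box a b => ?; meas.
move=> y _ /=; rewrite normrM (ger0_norm (box_ge0 _ _ _)) boxE (ger0_norm (poisson_ge0 _ e0)).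
case: (boolP (a <= y <= b)) => [/norm_le_max ym|_] /=; last by rewrite mul0r mulr0.
rewrite mul1r mulr1; apply: le_trans (poisson_le u e0 ym) _.
rewrite ler_piMr//; last by rewrite invf_le1 ?lerDl ?sqr_ge0// ltr_pwDl// sqr_ge0.
have := ltW e0 => e1.
by rewrite mulr_ge0// addr_ge0 ?divr_ge0 ?mulr_ge0// addr_ge0// mulr_ge0// sqr_ge0.
Qed.

Let eps n : R := n.+1%:R^-1.
Let eps0 n : 0 < eps n. Proof. by rewrite invr_gt0. Qed.
Let eps1 n : eps n <= 1. Proof. by rewrite invf_le1// ler1n. Qed.

Let right_lim : \int[mu]_u (g u * poisson_avg a b (eps n) u) @[n --> \oo] -->
  2 * pi * \int[mu]_(u in `[a, b]) g u.
Proof.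
rewrite Rintegral_box -RintegralZl//; last first.
  have i1 := integrable_fD measurableT ig (integrable_box a b).
  apply: (integrable_le _ _ i1) => //.
    by have := measurable_box a b => ?; meas.
  move=> u _ /=; rewrite normrM (ger0_norm (box_ge0 _ _ _)).
  have := box_ge0 a b u; have := box_le1 a b u.
  rewrite -(real_normK (num_real (g u))); have := normr_ge0 (g u).
  move: (box _ _ _) `|_| => c d; nra.
pose C := (1 + 2 * m ^+ 2) * (2 * pi) + 4 * (b - a).
have neq (c : R) : {ae mu, forall t : R, t != c}.
  exists [set c]; split => //; first exact: lebesgue_measure_set1.
  by move=> t /= /negP; rewrite negbK => /eqP.
have mb := measurable_box a b.
apply: (lebesgue_dominated_cvg _ _ _ (integrable_fZl measurableT C (integrable_sqr_decay mg ig))).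
- by move=> n; have := measurable_poisson_avg a b (eps n) => ?; meas.
- by meas.
- apply: (@filterS2 _ _ (ae_filter_ringOfSetsType mu) _ _ _ _ (neq a) (neq b)) => u ua ub.
  rewrite mulrCA -mulrA [X in _ --> X]mulrCA mulrCA.
  rewrite (_ : _ * _ = g u * (2 * ((if 0 < b - u then pi / 2 else - (pi / 2)) -
    (if 0 < a - u then pi / 2 else - (pi / 2))))); last first.
    rewrite boxE !subr_gt0; move: ua ub ab.
    by have [] := ltgtP u a; have [] := ltgtP u b => //=; lra.
  apply: cvgM; first exact: cvg_cst.
  apply: cvgM; first exact: cvg_cst.
  by apply: cvgB; apply: atan_scale_cvg; rewrite subr_eq0 eq_sym.
- move=> n u /=; rewrite normrM (ger0_norm (poisson_avg_ge0 ab (eps0 n) u)) [leRHS]mulrCA ler_wpM2l//.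
  exact: poisson_avg_le.
Qed.

Let iPQ : integrableT (fun t => `|P t| + `|Q t|).
Proof. by apply: integrable_fD => //; exact: h1_integrable_norm. Qed.

Let PQ_le y t : `|P t * cos (t * y) + Q t * sin (t * y)| <= `|P t| + `|Q t|.
Proof.
apply: le_trans (ler_normD _ _) _; rewrite !normrM lerD// ler_piMr//.
  exact: cos_max.
exact: sin_max.
Qed.

Let abel_cvg1 t : abel (eps n) t @[n --> \oo] --> (1 : R).
Proof.
have h : - (eps n * `|t|) @[n --> \oo] --> - (0 * `|t|).
  by apply: cvgN; apply: cvgM; [exact: cvg_harmonic|exact: cvg_cst].
rewrite mul0r oppr0 in h.
rewrite /abel -[X in _ --> X]expR0.
exact: (cvg_comp _ _ h (@continuous_expR R 0)).
Qed.

Let left_lim : \int[mu]_y (box a b y *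
    \int[mu]_t ((P t * cos (t * y) + Q t * sin (t * y)) * abel (eps n) t)) @[n --> \oo] -->
  \int[mu]_(y in `[a, b]) phi P Q y.
Proof.
rewrite Rintegral_box.
have mP := hP.1; have mQ := hQ.1.
have mb := measurable_box a b.
have mphi := measurable_phi hP hQ.
have mabel n : measurable_fun setT (abel (eps n)) by apply: measurable_fun_abel.
pose C := \int[mu]_t (`|P t| + `|Q t|).
have le_abel n y t : `|(P t * cos (t * y) + Q t * sin (t * y)) * abel (eps n) t| <= `|P t| + `|Q t|.
  rewrite normrM (ger0_norm (abel_ge0 _ _)); apply: le_trans (ler_piMr _ (abel_le1 (eps0 n) t)) _ => //.
have i0 n y : integrableT (fun t => (P t * cos (t * y) + Q t * sin (t * y)) * abel (eps n) t).
  by apply: (integrable_le _ _ iPQ) => //; have := mabel n => ?; meas.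
apply: (lebesgue_dominated_cvg _ _ _ (integrable_fZl measurableT C (integrable_box a b))).
- move=> n; apply: measurable_funM => //.
  apply: (@measurable_Rintegral_bounded R (fun y t => (P t * cos (t * y) + Q t * sin (t * y)) * abel (eps n) t) _ _ iPQ) => //.
  have m1 : measurable_fun setT (fun z : R * R => P z.2).
    by apply: (measurableT_comp mP); meas.
  have m2 : measurable_fun setT (fun z : R * R => Q z.2).
    by apply: (measurableT_comp mQ); meas.
  have m3 : measurable_fun setT (fun z : R * R => abel (eps n) z.2).
    by apply: measurable_fun_abel; meas.
  by meas.
- by meas.
- apply: aeW => y; apply: cvgM; first exact: cvg_cst.
  apply: (lebesgue_dominated_cvg _ _ _ iPQ) => //.
  + by move=> n; have := mabel n => ?; meas.
  + by meas.
  + apply: aeW => t; rewrite -[X in _ --> X]mulr1; apply: cvgM; first exact: cvg_cst.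
    exact: abel_cvg1.
- move=> n y /=; rewrite normrM (ger0_norm (box_ge0 _ _ _)) [leRHS]mulrC ler_wpM2l ?box_ge0//.
  apply: le_trans (le_normr_Rintegral _ (i0 n y)) _ => //.
  by apply: le_Rintegral => //; exact: integrable_norm (i0 n y).
Qed.

(** Integrate the Abel-Poisson identity over the segment and let [eps] tend to [0]
    on both sides. Averaging over a segment replaces a pointwise limit of
    Poisson integrals, which would only exist almost everywhere. *)
Lemma Rintegral_phi_segment :
  \int[mu]_(y in `[a, b]) phi P Q y = 2 * pi * \int[mu]_(u in `[a, b]) g u.
Proof.
apply: cvg_unique left_lim _ => //.
rewrite (_ : (fun n => _) = (fun n => \int[mu]_u (g u * poisson_avg a b (eps n) u))); first exact: right_lim.
apply/funext => n; rewrite -(swap (eps0 n)).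
by apply: eq_Rintegral => y _; rewrite abelE.
Qed.

End segment.

Section fourier_inversion.
Variables (P Q g1 g2 : R -> R) (k : nat -> R).
Hypotheses (hP : h1 P) (hQ : h1 Q).
Hypotheses (mg1 : measurable_fun setT g1) (mg2 : measurable_fun setT g2).
Hypotheses (ig1 : integrableT (fun u => g1 u ^+ 2)) (ig2 : integrableT (fun u => g2 u ^+ 2)).
Hypothesis k_cvg : k n @[n --> \oo] --> +oo.
Let p n t := wtrunc g1 g2 (k n) t - P t.
Let q n t := wtrunc g2 (fun u => - g1 u) (k n) t - Q t.
Hypotheses (ipq : forall n, integrableT (fun t => p n t ^+ 2 + q n t ^+ 2)).
Hypothesis pq0 : \int[mu]_t (p n t ^+ 2 + q n t ^+ 2) @[n --> \oo] --> (0 : R).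

(** Both sides have the same integral over every segment. *)
Lemma fourier_inversion : {ae mu, forall y, g1 y = phi P Q y / (2 * pi)}.
Proof.
have pi2 : 2 * pi != 0 :> R by rewrite mulf_neq0// gt_eqF// pi_gt0.
have mphi := measurable_phi hP hQ.
have ig a b : mu.-integrable `[a, b] (EFin \o g1).
  have i1 : mu.-integrable `[a, b] (EFin \o (fun u => g1 u ^+ 2)) by apply: integrableS ig1.
  have i2 : mu.-integrable `[a, b] (EFin \o (fun=> 1 : R)).
    by apply: integrable_segment; exact: cst_continuous.
  have mg1' : measurable_fun (`[a, b]%classic : set R) g1 by exact: measurable_funTS.
  apply: (integrable_le _ _ (integrable_fD _ i1 i2)) => //.
  move=> u _ /=; rewrite -(real_normK (num_real (g1 u))); have := normr_ge0 (g1 u).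
  move: `|_| => d; nra.
have iphi a b : mu.-integrable `[a, b] (EFin \o (fun y => phi P Q y / (2 * pi))).
  apply: integrable_segment => y; apply: cvgM; last exact: cvg_cst.
  exact: continuous_phi.
have : {ae mu, forall y, g1 y - phi P Q y / (2 * pi) = 0}.
  apply: segments_ae0.
  - by meas.
  - by move=> a b; apply: (integrable_fB _ (ig a b) (iphi a b)).
  - move=> a b ab.
    have J := Rintegral_phi_segment hP hQ mg1 ig1
      (fun eps y => abel_poisson hP hQ mg1 mg2 ig1 ig2 k_cvg ipq pq0 y) ab.
    have i1 := ig a b; have i2 := iphi a b.
    rewrite RintegralB// RintegralZr; last 2 first.
    + by [].
    + by apply: integrable_segment; exact: continuous_phi.
    by rewrite J mulrAC mulfV// mul1r subrr.
by apply: (@filterS _ _ (ae_filter_ringOfSetsType mu)) => y /eqP; rewrite subr_eq0 => /eqP.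
Qed.

End fourier_inversion.
End inversion.

(** * From the line back to the half-line *)

Section logarithmic_coordinates.
Context {R : realType}.
Notation mu := (@lebesgue_measure R).
Notation integrableT f := (mu.-integrable setT (EFin \o f)).

(** The factor [exp (u / 2)] makes this an isometry from L2 of the half-line to L2
    of the line, and turns the Mellin transform on [Re s = 1/2] into the
    Fourier transform. *)
Definition explog (f : R -> R) (u : R) : R := expR (u / 2) * f (expR u).

Let mRpos : measurable (Rpos : set (measurableTypeR R)).
Proof. exact: measurable_itv. Qed.

Lemma measurable_explog (f : R -> R) : measurable_fun (Rpos : set R) f ->
  measurable_fun setT (explog f).
Proof.
move=> mf; apply: measurable_funM; first by meas.
apply: (@measurable_comp _ _ _ _ _ _ (Rpos : set R)) => //.
by move=> _ [u _ <-]; rewrite /Rpos/= in_itv/= expR_gt0.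
Qed.

Lemma integrable_sqr_explog (f : R -> R) : measurable_fun (Rpos : set R) f ->
  mu.-integrable (Rpos : set R) (EFin \o (fun t => f t ^+ 2)) ->
  integrableT (fun u => explog f u ^+ 2).
Proof.
move=> mf i.
have mf2 : measurable_fun (Rpos : set R) (fun t => f t ^+ 2) by meas.
have /(_ i) j := (integrable_exp_subst (@ltr01 R) mf2).1.
apply: eq_integrable j => // u _; rewrite /= /explog mul1r exprMn mulrC; congr (_ * _)%:E.
by rewrite expr2 -expRD; congr expR; field.
Qed.

(** Null sets are not transported directly: the integral of [|f - hphi P Q|] is,
    and it vanishes. *)
Lemma ae_explog (f : R -> R) (P Q : R -> R) : h1 P -> h1 Q ->
  measurable_fun (Rpos : set R) f ->
  {ae mu, forall u, explog f u = phi P Q u / (2 * pi)} ->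
  {ae mu, forall t, (Rpos : set R) t -> f t = hphi P Q t}.
Proof.
move=> hP hQ mf fE.
have mh : measurable_fun (Rpos : set R) (fun t => f t - hphi P Q t).
  by apply: measurable_funB => //; apply: measurable_funTS; exact: measurable_hphi.
have mn : measurable_fun (Rpos : set R) (fun t => `|f t - hphi P Q t|) by meas.
have I0 : (\int[mu]_(t in Rpos) `|(f t - hphi P Q t)%:E| = 0)%E.
  have -> : (\int[mu]_(t in Rpos) `|(f t - hphi P Q t)%:E| =
    \int[mu]_u (`|f (1 * expR u) - hphi P Q (1 * expR u)| * (1 * expR u))%:E)%E.
    exact: (integral_exp_subst (@ltr01 R) mn).
  have mi : measurable_fun setT (fun u => (`|f (1 * expR u) - hphi P Q (1 * expR u)| * (1 * expR u))).
    have mc : measurable_fun setT (fun u => (fun t => `|f t - hphi P Q t|) (1 * expR u)).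
      apply: (@measurable_comp _ _ _ _ _ _ (Rpos : set R) (fun t => `|f t - hphi P Q t|)) => //; last by meas.
      by move=> _ [u _ <-]; rewrite /Rpos/= in_itv/= mul1r expR_gt0.
    by apply: measurable_funM => //; meas.
  have H : {ae mu, forall u, (setT : set R) u ->
      (`|f (1 * expR u) - hphi P Q (1 * expR u)| * (1 * expR u))%:E = (cst 0%E : R -> \bar R) u}.
    apply: (@filterS _ _ (ae_filter_ringOfSetsType mu) _ _ _ fE) => u hu _.
    rewrite /= mul1r /hphi expRK -hu /explog mulrA -expRD addNr expR0 mul1r subrr normr0.
    by rewrite mul0r.
  rewrite -[RHS](@integral0 _ (measurableTypeR R) _ mu setT).
  by apply: ae_eq_integral => //; exact/measurable_EFinP.
have me : measurable_fun (Rpos : set R) (fun t => (f t - hphi P Q t)%:E) by exact/measurable_EFinP.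
have := (ae_eq_integral_abs mu mRpos me).1 I0.
by apply: (@filterS _ _ (ae_filter_ringOfSetsType mu)) => t ht /ht [] /eqP; rewrite subr_eq0 => /eqP.
Qed.

(** The weight [t ^ (- 1/2) dt] becomes [exp (u / 2) du], the factor built into
    [explog]. *)
Lemma wtrunc_explog (f1 f2 : R -> R) (k tau : R) :
  measurable_fun (Rpos : set R) f1 -> measurable_fun (Rpos : set R) f2 ->
  \int[mu]_(t in `[expR (- k), expR k])
     (t `^ (2^-1 - 1) * (f1 t * cos (tau * ln t) - f2 t * sin (tau * ln t))) =
  wtrunc (explog f1) (explog f2) k tau.
Proof.
move=> m1 m2.
pose F (t : R) := (expR (- k) <= t <= expR k)%R%:R * (expR ((2^-1 - 1) * ln t) * (f1 t * cos (tau * ln t) - f2 t * sin (tau * ln t))).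
have mF : measurable_fun (Rpos : set R) F.
  have mb : measurable_fun (Rpos : set R) (fun t : R => (expR (- k) <= t <= expR k)%R%:R : R).
    rewrite (_ : (fun t => _) = box (expR (- k)) (expR k)); last by apply/funext => t; rewrite boxE.
    by apply: measurable_funTS; exact: measurable_box.
  have mln : measurable_fun (Rpos : set R) (fun t : R => ln t) by apply: measurable_funTS; exact: measurable_ln.
  by rewrite /F; meas.
transitivity (\int[mu]_(t in Rpos) F t).
  have -> : `[expR (- k), expR k]%classic = (Rpos : set R) `&` `[expR (- k), expR k]%classic.
    apply/seteqP; split => [t|t []//]; rewrite /= /Rpos/= !in_itv/= andbT => /andP[h1 h2].
    by split; [exact: lt_le_trans (expR_gt0 _) h1|rewrite h1 h2].
  rewrite Rintegral_mkcondr; apply: eq_Rintegral => t; rewrite inE /Rpos/= in_itv/= andbT => t0.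
  rewrite patchE /F mem_setE in_itv/=.
  case: (_ <= _ <= _); last by rewrite mul0r.
  by rewrite mul1r /powR gt_eqF.
rewrite (Rintegral_exp_subst (@ltr01 R) mF) /wtrunc Rintegral_win.
apply: eq_Rintegral => u _; rewrite /F mul1r expRK !ler_expR -ler_norml -/(win k u) /explog.
rewrite -!mulrA; congr (_ * _).
have e1 : expR u = expR (u / 2) * expR (u / 2) by rewrite -expRD; congr expR; field.
have e2 : expR ((2^-1 - 1) * u) * expR (u / 2) = 1.
  by rewrite -expRD -[RHS]expR0; congr expR; field.
rewrite [X in _ * (_ * X)]e1.
transitivity (expR ((2^-1 - 1) * u) * expR (u / 2) * (expR (u / 2) * (f1 (expR u) * cos (tau * u) - f2 (expR u) * sin (tau * u)))).
  by ring.
by rewrite e2; ring.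
Qed.

End logarithmic_coordinates.

(** * The transforms of complex-valued functions *)

Local Open Scope complex_scope.

Section complex_limits.
Context {R : realType}.

Lemma complex_cvg (T : Type) (F : set_system T) (FF : Filter F) (A B : T -> R) (a b : R) :
  A @ F --> a -> B @ F --> b ->
  (fun e => (A e +i* B e : R[i]^o)) @ F --> (a +i* b : R[i]^o).
Proof.
move=> Aa Bb; apply/cvgrPdist_lt => -[e e'] /=; rewrite ltcE/= => /andP[/eqP -> e0].
have e2 : 0 < e / 2 by rewrite divr_gt0.
move/cvgrPdist_lt: Aa => /(_ _ e2) Aa; move/cvgrPdist_lt: Bb => /(_ _ e2) Bb.
near=> t.
have ha : `|a - A t| < e / 2 by near: t.
have hb : `|b - B t| < e / 2 by near: t.
rewrite (_ : `|_| = (ComplexField.Normc.normc ((a - A t) +i* (b - B t)))%:C)//.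
rewrite ltcE/= eqxx/=.
apply: le_lt_trans (_ : `|a - A t| + `|b - B t| < _); last first.
  by rewrite (splitr e) ltrD.
rewrite -(@ler_pXn2r _ 2) ?nnegrE ?sqrtr_ge0 ?addr_ge0// sqr_sqrtr ?addr_ge0 ?sqr_ge0//.
rewrite -(real_normK (num_real (a - A t))) -(real_normK (num_real (b - B t))).
rewrite sqrrD lerD2r lerDl mulrn_wge0// mulr_ge0.
Unshelve. all: by end_near.
Qed.

Lemma complex_lim (T : Type) (F : set_system T) (FF : ProperFilter F) (z : T -> R[i]^o) (a b : R) :
  (fun e => complex.Re (z e)) @ F --> a -> (fun e => complex.Im (z e)) @ F --> b ->
  cvg (z e @[e --> F]) /\ lim (z e @[e --> F]) = a +i* b.
Proof.
move=> Aa Bb; have h := complex_cvg FF Aa Bb.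
have zh : z e @[e --> F] --> (a +i* b : R[i]^o).
  rewrite (_ : z = (fun e => (complex.Re (z e) +i* complex.Im (z e) : R[i]^o)))//.
  by apply/funext => e; case: (z e).
by split; [apply/cvg_ex; exists (a +i* b)|exact: cvg_lim].
Qed.

End complex_limits.

Section transforms_of_represented.
Context {R : realType}.
Notation mu := (@lebesgue_measure R).
Implicit Types (P Q : R -> R) (f : R -> R[i]).

(** The inverse Mellin transform of [P + i Q], as [mellin_inv_chphi] shows. *)
Definition chphi P Q (t : R) : R[i] := hphi P Q t +i* hphi Q (fun u => - P u) t.

(** Almost everywhere is enough for the integral transforms, and it is all that
    holds for a given [f] in L2. *)
Definition represented f P Q : Prop :=
  [/\ cmeasurable_fun Rpos f,
    {ae mu, forall t : R, (Rpos : set R) t -> complex.Re (f t) = hphi P Q t} &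
    {ae mu, forall t : R, (Rpos : set R) t -> complex.Im (f t) = hphi Q (fun u => - P u) t}].

Lemma represented_chphi f P Q : h1 P -> h1 Q ->
  (forall t, 0 < t -> f t = chphi P Q t) -> represented f P Q.
Proof.
move=> hP hQ fE; have pos (t : R) : (Rpos : set R) t -> 0 < t by rewrite /Rpos/= in_itv/= andbT.
have hN := h1N hP; split.
- split.
  + apply: (@eq_measurable_fun _ _ _ _ _ (hphi P Q)).
      by move=> t; rewrite inE => /pos t0; rewrite fE.
    by apply: measurable_funTS; exact: measurable_hphi.
  + apply: (@eq_measurable_fun _ _ _ _ _ (hphi Q (fun u => - P u))).
      by move=> t; rewrite inE => /pos t0; rewrite fE.
    by apply: measurable_funTS; exact: measurable_hphi.
- by apply: aeW => t /pos t0; rewrite fE.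
- by apply: aeW => t /pos t0; rewrite fE.
Qed.

Let ReMr (x : R) (z : R[i]) : complex.Re (x%:C * z) = x * complex.Re z.
Proof. by case: z => a b /=; rewrite mul0r subr0. Qed.

Let ImMr (x : R) (z : R[i]) : complex.Im (x%:C * z) = x * complex.Im z.
Proof. by case: z => a b /=; rewrite mul0r addr0. Qed.

Let divC (z : R[i]) (x : R) : z / x%:C = x^-1%:C * z.
Proof. by rewrite mulrC -fmorphV. Qed.

(** The Hilbert transform of a function represented by [P + i Q] is represented,
    at every point, by [- i ptanh * (P + i Q)]; in particular it can be applied
    again. *)
Lemma hilbert_represented f P Q (x : R) : h1 P -> h1 Q -> represented f P Q -> 0 < x ->
  hilbert_exists f x /\
  hilbert f x = chphi (fun t => ptanh t * Q t) (fun t => - (ptanh t * P t)) x.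
Proof.
move=> hP hQ [[mre mim] fre fim] x0; have hN := h1N hP.
have rE t : complex.Re (hilbert_integrand f x t) = complex.Re (f t) / (t - x).
  by rewrite /hilbert_integrand divC ReMr mulrC.
have iE t : complex.Im (hilbert_integrand f x t) = complex.Im (f t) / (t - x).
  by rewrite /hilbert_integrand divC ImMr mulrC.
have [lim_ex lim_val] : cvg (hilbert_trunc f x e @[e --> 0^'+]) /\
    lim (hilbert_trunc f x e @[e --> 0^'+]) =
    chphi (fun t => ptanh t * Q t) (fun t => - (ptanh t * P t)) x.
  apply: complex_lim.
  - rewrite /hilbert_trunc /cintegral/=.
    under eq_fun => e do under eq_Rintegral => t _ do rewrite rE.
    exact: (truncated_hilbert_cvg hP hQ mre fre x0).
  - rewrite /hilbert_trunc /cintegral/=.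
    under eq_fun => e do under eq_Rintegral => t _ do rewrite iE.
    have := truncated_hilbert_cvg hQ hN mim fim x0.
    have -> : (fun t => ptanh t * - P t) = (fun t => - (ptanh t * P t)).
      by apply/funext => t; rewrite mulrN.
    by [].
split => //; split => // e e0; split.
- under eq_fun => t do rewrite rE.
  exact: (truncated_hilbert_exp hP hQ mre fre x0 e0).1.
- under eq_fun => t do rewrite iE.
  exact: (truncated_hilbert_exp hQ hN mim fim x0 e0).1.
Qed.

Lemma stieltjes_represented f P Q (x : R) : h1 P -> h1 Q -> represented f P Q -> 0 < x ->
  cintegrable Rpos (stieltjes2_integrand f x) /\
  stieltjes2 f x = chphi (fun t => (pi ^+ 2 - ptanh t ^+ 2) * P t)
                         (fun t => (pi ^+ 2 - ptanh t ^+ 2) * Q t) x.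
Proof.
move=> hP hQ [[mre mim] fre fim] x0; have hN := h1N hP.
have rE t : complex.Re (stieltjes2_integrand f x t) = stieltjes2_kernel x t * complex.Re (f t).
  by rewrite /stieltjes2_integrand ReMr.
have iE t : complex.Im (stieltjes2_integrand f x t) = stieltjes2_kernel x t * complex.Im (f t).
  by rewrite /stieltjes2_integrand ImMr.
have [i1 v1] := stieltjes_exp hP hQ mre fre x0.
have [i2 v2] := stieltjes_exp hQ hN mim fim x0.
split.
  split; [under eq_fun => t do rewrite rE|under eq_fun => t do rewrite iE] => //.
rewrite /stieltjes2 /cintegral /chphi.
under eq_Rintegral => t _ do rewrite rE.
under [X in _ +i* X]eq_Rintegral => t _ do rewrite iE.
rewrite v1 v2; congr (_ +i* hphi _ _ _).
by apply/funext => t; rewrite mulrN.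
Qed.

End transforms_of_represented.

(** * The Mellin transform on the critical line *)

Local Open Scope complex_scope.

Section mellin_line.
Context {R : realType}.
Notation mu := (@lebesgue_measure R).
Notation integrableT f := (mu.-integrable setT (EFin \o f)).
Implicit Types (P Q : R -> R) (f : R -> R[i]) (G : R[i] -> R[i]).

Lemma phi_lin (c : R) P Q P' Q' y : h1 P -> h1 Q -> h1 P' -> h1 Q' ->
  phi (fun t => c * P t + P' t) (fun t => c * Q t + Q' t) y = c * phi P Q y + phi P' Q' y.
Proof.
move=> hP hQ hP' hQ'; rewrite /phi.
have i1 := integrable_phi hP hQ y; have i2 := integrable_phi hP' hQ' y.
rewrite -RintegralZl// -RintegralD//; last exact: integrable_fZl.
by apply: eq_Rintegral => t _; ring.
Qed.

Lemma chphi_lin (c : R) P Q P' Q' (x : R) : h1 P -> h1 Q -> h1 P' -> h1 Q' ->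
  chphi (fun t => c * P t + P' t) (fun t => c * Q t + Q' t) x =
  c%:C * chphi P Q x + chphi P' Q' x.
Proof.
move=> hP hQ hP' hQ'; have hN := h1N hP; have hN' := h1N hP'.
have -> : c%:C * chphi P Q x = (c * hphi P Q x) +i* (c * hphi Q (fun u => - P u) x).
  by rewrite /chphi; apply/eqP; rewrite eq_complex/= !mul0r subr0 addr0 !eqxx.
apply/eqP; rewrite eq_complex/=; apply/andP; split; apply/eqP; rewrite /hphi.
  by rewrite phi_lin//; ring.
have -> : (fun u => - (c * P u + P' u)) = (fun u => c * - P u + - P' u).
  by apply/funext => u; ring.
by rewrite phi_lin//; ring.
Qed.

Let P_ G (tau : R) : R := complex.Re (G (sigma tau)).
Let Q_ G (tau : R) : R := complex.Im (G (sigma tau)).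

Let normc2 (z : R[i]) : ComplexField.Normc.normc z ^+ 2 = complex.Re z ^+ 2 + complex.Im z ^+ 2.
Proof. by case: z => a b /=; rewrite sqr_sqrtr// addr_ge0// sqr_ge0. Qed.

Let measurable_normc2 (D : set R) (g : R -> R[i]) : cmeasurable_fun D g ->
  measurable_fun D (fun t => ComplexField.Normc.normc (g t) ^+ 2).
Proof. by move=> [m1 m2]; under eq_fun do rewrite normc2; meas. Qed.

Lemma in_L2_integrable (D : set R) (g : R -> R[i]) : measurable (D : set (measurableTypeR R)) ->
  in_L2 D g ->
  mu.-integrable D (EFin \o (fun t => complex.Re (g t) ^+ 2 + complex.Im (g t) ^+ 2)).
Proof.
move=> mD [mg fin].
apply: (@eq_integrable _ _ _ mu D mD (fun t => (ComplexField.Normc.normc (g t) ^+ 2)%:E)).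
  by move=> t _; rewrite /= normc2.
apply/integrableP; split; first by apply/measurable_EFinP; exact: measurable_normc2.
apply: le_lt_trans fin; rewrite /sqr_L2norm le_eqVlt; apply/orP; left; apply/eqP.
by apply: eq_integral => t _; rewrite /= ger0_norm// sqr_ge0.
Qed.

Lemma in_L2_integrable_sqr (D : set R) (g : R -> R[i]) : measurable (D : set (measurableTypeR R)) ->
  in_L2 D g -> mu.-integrable D (EFin \o (fun t => complex.Re (g t) ^+ 2)) /\
    mu.-integrable D (EFin \o (fun t => complex.Im (g t) ^+ 2)).
Proof.
move=> mD g2; have i := in_L2_integrable mD g2; have [m1 m2] := g2.1.
split; apply: (integrable_le _ _ i) => //; try by meas.
  by move=> t _; rewrite ger0_norm ?sqr_ge0// lerDl sqr_ge0.
by move=> t _; rewrite ger0_norm ?sqr_ge0// lerDr sqr_ge0.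
Qed.

(** [|s G s| ^ 2 = (1/4 + t ^ 2) (P ^ 2 + Q ^ 2)] at [s = 1/2 + i t]. *)
Lemma h1_sigma G : cmeasurable_fun setT (G \o sigma) -> in_L2_sigma (fun s => s * G s) ->
  h1 (P_ G) /\ h1 (Q_ G).
Proof.
move=> [m1 m2] s2; have i := in_L2_integrable (@measurableT _ (measurableTypeR R)) s2.
have sE tau : complex.Re (sigma tau * G (sigma tau)) ^+ 2 + complex.Im (sigma tau * G (sigma tau)) ^+ 2 =
    (4^-1 + tau ^+ 2) * (P_ G tau ^+ 2 + Q_ G tau ^+ 2).
  by rewrite /P_ /Q_ /sigma; case: (G _) => a b /=; field.
have i4 := integrable_fZl measurableT 4 i.
have bound (a b t : R) : (1 + t ^+ 2) * a ^+ 2 <= 4 * ((4^-1 + t ^+ 2) * (a ^+ 2 + b ^+ 2)).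
  have := sqr_ge0 a; have := sqr_ge0 b; have := sqr_ge0 t.
  move: (t ^+ 2) (a ^+ 2) (b ^+ 2) => T A B; nra.
have D0 (t : R) : 0 <= 1 + t ^+ 2 by rewrite addr_ge0// sqr_ge0.
split; split => //.
- apply: (integrable_le _ _ i4) => //; first by have m1' : measurable_fun setT (P_ G) := m1; meas.
  by move=> t _ /=; rewrite sE (ger0_norm (mulr_ge0 (D0 t) (sqr_ge0 _))); exact: bound.
- apply: (integrable_le _ _ i4) => //; first by have m2' : measurable_fun setT (Q_ G) := m2; meas.
  by move=> t _ /=; rewrite sE (addrC (P_ G t ^+ 2)) (ger0_norm (mulr_ge0 (D0 t) (sqr_ge0 _))); exact: bound.
Qed.

Lemma mellin_inv_chphi G (x : R) : h1 (P_ G) -> h1 (Q_ G) -> 0 < x ->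
  mellin_inv G x = chphi (P_ G) (Q_ G) x.
Proof.
move=> hP hQ x0; have hN := h1N hP.
have i0 : 'i%C != 0 :> R[i] by rewrite eq_complex/= eqxx oner_eq0.
have pi0 : (2 * pi)%:C != 0 :> R[i].
  by rewrite eq_complex/= eqxx andbT mulf_neq0// gt_eqF// pi_gt0.
have e : expR (- (ln x / 2)) = x `^ (- 2^-1).
  by rewrite /powR gt_eqF//; congr expR; rewrite mulNr mulrC.
rewrite /mellin_inv /integral_sigma.
have -> : cintegral setT ((fun s => G s * cpow x (- s)) \o sigma) =
  (x `^ (- 2^-1) * phi (P_ G) (Q_ G) (ln x)) +i* (x `^ (- 2^-1) * phi (Q_ G) (fun t => - P_ G t) (ln x)).
  rewrite /cintegral /phi -!RintegralZl//.
  - congr (_ +i* _); apply: eq_Rintegral => t _; rewrite /= /P_ /Q_ /cpow /sigma; case: (G _) => a b /=.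
      by rewrite mulNr cosN sinN; ring.
    by rewrite mulNr cosN sinN; ring.
  - exact: (integrable_phi hQ hN).
  - exact: (integrable_phi hP hQ).
set a := phi _ _ _; set b := phi _ _ _.
have -> : 2 * (pi : R)%:C * 'i%C = (2 * pi)%:C * 'i%C :> R[i].
  by rewrite rmorphM/= rmorph_nat.
rewrite invfM -mulrA mulKf// -fmorphV /chphi /hphi e -/a -/b.
apply/eqP; rewrite eq_complex/= !mul0r subr0 addr0; apply/andP.
by split; apply/eqP; ring.
Qed.

(** Fourier inversion along the windows [exp (- k), exp k]. The L2 distances to
    the limit tend to [0] but the first of them may be infinite, which is why the
    windows start at some [N]. The imaginary part of [f] is the real part of
    [- i f], whose transform is [Q - i P]. *)
Lemma mellin_represented f G : in_L2 Rpos f -> is_mellin f G ->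
  in_L2_sigma (fun s => s * G s) -> represented f (P_ G) (Q_ G).
Proof.
move=> f2 [G2 Gcvg] sG2.
have mRpos : measurable (Rpos : set (measurableTypeR R)) by exact: measurable_itv.
have [mre mim] := f2.1; have [ire iim] := in_L2_integrable_sqr mRpos f2.
have [mP mQ] := G2.1; have [hP hQ] := h1_sigma G2.1 sG2; have hN := h1N hP.
pose f1 t := complex.Re (f t); pose f2' t := complex.Im (f t).
pose g1 := explog f1; pose g2 := explog f2'.
have mg1 : measurable_fun setT g1 by exact: measurable_explog.
have mg2 : measurable_fun setT g2 by exact: measurable_explog.
have ig1 : integrableT (fun u => g1 u ^+ 2) by exact: integrable_sqr_explog.
have ig2 : integrableT (fun u => g2 u ^+ 2) by exact: integrable_sqr_explog.
have mN1 : measurable_fun setT (fun u => - g1 u) by meas.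
have iN1 : integrableT (fun u => (- g1 u) ^+ 2).
  by apply: eq_integrable ig1 => // u _; rewrite /= sqrrN.
have mN2 : measurable_fun setT (fun u => - g2 u) by meas.
have N1E : explog (fun t => - f1 t) = (fun u => - g1 u).
  by apply/funext => u; rewrite /explog mulrN.
pose p k t := wtrunc g1 g2 k t - P_ G t.
pose q k t := wtrunc g2 (fun u => - g1 u) k t - Q_ G t.
have truncE (k t : R) : mellin_trunc f (expR (- k)) (expR k) (sigma t) - G (sigma t) = p k t +i* q k t.
  have -> : mellin_trunc f (expR (- k)) (expR k) (sigma t) =
     wtrunc g1 g2 k t +i* wtrunc g2 (fun u => - g1 u) k t.
    rewrite /g1 /g2 -N1E -!wtrunc_explog//; last by meas.
    rewrite /mellin_trunc /cintegral; congr (_ +i* _); apply: eq_Rintegral => u _;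
      rewrite /f1 /f2' /cpow /sigma; case: (f u) => a b /=; rewrite subr0; ring.
  by rewrite /p /q /P_ /Q_; case: (G _).
pose E (n : nat) := (\int[mu]_t (p n%:R t ^+ 2 + q n%:R t ^+ 2)%:E)%E.
have E_cvg : E n @[n --> \oo] --> 0%E.
  have lim : (expR (- n%:R : R), expR (n%:R : R)) @[n --> \oo] --> ((0 : R)^'+, +oo).
    apply: cvg_pair.
      move=> A [eps /= e0 He].
      have c0 : expR (- n%:R) @[n --> \oo] --> (0 : R) := cvg_comp _ _ cvgr_idn (@cvgr_expR R).
      move/cvgrPdist_lt: c0 => /(_ _ e0); apply: filterS => n hn.
      by apply: He => //; exact: expR_gt0.
    apply/cvgryPge => A; move/cvgryPge: (@cvgr_idn R) => /(_ A).
    apply: filterS => n An; apply: le_trans An _; apply: le_trans (expR_ge1Dx _).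
    by rewrite lerDr.
  have h := cvg_comp _ _ lim Gcvg.
  apply: cvg_trans h; apply: near_eq_cvg; apply: nearW => n /=.
  rewrite /sqr_L2norm /E; apply: eq_integral => t _.
  by rewrite truncE normc2.
have mpq n : measurable_fun setT (fun t => p n%:R t ^+ 2 + q n%:R t ^+ 2).
  have m1 := measurable_wtrunc mg1 mg2 ig1 ig2 n%:R.
  have m2 := measurable_wtrunc mg2 mN1 ig2 iN1 n%:R.
  have mP' : measurable_fun setT (P_ G) := mP; have mQ' : measurable_fun setT (Q_ G) := mQ.
  by rewrite /p /q; meas.
have pq_ge0 n t : 0 <= p n%:R t ^+ 2 + q n%:R t ^+ 2 by rewrite addr_ge0// sqr_ge0.
have [N _ NE] : \forall n \near \oo, (E n < +oo)%E.
  apply: (E_cvg [set z | (z < +oo)%E]); apply: open_ereal_lt'; exact: ltry.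
pose k n : R := (n + N)%:R.
have ipq n : integrableT (fun t => p (k n) t ^+ 2 + q (k n) t ^+ 2).
  apply/integrableP; split; first by apply/measurable_EFinP; exact: mpq.
  have En : (E (n + N)%N < +oo)%E by apply: NE; exact: leq_addl.
  apply: le_lt_trans En.
  rewrite le_eqVlt; apply/orP; left; apply/eqP.
  by apply: eq_integral => t _; rewrite /= ger0_norm//; exact: pq_ge0.
have pq0 : \int[mu]_t (p (k n) t ^+ 2 + q (k n) t ^+ 2) @[n --> \oo] --> (0 : R).
  have Es : E (n + N)%N @[n --> \oo] --> 0%E by rewrite (cvg_shiftn N E).
  rewrite /Rintegral; apply: (@fine_cvg _ _ _ _ (fun n => E (n + N)%N)).
  exact: Es.
have k_cvg : k n @[n --> \oo] --> +oo.
  by rewrite /k (cvg_shiftn N (fun n => n%:R : R)); exact: cvgr_idn.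
split => //.
- apply: ae_explog => //; exact: (fourier_inversion hP hQ mg1 mg2 ig1 ig2 k_cvg ipq pq0).
- apply: ae_explog => //.
  have qpE n t : (wtrunc g2 (fun u => - g1 u) (k n) t - Q_ G t) ^+ 2 +
      (wtrunc (fun u => - g1 u) (fun u => - g2 u) (k n) t - - P_ G t) ^+ 2 =
      p (k n) t ^+ 2 + q (k n) t ^+ 2.
    have -> : wtrunc (fun u => - g1 u) (fun u => - g2 u) (k n) t = - wtrunc g1 g2 (k n) t.
      have i := integrable_wtrunc mg1 mg2 ig1 ig2 (k n) t; move: i.
      rewrite /wtrunc; move: (k n) => kn i; rewrite -[RHS]mulN1r -RintegralZl//.
      by apply: eq_Rintegral => u _; rewrite mulN1r opprB mulNr mulNr opprK addrC.
    by rewrite /p /q; ring.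
  apply: (fourier_inversion hQ hN mg2 mN1 ig2 iN1 k_cvg).
  + by move=> n; apply: eq_integrable (ipq n) => // t _; rewrite /= qpE.
  + by under eq_fun => n do under eq_Rintegral => t _ do rewrite qpE.
Qed.

End mellin_line.

(** * The square of the Hilbert transform *)

Unset Implicit Arguments.
Local Open Scope complex_scope.

Theorem corollary1 (R : realType) (f : R -> R[i]) (fM : R[i] -> R[i])
    (f_L2 : in_L2 Rpos f) (f_mellin : is_mellin f fM)
    (sfM_L2 : in_L2_sigma (fun s => s * fM s)) (x : R) (x_gt0 : 0 < x) :
  [/\ hilbert_exists f x, hilbert_exists (hilbert f) x,
      cintegrable Rpos (stieltjes2_integrand f x) &
      hilbert (hilbert f) x =
        stieltjes2 f x - (pi ^+ 2)%:C * mellin_inv fM x].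
Proof.
pose P tau := complex.Re (fM (sigma tau)); pose Q tau := complex.Im (fM (sigma tau)).
have [hP hQ] : h1 P /\ h1 Q := h1_sigma f_mellin.1.1 sfM_L2.
have rep : represented f P Q := mellin_represented f_L2 f_mellin sfM_L2.
have hMQ := h1_ptanh hQ; have hMP := h1N (h1_ptanh hP).
have Hf t : 0 < t -> hilbert f t = chphi (fun u => ptanh u * Q u) (fun u => - (ptanh u * P u)) t.
  by move=> t0; exact: (hilbert_represented hP hQ rep t0).2.
have repH := represented_chphi hMQ hMP Hf.
have [ex1 _] := hilbert_represented hP hQ rep x_gt0.
have [ex2 ->] := hilbert_represented hMQ hMP repH x_gt0.
have [iS ->] := stieltjes_represented hP hQ rep x_gt0.
split => //.
rewrite (mellin_inv_chphi hP hQ x_gt0).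
have hMMP := h1_ptanh hMP; have hMMQ := h1N (h1_ptanh hMQ).
rewrite -[LHS](addrK ((pi ^+ 2)%:C * chphi P Q x)) [X in X - _]addrC -(chphi_lin _ _ hP hQ hMMP hMMQ).
by congr (chphi _ _ _ - _); apply/funext => t; ring.
Qed.
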